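(* Let $A$ be a non-positive DG-ring. For any $I \in \operatorname{Inj}(A)$, the left $\mathrm{H}^0(A)$-module $\mathrm{H}^0(I)$ is injective, and the functor $$\mathrm{H}^0(-):\operatorname{Inj}(A) \to \operatorname{Inj}(\mathrm{H}^0(A))$$ is an equivalence of categories.
   Context: Rings are associative and unital; modules and DG-modules are left (DG-)modules. A DG-ring is a $\mathbb{Z}$-graded ring $A=\bigoplus_n A^n$ with a $\mathbb{Z}$-linear differential $d$ of degree $+1$, $d\circ d=0$, satisfying $d(ab)=d(a)b+(-1)^i a\,d(b)$ for $a\in A^i$. It is non-positive if $A^i=0$ for all $i>0$; then $\mathrm{H}^0(A)$ is a ring. $\mathsf{D}(A)$ is the derived category of left DG-modules over $A$, and $\mathsf{D}^{\mathrm{b}}(A)$ is its full subcategory of DG-modules with bounded cohomology. Cohomology gives functors $\mathrm{H}^n:\mathsf{D}(A)\to \operatorname{Mod}(\mathrm{H}^0(A))$. For $N\in\mathsf{D}(A)$, $\inf(N)=\inf\{n\mid \mathrm{H}^n(N)\neq 0\}$, and $\operatorname{Ext}^i_A(N,M)=\mathrm{H}^i(\mathrm{R}\operatorname{Hom}_A(N,M))$. The injective dimension of $M\in\mathsf{D}(A)$ is $\operatorname{inj\,dim}_A(M)=\inf\{n\in\mathbb{Z}\mid \operatorname{Ext}^i_A(N,M)=0 \text{ for any } N\in\mathsf{D}^{\mathrm{b}}(A) \text{ and any } i>n-\inf(N)\}$. $\operatorname{Inj}(A)$ is the full subcategory of $\mathsf{D}(A)$ consisting of those $M$ such that either $M\cong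 0$, or $\inf(M)=0$ and $\operatorname{inj\,dim}_A(M)=0$. For a ring (a DG-ring concentrated in degree $0$), $\operatorname{Inj}$ is identified with the category of injective left modules. *)

(* Defs.v *)
From HB Require Import structures.
From mathcomp Require Import all_boot all_order all_algebra.
From mathcomp Require Import generic_quotient ring_quotient.
From mathcomp Require Import boolp classical_sets constructive_ereal.

Set Implicit Arguments.
Unset Strict Implicit.
Unset Printing Implicit Defensive.

Import Order.TTheory GRing.Theory Num.Theory.
Local Open Scope ring_scope.

Record category := Category {
  obj :> Type;
  hom : obj -> obj -> Type;
  idm : forall x, hom x x;
  compm : forall x y z, hom y z -> hom x y -> hom x z;
  comp1m : forall x y (f : hom x y), compm (idm y) f = f;
  compm1 : forall x y (f : hom x y), compm f (idm x) = f;
  compmA : forall x y z t (h : hom z t) (g : hom y z) (f : hom x y),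
    compm h (compm g f) = compm (compm h g) f }.

Arguments hom {c}.
Arguments idm {c}.
Arguments compm {c x y z}.

Definition inverse_of (C : category) (x y : C) (f : hom x y) (g : hom y x) :=
  compm g f = idm x /\ compm f g = idm y.

Definition is_iso (C : category) (x y : C) (f : hom x y) :=
  exists g, inverse_of f g.

Definition isomorphic (C : category) (x y : C) :=
  exists f : hom x y, is_iso f.

Record functor (C D : category) := Functor {
  fobj :> C -> D;
  fmap : forall x y, hom x y -> hom (fobj x) (fobj y);
  fmap1 : forall x, fmap (idm x) = idm (fobj x);
  fmapM : forall x y z (g : hom y z) (f : hom x y),
    fmap (compm g f) = compm (fmap g) (fmap f) }.

Arguments fmap {C D} _ {x y}.

Definition id_functor (C : category) : functor C C :=
  @Functor C C id (fun _ _ f => f) (fun _ => erefl) (fun _ _ _ _ _ => erefl).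

Definition comp_functor (C D E : category) (G : functor D E) (F : functor C D) :
  functor C E.
Proof.
apply: (@Functor C E (fun x => G (F x)) (fun x y f => fmap G (fmap F f))).
- by move=> x; rewrite !fmap1.
- by move=> x y z g f; rewrite !fmapM.
Defined.

Definition naturally_isomorphic (C D : category) (F G : functor C D) :=
  exists eta : forall x, hom (F x) (G x),
    (forall x, is_iso (eta x)) /\
    (forall x y (f : hom x y),
       compm (eta y) (fmap F f) = compm (fmap G f) (eta x)).

Definition is_equivalence (C D : category) (F : functor C D) :=
  exists G : functor D C,
    naturally_isomorphic (comp_functor G F) (id_functor C) /\
    naturally_isomorphic (comp_functor F G) (id_functor D).

Definition full_subcategory (C : category) (P : C -> Prop) : category.
Proof.
apply: (@Category {x : C | P x} (fun x y => hom (sval x) (sval y))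
          (fun x => idm (sval x)) (fun x y z g f => compm g f)).
- by move=> *; apply: comp1m.
- by move=> *; apply: compm1.
- by move=> *; apply: compmA.
Defined.

Definition restrict_functor (C D : category) (F : functor C D)
    (P : C -> Prop) (Q : D -> Prop) (PQ : forall x, P x -> Q (F x)) :
  functor (full_subcategory P) (full_subcategory Q).
Proof.
apply: (@Functor (full_subcategory P) (full_subcategory Q)
  (fun x => exist _ (F (sval x)) (PQ _ (svalP x))) (fun x y f => fmap F f)).
- by move=> x; apply: fmap1.
- by move=> x y z g f; apply: fmapM.
Defined.

Definition classes_of (T : Type) (R : T -> T -> Prop) :=
  {P : T -> Prop | exists x, P = R x}.

Section ClassesOf.
Variables (T : Type) (R : T -> T -> Prop).
Hypotheses (Rrefl : forall x, R x x) (Rsym : forall x y, R x y -> R y x)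
  (Rtrans : forall x y z, R x y -> R y z -> R x z).

Definition class_of (x : T) : classes_of R := exist _ (R x) (ex_intro _ x erefl).

Definition class_repr (c : classes_of R) : T := projT1 (cid (svalP c)).

Lemma class_reprK c : class_of (class_repr c) = c.
Proof.
apply: eq_sig_hprop => [P p q|]; first exact: Prop_irrelevance.
by rewrite /class_repr; case: cid.
Qed.

Lemma class_of_eqP x y : class_of x = class_of y <-> R x y.
Proof.
split=> [[/(congr1 (fun P : T -> Prop => P y)) ->] //|xy].
suff e : R x = R y.
  by apply: eq_sig_hprop => [P p q|//]; apply: Prop_irrelevance.
apply/funext => z; apply/propext; split => [xz|yz].
- exact: Rtrans (Rsym xy) xz.
- exact: Rtrans xy yz.
Qed.

Lemma class_of_repr x : R (class_repr (class_of x)) x.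
Proof. by apply/class_of_eqP; rewrite class_reprK. Qed.
End ClassesOf.

Section Localization.
Variables (C : category) (W : forall x y : C, hom x y -> Prop).

(* Gabriel-Zisman localization: the morphisms of [C[W^-1]] are the formal
   composites of arrows of [C] and of formal inverses of arrows of [W], modulo
   the congruence generated by the category axioms, the functoriality of
   [C -> C[W^-1]], and the fact that [zz_inv s] is inverse to [s]. *)
Inductive zigzag : C -> C -> Type :=
| zz_arr x y of hom x y : zigzag x y
| zz_inv x y (s : hom x y) of W s : zigzag y x
| zz_comp x y z of zigzag y z & zigzag x y : zigzag x z.

Inductive zz_eq : forall x y, zigzag x y -> zigzag x y -> Prop :=
| zz_refl x y (u : zigzag x y) : zz_eq u u
| zz_sym x y (u v : zigzag x y) : zz_eq u v -> zz_eq v u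
| zz_trans x y (u v w : zigzag x y) : zz_eq u v -> zz_eq v w -> zz_eq u w
| zz_cong x y z (u u' : zigzag y z) (v v' : zigzag x y) :
    zz_eq u u' -> zz_eq v v' -> zz_eq (zz_comp u v) (zz_comp u' v')
| zz_assoc x y z t (u : zigzag z t) (v : zigzag y z) (w : zigzag x y) :
    zz_eq (zz_comp u (zz_comp v w)) (zz_comp (zz_comp u v) w)
| zz_id_l x y (u : zigzag x y) : zz_eq (zz_comp (zz_arr (idm y)) u) u
| zz_id_r x y (u : zigzag x y) : zz_eq (zz_comp u (zz_arr (idm x))) u
| zz_arr_comp x y z (g : hom y z) (f : hom x y) :
    zz_eq (zz_comp (zz_arr g) (zz_arr f)) (zz_arr (compm g f))
| zz_inv_l x y (s : hom x y) (Ws : W s) :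
    zz_eq (zz_comp (zz_inv Ws) (zz_arr s)) (zz_arr (idm x))
| zz_inv_r x y (s : hom x y) (Ws : W s) :
    zz_eq (zz_comp (zz_arr s) (zz_inv Ws)) (zz_arr (idm y)).

Definition loc_hom x y := classes_of (@zz_eq x y).

Definition loc_class x y (u : zigzag x y) : loc_hom x y := class_of (@zz_eq x y) u.

Lemma loc_class_eqP x y (u v : zigzag x y) : loc_class u = loc_class v <-> zz_eq u v.
Proof.
apply: class_of_eqP; [exact: zz_refl | exact: zz_sym | exact: zz_trans].
Qed.

Lemma loc_class_repr x y (u : zigzag x y) : zz_eq (class_repr (loc_class u)) u.
Proof.
apply: class_of_repr; [exact: zz_refl | exact: zz_sym | exact: zz_trans].
Qed.

Definition loc_comp x y z (g : loc_hom y z) (f : loc_hom x y) : loc_hom x z :=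
  loc_class (zz_comp (class_repr g) (class_repr f)).

Lemma loc_compE x y z (u : zigzag y z) (v : zigzag x y) :
  loc_comp (loc_class u) (loc_class v) = loc_class (zz_comp u v).
Proof. by apply/loc_class_eqP/zz_cong; apply: loc_class_repr. Qed.

Lemma loc_homW x y (P : loc_hom x y -> Prop) :
  (forall u, P (loc_class u)) -> forall f, P f.
Proof. by move=> Pc f; rewrite -[f]class_reprK; apply: Pc. Qed.

Definition localization : category.
Proof.
apply: (@Category C loc_hom (fun x => loc_class (zz_arr (idm x))) loc_comp).
- by move=> x y; apply: loc_homW => u; rewrite loc_compE; apply/loc_class_eqP/zz_id_l.
- by move=> x y; apply: loc_homW => u; rewrite loc_compE; apply/loc_class_eqP/zz_id_r.
- move=> x y z t; apply: loc_homW => u; apply: loc_homW => v; apply: loc_homW => w.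
  by rewrite !loc_compE; apply/loc_class_eqP/zz_assoc.
Defined.

Variables (D : category) (F : functor C D).
Hypothesis FW : forall x y (s : hom x y), W s -> is_iso (fmap F s).

Fixpoint zz_map x y (u : zigzag x y) : hom (F x) (F y) :=
  match u with
  | zz_arr _ _ f => fmap F f
  | zz_inv _ _ s Ws => projT1 (cid (FW Ws))
  | zz_comp _ _ _ u v => compm (zz_map u) (zz_map v)
  end.

Lemma zz_map_eq x y (u v : zigzag x y) : zz_eq u v -> zz_map u = zz_map v.
Proof.
elim=> {x y u v} //=.
- by move=> x y u v w _ -> _ ->.
- by move=> x y z u u' v v' _ -> _ ->.
- by move=> *; rewrite compmA.
- by move=> *; rewrite fmap1 comp1m.
- by move=> *; rewrite fmap1 compm1.
- by move=> *; rewrite fmapM.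
- by move=> x y s Ws; rewrite fmap1; case: cid => g [].
- by move=> x y s Ws; rewrite fmap1; case: cid => g [].
Qed.

Definition loc_functor : functor localization D.
Proof.
apply: (@Functor localization D F (fun x y f => zz_map (class_repr f))).
- by move=> x; rewrite (zz_map_eq (loc_class_repr _)) /= fmap1.
- by move=> x y z g f; rewrite (zz_map_eq (loc_class_repr _)).
Defined.

End Localization.

Lemma linear_eq (R : pzRingType) (U V : lmodType R) (f g : {linear U -> V}) :
  f =1 g -> f = g.
Proof.
move=> e; have {}e : (f : U -> V) = g by apply/funext.
case: f g e => [f cf] [g cg] /= e; subst g; suff -> : cf = cg by [].
case: cf cg => [[a1] [b1]] [[a2] [b2]].
by rewrite (Prop_irrelevance a1 a2) (Prop_irrelevance b1 b2).
Qed.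

Definition Mod (R : pzRingType) : category.
Proof.
apply: (@Category (lmodType R) (fun U V => {linear U -> V})
  (fun U => idfun) (fun U V X g f => g \o f)).
- by move=> U V f; apply: linear_eq.
- by move=> U V f; apply: linear_eq.
- by move=> U V X Y h g f; apply: linear_eq.
Defined.

Definition injective_module (R : pzRingType) (J : Mod R) :=
  forall (U V : lmodType R) (i : {linear U -> V}) (f : {linear U -> (J : lmodType R)}),
    injective i -> exists g : {linear V -> (J : lmodType R)}, forall x, g (i x) = f x.

Definition InjMod (R : pzRingType) : category :=
  full_subcategory (@injective_module R).

(* A grading [V = \bigoplus_n V^n] is encoded by the projections
   [gpr n : V -> V] onto the summands, so that [V^n] is the set of the [x]
   with [gpr n x = x]. *)

Record complex_on (V : zmodType) := ComplexOn {
  gpr : int -> V -> V;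
  diff : V -> V;
  gprB : forall n x y, gpr n (x - y) = gpr n x - gpr n y;
  gprK : forall m n x, gpr m (gpr n x) = if m == n then gpr n x else 0;
  gpr_sum : forall x, exists s : seq int, uniq s /\ x = \sum_(n <- s) gpr n x;
  diffB : forall x y, diff (x - y) = diff x - diff y;
  diff_deg : forall n x, gpr n x = x -> gpr (n + 1) (diff x) = diff x;
  diffK : forall x, diff (diff x) = 0 }.

Definition homogeneous (V : zmodType) (c : complex_on V) (n : int) (x : V) :=
  gpr c n x = x.

Section Cohomology.
Variables (V : zmodType) (c : complex_on V) (n : int).

Definition cocycle : {pred V} :=
  fun x => `[< homogeneous c n x /\ diff c x = 0 >].

Lemma cocycleP x : reflect (homogeneous c n x /\ diff c x = 0) (x \in cocycle).
Proof. exact: asboolP. Qed.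

Lemma gpr0 m : gpr c m 0 = 0.
Proof. by have := gprB c m 0 0; rewrite !subrr. Qed.

Lemma diff0 : diff c 0 = 0.
Proof. by have := diffB c 0 0; rewrite !subrr. Qed.

Lemma homogeneous0 m : homogeneous c m 0.
Proof. exact: gpr0. Qed.

Lemma homogeneousB m x y :
  homogeneous c m x -> homogeneous c m y -> homogeneous c m (x - y).
Proof. by rewrite /homogeneous gprB => -> ->. Qed.

Lemma homogeneousN m x : homogeneous c m x -> homogeneous c m (- x).
Proof. by move=> hx; rewrite -sub0r; apply: homogeneousB; first exact: homogeneous0. Qed.

Lemma homogeneousD m x y :
  homogeneous c m x -> homogeneous c m y -> homogeneous c m (x + y).
Proof. by move=> hx /homogeneousN hy; rewrite -[y]opprK; apply: homogeneousB. Qed.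

Lemma diffN x : diff c (- x) = - diff c x.
Proof. by rewrite -sub0r diffB diff0 sub0r. Qed.

Lemma diffD x y : diff c (x + y) = diff c x + diff c y.
Proof. by rewrite -{1}[y]opprK diffB diffN opprK. Qed.

Lemma cocycle_zmod_closed : zmod_closed cocycle.
Proof.
split=> [|x y /cocycleP[hx dx] /cocycleP[hy dy]]; apply/cocycleP.
- by split; [exact: homogeneous0 | exact: diff0].
- by split; [exact: homogeneousB | rewrite diffB dx dy subrr].
Qed.
HB.instance Definition _ := GRing.isZmodClosed.Build V cocycle cocycle_zmod_closed.

Definition cocycles := {x : V | x \in cocycle}.
HB.instance Definition _ := SubChoice.on cocycles.
Definition cocycles_mk x (hx : x \in cocycle) : cocycles := exist _ x hx.
HB.instance Definition _ := [SubChoice_isSubZmodule of cocycles by <:].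

Definition coboundary : {pred cocycles} :=
  fun z => `[< exists2 y, homogeneous c (n - 1) y & diff c y = val z >].

Lemma coboundaryP (z : cocycles) :
  reflect (exists2 y, homogeneous c (n - 1) y & diff c y = val z) (z \in coboundary).
Proof. exact: asboolP. Qed.

Lemma coboundary_zmod_closed : zmod_closed coboundary.
Proof.
split=> [|x y /coboundaryP[a ha da] /coboundaryP[b hb db]]; apply/coboundaryP.
- by exists 0; [exact: homogeneous0 | rewrite diff0].
- by exists (a - b); [exact: homogeneousB | rewrite diffB da db].
Qed.
HB.instance Definition _ :=
  GRing.isZmodClosed.Build cocycles coboundary coboundary_zmod_closed.

Definition cohomology := Quotient.quot coboundary.
HB.instance Definition _ := GRing.Zmodule.on cohomology.

Definition coh_class (z : cocycles) : cohomology := \pi_(Quotient.quot coboundary)%qT z.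

Definition coh_repr (h : cohomology) : cocycles := repr (h : Quotient.quot coboundary).

Lemma coh_reprK h : coh_class (coh_repr h) = h.
Proof. exact: reprK. Qed.

Lemma coh_classP z t : coh_class z = coh_class t <->
  exists2 y, homogeneous c (n - 1) y & diff c y = val z - val t.
Proof.
split=> [/eqmodP/coboundaryP//|e]; apply/eqmodP; exact/coboundaryP.
Qed.

Lemma coh_classD z t : coh_class (z + t) = coh_class z + coh_class t.
Proof. exact: raddfD. Qed.

End Cohomology.

Definition isign (R : pzRingType) (i : int) : R := (-1) ^+ `|i|%N.

Record dgRing := DGRing {
  dgr_ring :> pzRingType;
  dgr_cpx : complex_on dgr_ring;
  dgr1 : homogeneous dgr_cpx 0 1;
  dgrM : forall i j a b, homogeneous dgr_cpx i a -> homogeneous dgr_cpx j b ->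
    homogeneous dgr_cpx (i + j) (a * b);
  dgr_leibniz : forall i a b, homogeneous dgr_cpx i a ->
    diff dgr_cpx (a * b) =
    diff dgr_cpx a * b + isign dgr_ring i * a * diff dgr_cpx b }.

Definition nonpositive (A : dgRing) :=
  forall i a, 0 < i -> homogeneous (dgr_cpx A) i a -> a = 0.

Record dgModule (A : dgRing) := DGModule {
  dgm_mod :> lmodType A;
  dgm_cpx : complex_on dgm_mod;
  dgmZ : forall i j (a : A) m,
    homogeneous (dgr_cpx A) i a -> homogeneous dgm_cpx j m ->
    homogeneous dgm_cpx (i + j) (a *: m);
  dgm_leibniz : forall i (a : A) m, homogeneous (dgr_cpx A) i a ->
    diff dgm_cpx (a *: m) =
    diff (dgr_cpx A) a *: m + (isign A i * a) *: diff dgm_cpx m }.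

Definition H (A : dgRing) (n : int) (M : dgModule A) := cohomology (dgm_cpx M) n.
HB.instance Definition _ A n M := GRing.Zmodule.on (@H A n M).

Definition H0 (A : dgRing) := cohomology (dgr_cpx A) 0.
HB.instance Definition _ A := GRing.Zmodule.on (H0 A).

Definition regular_dgModule (A : dgRing) : dgModule A :=
  @DGModule A A^o (dgr_cpx A) (@dgrM A) (@dgr_leibniz A).

Section CohomologyAction.
Variable A : dgRing.
Implicit Types (M : dgModule A) (n : int).

Local Notation Z0 := (cocycles (dgr_cpx A) 0).

Lemma cocycle_actP M n (a : Z0) (m : cocycles (dgm_cpx M) n) :
  (val a : A) *: (val m : M) \in cocycle (dgm_cpx M) n.
Proof.
case/cocycleP: (valP a) => ha da; case/cocycleP: (valP m) => hm dm.
apply/cocycleP; split; first by have := dgmZ ha hm; rewrite add0r.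
by rewrite (dgm_leibniz _ ha) da dm scale0r scaler0 addr0.
Qed.

Definition cocycle_act M n (a : Z0) (m : cocycles (dgm_cpx M) n) :
  cocycles (dgm_cpx M) n := cocycles_mk (cocycle_actP a m).

Definition coh_act M n (a : H0 A) (x : H n M) : H n M :=
  coh_class (cocycle_act (coh_repr a) (coh_repr x)).

Lemma coh_actE M n (a : Z0) (m : cocycles (dgm_cpx M) n) :
  coh_act (coh_class a : H0 A) (coh_class m : H n M) = coh_class (cocycle_act a m).
Proof.
rewrite /coh_act; set a' := coh_repr _; set m' := coh_repr _.
have /coh_classP[b hb db] : coh_class a' = coh_class a by rewrite coh_reprK.
have /coh_classP[y hy dy] : coh_class m' = coh_class m by rewrite coh_reprK.
apply/coh_classP; rewrite /= -/(val a') -/(val m') -/(val a) -/(val m).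
case/cocycleP: (valP a') => ha' da'; case/cocycleP: (valP m) => hm dm.
exists ((b : A) *: (val m : M) + (val a' : A) *: (y : M)).
  apply: homogeneousD.
    by have := dgmZ hb hm; rewrite [0 - 1 + n]addrC addrA addr0.
  by have := dgmZ ha' hy; rewrite add0r.
rewrite diffD (dgm_leibniz _ hb) (dgm_leibniz _ ha') db dy dm da'.
rewrite scaler0 addr0 scale0r add0r /isign expr0 mul1r.
by rewrite scalerBl scalerBr addrC addrA subrK.
Qed.

Lemma cohW (V : zmodType) (c : complex_on V) n (P : cohomology c n -> Prop) :
  (forall z, P (coh_class z)) -> forall h, P h.
Proof. by move=> Pc h; rewrite -[h]coh_reprK; apply: Pc. Qed.

Definition H0_mul (a b : H0 A) : H0 A := @coh_act (regular_dgModule A) 0 a b.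

Lemma coh_actA M n (a b : H0 A) (x : H n M) :
  coh_act a (coh_act b x) = coh_act (H0_mul a b) x.
Proof.
elim/cohW: a => a; elim/cohW: b => b; elim/cohW: x => x.
rewrite /H0_mul coh_actE coh_actE (@coh_actE (regular_dgModule A)) coh_actE.
by congr coh_class; apply: val_inj; rewrite /= scalerA.
Qed.

Lemma coh_actDr M n (a : H0 A) (x y : H n M) :
  coh_act a (x + y) = coh_act a x + coh_act a y.
Proof.
elim/cohW: a => a; elim/cohW: x => x; elim/cohW: y => y.
rewrite -coh_classD !coh_actE -coh_classD; congr coh_class.
by apply: val_inj; rewrite /= scalerDr.
Qed.

Lemma coh_actDl M n (x : H n M) (a b : H0 A) :
  coh_act (a + b) x = coh_act a x + coh_act b x.
Proof.
elim/cohW: a => a; elim/cohW: b => b; elim/cohW: x => x.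
rewrite -coh_classD !coh_actE -coh_classD; congr coh_class.
by apply: val_inj; rewrite /= scalerDl.
Qed.

Lemma cocycle1P : (1 : A) \in cocycle (dgr_cpx A) 0.
Proof.
apply/cocycleP; split; first exact: dgr1.
have := dgr_leibniz 1 (dgr1 A); rewrite /isign expr0 mulr1 mulr1 !mul1r.
by move/esym/eqP; rewrite -subr_eq0 addrK => /eqP.
Qed.

Definition H0_one : H0 A := coh_class (cocycles_mk cocycle1P).

Lemma coh_act1 M n (x : H n M) : coh_act H0_one x = x.
Proof.
elim/cohW: x => x; rewrite coh_actE; congr coh_class.
by apply: val_inj; rewrite /= scale1r.
Qed.

Lemma H0_mulr1 (a : H0 A) : H0_mul a H0_one = a.
Proof.
elim/cohW: a => a; rewrite /H0_mul (@coh_actE (regular_dgModule A)).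
by congr coh_class; apply: val_inj; rewrite /= /GRing.scale /= mulr1.
Qed.

HB.instance Definition _ := GRing.Zmodule_isPzRing.Build (H0 A)
  (@coh_actA (regular_dgModule A) 0) (@coh_act1 (regular_dgModule A) 0) H0_mulr1
  (fun a b x => @coh_actDl (regular_dgModule A) 0 x a b)
  (@coh_actDr (regular_dgModule A) 0).

HB.instance Definition _ M n := GRing.Zmodule_isLmodule.Build (H0 A) (H n M)
  (@coh_actA M n) (@coh_act1 M n) (@coh_actDr M n) (@coh_actDl M n).

End CohomologyAction.

Record dgHom (A : dgRing) (M N : dgModule A) := DGHom {
  dgh_lin :> {linear M -> N};
  dgh_gpr : forall n x, dgh_lin (gpr (dgm_cpx M) n x) = gpr (dgm_cpx N) n (dgh_lin x);
  dgh_diff : forall x, dgh_lin (diff (dgm_cpx M) x) = diff (dgm_cpx N) (dgh_lin x) }.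

Lemma dgHom_eq (A : dgRing) (M N : dgModule A) (f g : dgHom M N) : f =1 g -> f = g.
Proof.
case: f g => [f gf df] [g gg dg] /= /linear_eq e; subst g.
by rewrite (Prop_irrelevance gf gg) (Prop_irrelevance df dg).
Qed.

Definition dgHom_id (A : dgRing) (M : dgModule A) : dgHom M M :=
  @DGHom A M M idfun (fun _ _ => erefl) (fun _ => erefl).

Definition dgHom_comp (A : dgRing) (M N P : dgModule A)
  (g : dgHom N P) (f : dgHom M N) : dgHom M P.
Proof.
apply: (@DGHom A M P (g \o f)).
- by move=> n x /=; rewrite !dgh_gpr.
- by move=> x /=; rewrite !dgh_diff.
Defined.

Definition DGMod (A : dgRing) : category.
Proof.
apply: (@Category (dgModule A) (@dgHom A) (@dgHom_id A) (@dgHom_comp A)).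
- by move=> M N f; apply: dgHom_eq.
- by move=> M N f; apply: dgHom_eq.
- by move=> M N P Q h g f; apply: dgHom_eq.
Defined.

Section CohomologyFunctor.
Variables (A : dgRing) (n : int).

Section Map.
Variables (M N : dgModule A) (f : dgHom M N).

Lemma cocycle_mapP (z : cocycles (dgm_cpx M) n) :
  f (val z) \in cocycle (dgm_cpx N) n.
Proof.
case/cocycleP: (valP z) => hz dz; apply/cocycleP; split.
  by rewrite /homogeneous -dgh_gpr hz.
by rewrite -dgh_diff dz linear0.
Qed.

Definition cocycle_map (z : cocycles (dgm_cpx M) n) : cocycles (dgm_cpx N) n :=
  cocycles_mk (cocycle_mapP z).

Definition H_map_fun (x : H n M) : H n N := coh_class (cocycle_map (coh_repr x)).

Lemma H_mapE z : H_map_fun (coh_class z) = coh_class (cocycle_map z).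
Proof.
rewrite /H_map_fun; set z' := coh_repr _.
have /coh_classP[y hy dy] : coh_class z' = coh_class z by rewrite coh_reprK.
apply/coh_classP; exists (f y); first by rewrite /homogeneous -dgh_gpr hy.
by rewrite -dgh_diff dy linearB.
Qed.

Lemma H_map_linear : linear H_map_fun.
Proof.
move=> a x y; elim/cohW: a => a; elim/cohW: x => x; elim/cohW: y => y.
rewrite [_ *: _]coh_actE -coh_classD !H_mapE [_ *: _]coh_actE -coh_classD.
by congr coh_class; apply: val_inj; rewrite /= linearP.
Qed.
HB.instance Definition _ :=
  GRing.isLinear.Build (H0 A) (H n M) (H n N) *:%R H_map_fun H_map_linear.

Definition H_map : {linear H n M -> H n N} := H_map_fun.
End Map.

Definition H_functor : functor (DGMod A) (Mod (H0 A)).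
Proof.
apply: (@Functor (DGMod A) (Mod (H0 A)) (fun M => H n M) H_map).
- move=> M; apply: linear_eq; apply: cohW => z; rewrite /= H_mapE.
  by congr coh_class; apply: val_inj.
- move=> M N P g f; apply: linear_eq; apply: cohW => z; rewrite /= !H_mapE.
  by congr coh_class; apply: val_inj.
Defined.
End CohomologyFunctor.

Section Derived.
Variable A : dgRing.

Definition quasi_iso (M N : DGMod A) (f : hom M N) :=
  forall n, is_iso (fmap (H_functor A n) f).

(* Quasi-isomorphisms are inverted directly in the category of DG-modules:
   passing first to the homotopy category gives the same localization, as
   homotopy equivalences are quasi-isomorphisms. *)
Definition D : category := localization quasi_iso.

Definition HD (n : int) : functor D (Mod (H0 A)) :=
  loc_functor (F := H_functor A n) (fun M N f qf => qf n).

Definition H_zero (n : int) (M : D) := forall x : H n M, x = 0.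

Definition bounded (M : D) :=
  exists b : nat, forall n : int, (b < `|n|)%N -> H_zero n M.

(* The infimum is taken in [\bar int], hence is [+oo] on the empty set. *)
Definition extinf (S : set int) : \bar int :=
  infimum +oo%E [set (n%:E)%E | n in S]%classic.

Definition inf (M : D) : \bar int := extinf [set n | ~ H_zero n M]%classic.

Definition zero_complex : complex_on 'rV[A]_0.
Proof.
by apply: (@ComplexOn 'rV[A]_0 (fun _ _ => 0) (fun _ => 0)) => *;
  rewrite ?subrr ?if_same //; exists [::]; rewrite big_nil thinmx0.
Defined.

Definition zero_dgModule : dgModule A.
Proof.
by apply: (@DGModule A 'rV[A]_0 zero_complex) => *;
  rewrite /homogeneous [LHS]thinmx0 [RHS]thinmx0.
Defined.

(* [Hom_A(P, M)^i] consists of the additive maps of degree [i] such that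
   [f (a x) = (-1)^(i j) a f(x)] for [a] in [A^j]; its differential is
   [f |-> d o f - (-1)^i f o d]. *)
Definition hom_degree (P M : dgModule A) (i : int) (f : P -> M) : Prop :=
  [/\ forall x y, f (x - y) = f x - f y,
      forall n x, homogeneous (dgm_cpx P) n x -> homogeneous (dgm_cpx M) (n + i) (f x)
    & forall j (a : A) x, homogeneous (dgr_cpx A) j a ->
        f (a *: x) = isign A (i * j) *: (a *: f x)].

Definition hom_diff (P M : dgModule A) (i : int) (f : P -> M) : P -> M :=
  fun x => diff (dgm_cpx M) (f x) - isign A i *: f (diff (dgm_cpx P) x).

Definition H_Hom_zero (i : int) (P M : dgModule A) :=
  forall f : P -> M, hom_degree i f -> hom_diff i f = (fun=> 0) ->
  exists2 g : P -> M, hom_degree (i - 1) g & hom_diff (i - 1) g = f.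

Definition acyclic (M : dgModule A) := forall n, H_zero n M.

Definition K_projective (P : dgModule A) :=
  forall M, acyclic M -> forall i, H_Hom_zero i P M.

(* [Ext^i(N, M) = H^i(RHom(N, M)) = 0], with [RHom(N, M) = Hom_A(P, M)] for a
   K-projective resolution [P] of [N]; the choice of [P] is immaterial. *)
Definition Ext_zero (i : int) (N M : D) :=
  exists P (p : dgHom P N), [/\ K_projective P, quasi_iso p & H_Hom_zero i P M].

Definition inj_dim (M : D) : \bar int :=
  extinf [set n | forall N : D, bounded N ->
    forall i : int, (n%:E - inf N < i%:E)%E -> Ext_zero i N M]%classic.

Definition is_Inj (M : D) :=
  isomorphic M (zero_dgModule : D) \/ inf M = 0%E /\ inj_dim M = 0%E.

Definition Inj : category := full_subcategory is_Inj.

End Derived.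

(* Main.v *)
(* Embed an injective [H0 A]-module [J] into an injective module [X] over the ring
   [Z0] of degree-zero cocycles so that [J] is exactly the part of [X] killed by
   the boundaries. The graded coextension [E = Hom_Z0(A, X)] then satisfies
   [H^0 E = J] and represents [N |-> Hom(H^0 N, J)] on the derived category, where
   all morphisms to [E] are classes of strict ones.
   If [M] is in [Inj A], choose [M -> E] injective on [H^0], with cone [C], and let
   [c >= 0] be such that [H^n C = 0] for [n < c]. As [tau_(<= c) C] is bounded, with
   cohomology in degree [c] only, [Ext^1(tau_(<= c) C, M) = 0], so its map to [C]
   lifts to [E]; hence [H^c E -> H^c C] splits, by the zero map if [c > 0]. For
   [c = 0] this exhibits [H^0 M] as a summand of an injective module; taking then
   [J = H^0 M], it shows inductively that [C] is acyclic, so that [M] and [E] are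
   isomorphic. Conversely, each [E] lies in [Inj A]: the vanishing of [Ext] is read
   off a semi-free resolution. *)

From HB Require Import structures.
From mathcomp Require Import all_boot all_order all_algebra.
From mathcomp Require Import generic_quotient ring_quotient.
From mathcomp Require Import boolp classical_sets functions constructive_ereal.
From mathcomp Require Import zify.
Require Import Defs.

Set Implicit Arguments.
Unset Strict Implicit.
Unset Printing Implicit Defensive.

Import Order.TTheory GRing.Theory Num.Theory.
Local Open Scope ring_scope.

(** * Graded modules and signs *)

(** [H0 A] is a quotient of [Z0] and need not map to [A], so [J] cannot be coextended directly; [Z0]
    does map to [A], and all differentials are linear over it. Over [Z0], however, [J] is in general
    no longer injective, which forces the larger [X]. A degree-zero element of Hom_Z0(A, X) is
    determined by its value at 1, and it is a cocycle when the boundaries kill that value: hence the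
    condition that this part of [X] be [J]. Injectivity of [X] replaces a calculus of fractions. A
    morphism to E is a functional on N^0 that kills boundaries; it extends along a quasi-isomorphism
    because it extends on H^0, and two with the same effect on H^0 differ by a map through a
    contractible module. Ext^1 alone is used on the side of [M]: if N has no cohomology in negative
    degrees then 1 > 0 - inf N, the range where injective dimension 0 gives vanishing. Truncations
    enter because only bounded N may be tested, while the cone and E may be unbounded. *)

Definition subtractive (U V : zmodType) (f : U -> V) :=
  forall x y, f (x - y) = f x - f y.

Section Subtractive.
Variables (U V : zmodType) (f : U -> V).
Hypothesis fB : subtractive f.

Lemma sub_f0 : f 0 = 0.
Proof. by have := fB 0 0; rewrite !subrr. Qed.

Lemma sub_fN x : f (- x) = - f x.
Proof. by rewrite -sub0r fB sub_f0 sub0r. Qed.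

Lemma sub_fD x y : f (x + y) = f x + f y.
Proof. by rewrite -{1}[y]opprK fB sub_fN opprK. Qed.

Lemma sub_f_sum (I : Type) (s : seq I) (F : I -> U) :
  f (\sum_(i <- s) F i) = \sum_(i <- s) f (F i).
Proof. by apply: (big_morph f sub_fD sub_f0). Qed.
End Subtractive.

Definition odd_int (i : int) : bool := odd `|i|%N.

Lemma odd_intD i j : odd_int (i + j) = odd_int i (+) odd_int j.
Proof. by rewrite /odd_int; lia. Qed.

Lemma odd_intN i : odd_int (- i) = odd_int i.
Proof. by rewrite /odd_int abszN. Qed.

Lemma odd_intM i j : odd_int (i * j) = odd_int i && odd_int j.
Proof. by rewrite /odd_int abszM oddM. Qed.

Definition odd_intE := (odd_intD, odd_intN, odd_intM).

(** A sign given by a parity test needs no ring, so it applies to [A], to modules and to [X] alike,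
    and identities between signs become Boolean identities through [odd_intE]. *)
Definition sg (V : zmodType) (i : int) (x : V) : V := if odd_int i then - x else x.

Section Sign.
Variable V : zmodType.
Implicit Types (i j : int) (x y : V).

Lemma sgB i : subtractive (@sg V i).
Proof. by move=> x y; rewrite /sg; case: odd_int => //; rewrite opprD. Qed.

Lemma sgD i x y : sg i (x + y) = sg i x + sg i y.
Proof. exact/sub_fD/sgB. Qed.

Lemma sgN i x : sg i (- x) = - sg i x.
Proof. exact/sub_fN/sgB. Qed.

Lemma sg0 i : sg i 0 = 0 :> V.
Proof. exact/sub_f0/sgB. Qed.

Lemma sg_add i j x : sg (i + j) x = sg i (sg j x).
Proof.
by rewrite /sg odd_intD; case: (odd_int i); case: (odd_int j); rewrite /= ?opprK.
Qed.

Lemma sgK i x : sg i (sg i x) = x.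
Proof. by rewrite /sg; case: odd_int; rewrite ?opprK. Qed.

Lemma sg_even0 x : sg 0 x = x.
Proof. by []. Qed.

Lemma sg1 x : sg 1 x = - x.
Proof. by []. Qed.

Lemma eq_sg i j x : odd_int i = odd_int j -> sg i x = sg j x.
Proof. by rewrite /sg => ->. Qed.

Lemma sg_eq0 i x : sg i x = 0 -> x = 0.
Proof. by move=> /(congr1 (sg i)); rewrite sgK sg0. Qed.
End Sign.

Lemma sub_f_sg (U V : zmodType) (f : U -> V) i x :
  subtractive f -> f (sg i x) = sg i (f x).
Proof. by move=> fB; rewrite /sg; case: odd_int => //; apply: sub_fN. Qed.

Lemma isignE (R : pzRingType) i : isign R i = sg i 1.
Proof. by rewrite /isign -signr_odd /sg /odd_int; case: odd; rewrite ?expr1 ?expr0. Qed.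

Lemma isignM (R : pzRingType) i (a : R) : isign R i * a = sg i a.
Proof. by rewrite isignE /sg; case: odd_int; rewrite ?mulN1r ?mul1r. Qed.

Lemma isignZ (R : pzRingType) (V : lmodType R) i (x : V) : isign R i *: x = sg i x.
Proof. by rewrite isignE /sg; case: odd_int; rewrite ?scaleN1r ?scale1r. Qed.

Lemma sgZl (R : pzRingType) (V : lmodType R) i (a : R) (x : V) :
  sg i a *: x = sg i (a *: x).
Proof. by rewrite /sg; case: odd_int; rewrite ?scaleNr. Qed.

Lemma sgZr (R : pzRingType) (V : lmodType R) i (a : R) (x : V) :
  a *: sg i x = sg i (a *: x).
Proof. by rewrite /sg; case: odd_int; rewrite ?scalerN. Qed.

Lemma sgMl (R : pzRingType) i (a x : R) : sg i a * x = sg i (a * x).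
Proof. by rewrite /sg; case: odd_int; rewrite ?mulNr. Qed.

Section MakeComplex.
Variables (V : zmodType) (g : int -> V -> V) (d : V -> V).
Hypotheses (gB : forall n, subtractive (g n))
  (gK : forall m n x, g m (g n x) = if m == n then g n x else 0)
  (g_fin : forall x, exists s : seq int, forall n, n \notin s -> g n x = 0)
  (g_sep : forall x, (forall n, g n x = 0) -> x = 0)
  (dB : subtractive d) (d_deg : forall n x, g n x = x -> g (n + 1) (d x) = d x)
  (dK : forall x, d (d x) = 0).

(** The difference between [x] and the finite sum of its components has all components zero, so
    [g_sep] kills it. Finiteness and separation are easier to check than the decomposition
    itself. *)
Lemma make_complex_sum x :
  exists s : seq int, uniq s /\ x = \sum_(n <- s) g n x.
Proof.
have [s hs] := g_fin x; exists (undup s); split; first exact: undup_uniq.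
apply/eqP; rewrite -subr_eq0; apply/eqP/g_sep => m.
rewrite gB (sub_f_sum (gB m)).
under eq_bigr do rewrite gK.
have [ms|ms] := boolP (m \in undup s).
  rewrite (bigD1_seq m) ?undup_uniq //= eqxx big1_seq ?addr0 ?subrr //.
  by move=> n /andP[+ _]; rewrite eq_sym => /negbTE ->.
rewrite hs ?sub0r; last by rewrite mem_undup in ms.
rewrite big1_seq ?oppr0 // => n /andP[_ ns]; case: eqP => // e.
by rewrite e ns in ms.
Qed.

Definition make_complex : complex_on V :=
  @ComplexOn V g d gB gK make_complex_sum dB d_deg dK.
End MakeComplex.

Section Grading.
Variables (V : zmodType) (c : complex_on V).
Implicit Types (x y : V) (m n k : int).

Lemma gprD n x y : gpr c n (x + y) = gpr c n x + gpr c n y.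
Proof. exact/sub_fD/gprB. Qed.

Lemma gpr_sg k n x : gpr c n (sg k x) = sg k (gpr c n x).
Proof. exact/sub_f_sg/gprB. Qed.

Lemma diff_sg k x : diff c (sg k x) = sg k (diff c x).
Proof. exact/sub_f_sg/diffB. Qed.

Lemma homogeneous_gpr n x : homogeneous c n (gpr c n x).
Proof. by rewrite /homogeneous gprK eqxx. Qed.

Lemma gpr_homogeneous m n x :
  homogeneous c n x -> gpr c m x = if m == n then x else 0.
Proof. by move=> hx; rewrite -hx gprK hx. Qed.

Lemma homogeneous_sg k n x : homogeneous c n x -> homogeneous c n (sg k x).
Proof. by rewrite /homogeneous gpr_sg => ->. Qed.

Lemma gpr_sep x : (forall n, gpr c n x = 0) -> x = 0.
Proof. by move=> x0; have [s [_ ->]] := gpr_sum c x; rewrite big1. Qed.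

Lemma gpr_ext x y : (forall n, gpr c n x = gpr c n y) -> x = y.
Proof.
by move=> e; apply/eqP; rewrite -subr_eq0; apply/eqP/gpr_sep => n; rewrite gprB e subrr.
Qed.

Lemma gpr_fin x : exists s : seq int, forall n, n \notin s -> gpr c n x = 0.
Proof.
have [s [us ex]] := gpr_sum c x; exists s => n ns; rewrite ex.
rewrite (sub_f_sum (fun x y => gprB c n x y)) big1_seq // => k /andP[_ ks].
by rewrite gprK; case: eqP => // e; rewrite e ks in ns.
Qed.

Lemma gpr_ind (Q : V -> Prop) :
  Q 0 -> (forall x y, Q x -> Q y -> Q (x + y)) ->
  (forall n x, homogeneous c n x -> Q x) -> forall x, Q x.
Proof.
move=> Q0 QD Qh x; have [s [_ ->]] := gpr_sum c x.
by elim/big_rec: _ => // n y _; apply/QD/(Qh n)/homogeneous_gpr.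
Qed.

Lemma homogeneous_diff n x : homogeneous c n x -> homogeneous c (n + 1) (diff c x).
Proof. exact: diff_deg. Qed.

Lemma gpr_diff n x : gpr c (n + 1) (diff c x) = diff c (gpr c n x).
Proof.
elim/gpr_ind: x => [|x y ex ey|k x hx].
- by rewrite gpr0 !diff0 gpr0.
- by rewrite diffD !gprD ex ey diffD.
- rewrite (gpr_homogeneous _ hx) (gpr_homogeneous _ (homogeneous_diff hx)).
  by rewrite (inj_eq (addIr _)); case: eqP; rewrite ?diff0.
Qed.

Lemma gpr_diff' n x : gpr c n (diff c x) = diff c (gpr c (n - 1) x).
Proof. by rewrite -gpr_diff subrK. Qed.

Lemma subtractive_ext (W : zmodType) (f h : V -> W) :
  subtractive f -> subtractive h ->
  (forall n x, homogeneous c n x -> f x = h x) -> f =1 h.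
Proof.
move=> fB hB e; elim/gpr_ind => [|x y ex ey|n x]; last exact: e.
- by rewrite (sub_f0 fB) (sub_f0 hB).
- by rewrite (sub_fD fB) (sub_fD hB) ex ey.
Qed.

(* The sign twist multiplies the component of degree [n] by [(-1)^(k n)]. *)
Definition twist k x : V :=
  \sum_(n <- projT1 (cid (gpr_sum c x))) sg (k * n) (gpr c n x).

Lemma gpr_twist k n x : gpr c n (twist k x) = sg (k * n) (gpr c n x).
Proof.
rewrite /twist; case: cid => s [us ex] /=.
rewrite (sub_f_sum (fun x y => gprB c n x y)).
under eq_bigr do rewrite gpr_sg gprK.
have [ns|ns] := boolP (n \in s).
  rewrite (bigD1_seq n) //= eqxx big1_seq ?addr0 // => m /andP[+ _].
  by rewrite eq_sym => /negbTE ->; rewrite sg0.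
rewrite big1_seq => [|m /andP[_ ms]]; last first.
  by case: eqP => [e|_]; [rewrite e ms in ns|rewrite sg0].
suff -> : gpr c n x = 0 by rewrite sg0.
rewrite ex (sub_f_sum (fun x y => gprB c n x y)) big1_seq // => m /andP[_ ms].
by rewrite gprK; case: eqP => // e; rewrite e ms in ns.
Qed.

Lemma twistB k : subtractive (twist k).
Proof. by move=> x y; apply: gpr_ext => n; rewrite gprB !gpr_twist gprB sgB. Qed.

Lemma twistD k x y : twist k (x + y) = twist k x + twist k y.
Proof. exact/sub_fD/twistB. Qed.

Lemma twist0 k : twist k 0 = 0.
Proof. exact/sub_f0/twistB. Qed.

Lemma twistN k x : twist k (- x) = - twist k x.
Proof. exact/sub_fN/twistB. Qed.

Lemma twist_homogeneous k n x : homogeneous c n x -> twist k x = sg (k * n) x.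
Proof.
move=> hx; apply: gpr_ext => m; rewrite gpr_twist gpr_sg (gpr_homogeneous _ hx).
by case: eqP => [->|]; rewrite ?sg0.
Qed.

Lemma homogeneous_twist k n x : homogeneous c n x -> homogeneous c n (twist k x).
Proof. by move=> hx; rewrite (twist_homogeneous _ hx); apply: homogeneous_sg. Qed.

Lemma twistK k x : twist k (twist k x) = x.
Proof. by apply: gpr_ext => n; rewrite !gpr_twist sgK. Qed.

Lemma twist_by0 x : twist 0 x = x.
Proof. by apply: gpr_ext => n; rewrite gpr_twist mul0r. Qed.

Lemma twist_diff k x : twist k (diff c x) = sg k (diff c (twist k x)).
Proof.
apply: gpr_ext => n; rewrite gpr_twist gpr_sg !gpr_diff' gpr_twist diff_sg -sg_add.
by apply: eq_sg; rewrite !odd_intE; case: odd_int; case: odd_int.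
Qed.
End Grading.

Section DGModuleBasics.
Variables (A : dgRing) (M : dgModule A).
Local Notation cA := (dgr_cpx A).
Local Notation cM := (dgm_cpx M).

Lemma gpr_scale i (a : A) n (x : M) :
  homogeneous cA i a -> gpr cM n (a *: x) = a *: gpr cM (n - i) x.
Proof.
move=> ha; elim/(@gpr_ind _ cM): x => [|x y ex ey|k x hx].
- by rewrite scaler0 !gpr0 scaler0.
- by rewrite scalerDr !gprD ex ey scalerDr.
- rewrite (gpr_homogeneous _ (dgmZ ha hx)) (gpr_homogeneous _ hx).
  by rewrite subr_eq addrC; case: eqP; rewrite ?scaler0.
Qed.

Lemma diff_scale i (a : A) (x : M) : homogeneous cA i a ->
  diff cM (a *: x) = diff cA a *: x + sg i (a *: diff cM x).
Proof. by move=> ha; rewrite (dgm_leibniz _ ha) isignM sgZl. Qed.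

Lemma twist_scale k i (a : A) (x : M) : homogeneous cA i a ->
  twist cM k (a *: x) = sg (k * i) (a *: twist cM k x).
Proof.
move=> ha; apply: (@gpr_ext _ cM) => n.
rewrite gpr_twist gpr_sg !(gpr_scale _ _ ha) gpr_twist sgZr -sg_add.
by apply: eq_sg; rewrite !odd_intE; case: (odd_int k); case: (odd_int n); case: (odd_int i).
Qed.

End DGModuleBasics.

Section DGHomBasics.
Variables (A : dgRing) (M N : dgModule A).

Lemma dgHom_homogeneous (f : dgHom M N) n x :
  homogeneous (dgm_cpx M) n x -> homogeneous (dgm_cpx N) n (f x).
Proof. by rewrite /homogeneous -dgh_gpr => ->. Qed.

Lemma subtractive_linear (R : pzRingType) (U V : lmodType R) (f : {linear U -> V}) :
  subtractive f.
Proof. exact: linearB. Qed.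

Lemma linear_of_homogeneous (f : M -> N) : subtractive f ->
  (forall i (a : A) x, homogeneous (dgr_cpx A) i a -> f (a *: x) = a *: f x) ->
  linear f.
Proof.
move=> fB fZ a x y; rewrite (sub_fD fB); congr (_ + _).
elim/(@gpr_ind _ (dgr_cpx A)): a => [|a b ea eb|i a ha]; last exact: fZ ha.
- by rewrite !scale0r (sub_f0 fB).
- by rewrite !scalerDl (sub_fD fB) ea eb.
Qed.

Section MakeDGHom.
Variable f : M -> N.
Hypothesis fL : linear f.
HB.instance Definition _ := GRing.isLinear.Build A M N *:%R f fL.
Definition make_linear : {linear M -> N} := f.
End MakeDGHom.

Lemma make_dgHom (f : M -> N) : subtractive f ->
  (forall i (a : A) x, homogeneous (dgr_cpx A) i a -> f (a *: x) = a *: f x) ->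
  (forall n x, homogeneous (dgm_cpx M) n x -> homogeneous (dgm_cpx N) n (f x)) ->
  (forall x, f (diff (dgm_cpx M) x) = diff (dgm_cpx N) (f x)) ->
  exists g : dgHom M N, g =1 f.
Proof.
move=> fB fZ fh fd; have fL := linear_of_homogeneous fB fZ.
have fg n x : make_linear fL (gpr (dgm_cpx M) n x) = gpr (dgm_cpx N) n (make_linear fL x).
  rewrite /make_linear /=; elim/(@gpr_ind _ (dgm_cpx M)): x => [|x y ex ey|k x hx].
  - by rewrite gpr0 (sub_f0 fB) gpr0.
  - by rewrite (sub_fD fB) !gprD (sub_fD fB) ex ey.
  - rewrite (gpr_homogeneous _ hx) (gpr_homogeneous _ (fh _ _ hx)).
    by case: eqP; rewrite ?(sub_f0 fB).
by exists (@DGHom A M N (make_linear fL) fg fd).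
Qed.
End DGHomBasics.

(** * Injective modules *)

Section ZornSubmodule.
Variables (V : zmodType) (I : Type) (op : I -> V -> V).
Local Open Scope classical_set_scope.

(** One notion serves both uses of Zorn's lemma: scalar multiplications as operators give
    submodules, the empty family of operators gives plain subgroups. *)
Definition stable_subgroup (P : set V) :=
  [/\ P 0, forall x y, P x -> P y -> P (x - y) & forall i x, P x -> P (op i x)].

Lemma stable_subgroupN P x : stable_subgroup P -> P x -> P (- x).
Proof. by case=> P0 PB _ Px; rewrite -sub0r; apply: PB. Qed.

Lemma stable_subgroupD P x y : stable_subgroup P -> P x -> P y -> P (x + y).
Proof.
move=> sP Px Py; rewrite -[y]opprK; case: (sP) => _ PB _; apply: PB => //.
exact: stable_subgroupN.
Qed.

Lemma maximal_avoiding (K0 Y : set V) : stable_subgroup K0 ->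
  (forall x, K0 x -> Y x -> x = 0) ->
  exists K, [/\ stable_subgroup K, K0 `<=` K, forall x, K x -> Y x -> x = 0 &
    forall K', stable_subgroup K' -> K `<=` K' ->
      (forall x, K' x -> Y x -> x = 0) -> K' `<=` K].
Proof.
move=> sK0 K0Y.
pose good K := [/\ stable_subgroup K, K0 `<=` K & forall x, K x -> Y x -> x = 0].
have [F FP Ftot|K [[->|[sK K0K KY]] Kmax]] :=
  @Zorn_bigcup V [set K | K = set0 \/ good K].
- have [[X [FX gX]]|nX] := pselect (exists X, F X /\ good X); last first.
    left; apply/seteqP; split=> // x [X FX Xx].
    by case: (FP _ FX) => [X0|gX]; [rewrite X0 in Xx|case: nX; exists X].
  right; case: gX => -[X0 _ _] K0X _.
  have gF Z z : F Z -> Z z -> good Z by move=> FZ Zz; case: (FP _ FZ) => // Z0; rewrite Z0 in Zz.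
  split; first split.
  + by exists X.
  + move=> x y [Z1 F1 Z1x] [Z2 F2 Z2y].
    have [[_ B1 _] _ _] := gF _ _ F1 Z1x; have [[_ B2 _] _ _] := gF _ _ F2 Z2y.
    by have [Z12|Z21] := Ftot _ _ F1 F2;
      [exists Z2 => //; apply: B2 => //; apply: Z12
      |exists Z1 => //; apply: B1 => //; apply: Z21].
  + move=> i x [Z FZ Zx]; have [[_ _ Zop] _ _] := gF _ _ FZ Zx.
    by exists Z => //; apply: Zop.
  + by move=> x /K0X; exists X.
  + by move=> x [Z FZ Zx]; have [_ _] := gF _ _ FZ Zx; apply.
- case: (Kmax K0); last by right; split.
  by split=> // e; case: sK0 => /e.
- exists K; split=> // K' sK' KK' K'Y; apply: contrapT => nK.
  by case: (Kmax K') => //; right; split=> //; apply: subset_trans KK'.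
Qed.
End ZornSubmodule.

(** * Divisible groups and characters *)

Definition divisible (D : zmodType) :=
  forall (n : nat) (d : D), (0 < n)%N -> exists d', d' *+ n = d.

Section ExtendCharacter.
Variables (V D : zmodType).
Hypothesis Ddiv : divisible D.
Local Open Scope classical_set_scope.

Let op : False -> V * D -> V * D := fun i _ => False_rect _ i.

(** Homomorphisms defined on subgroups are handled as graphs. A maximal single-valued graph above
    [G0] is total, because divisibility of [D] allows one to enlarge it at any [v]. *)
Lemma extend_graph (G0 : set (V * D)) : G0 (0, 0) ->
  (forall p q, G0 p -> G0 q -> G0 (p - q)) -> (forall d, G0 (0, d) -> d = 0) ->
  exists chi : V -> D, subtractive chi /\ forall v d, G0 (v, d) -> chi v = d.
Proof.
move=> G00 G0B G0f.
have [|p G0p p0|G [sG G0G Gf Gmax]] :=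
    @maximal_avoiding _ _ op G0 [set p | p.1 = 0].
- by split.
- by case: p p0 G0p => v d /= -> /G0f ->.
have GB p q : G p -> G q -> G (p - q) by case: sG => _ + _; apply.
have Gfun v d d' : G (v, d) -> G (v, d') -> d = d'.
  move=> Gd Gd'; apply/eqP; rewrite -subr_eq0; apply/eqP.
  by have /Gf := GB _ _ Gd Gd'; move=> /(_ (subrr v)) /(congr1 snd).
have GMn p n : G p -> G (p *+ n).
  move=> Gp; elim: n => [|n IH]; first by rewrite mulr0n; case: sG.
  by rewrite mulrS; apply: (stable_subgroupD sG).
have GMz p (m : int) : G p -> G (p *~ m).
  move=> Gp; case: m => n; rewrite ?NegzE ?mulrNz -pmulrn; first exact: GMn.
  exact/(stable_subgroupN sG)/GMn.
have pairMz (v : V) (d : D) (m : int) : (v, d) *~ m = (v *~ m, d *~ m).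
  have pairMn (n : nat) : (v, d) *+ n = (v *+ n, d *+ n).
    by elim: n => // n IH; rewrite !mulrS IH.
  by case: m => n; rewrite ?NegzE ?mulrNz -!pmulrn pairMn.
have Gtot v : exists d, G (v, d).
  (* Adjoining [(v, d0)] keeps the graph single-valued as soon as [d0] agrees with the values
     already taken at multiples of [v]. *)
  suff [d0 hd0] : exists d0, forall e m, G (v *~ m, e) -> e = d0 *~ m.
    exists d0.
    pose G' := [set p | exists q (m : int), G q /\ p = q + (v, d0) *~ m].
    apply: (Gmax G').
    - split=> [|x y [q [m [Gq ->]]] [q' [m' [Gq' ->]]]|[]].
        by exists 0, 0; rewrite mulr0z addr0; split=> //; case: sG.
      exists (q - q'), (m - m'); split; first exact: GB.
      by rewrite mulrzBr opprD addrACA.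
    - by move=> q Gq; exists q, 0; rewrite mulr0z addr0.
    - move=> _ [[w e] [m [Gwe ->]]]; rewrite pairMz /= => wm.
      have : G (v *~ m, - e).
        have -> : v *~ m = - w by apply/eqP; rewrite -addr_eq0 addrC wm.
        exact: (stable_subgroupN sG Gwe).
      by move=> /hd0 <-; congr (_, _); rewrite ?subrr // wm.
    - by exists 0, 1; rewrite add0r mulr1z; split=> //; case: sG.
  (* The multiples of [v] in the domain correspond to an ideal of the integers. If its least
     positive element is [n], then [d0] is an [n]-th part of the value at [v *+ n]; if the ideal is
     zero, any [d0] works. *)
  pose Q n := (0 < n)%N && `[< exists d, G (v *+ n, d) >].
  have [exQ|nQ] := pselect (exists n, Q n); last first.
    exists 0 => e m Gm; rewrite mul0rz.
    case: (eqVneq m 0) => [m0|m0].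
      by apply: (Gfun 0); rewrite -?(mulr0z v) -?m0 //; case: sG; rewrite m0.
    case: nQ; exists `|m|%N; rewrite /Q absz_gt0 m0; apply/asboolP.
    exists (e *~ sgz m); have := GMz _ (sgz m) Gm.
    by rewrite pairMz -mulrzA mulrC -abszEsg pmulrn.
  have [n /andP[n0 /asboolP[d Gd]] nmin] := ex_minnP exQ.
  have [d0 ed0] := Ddiv d n0; exists d0 => e m Gm.
  have n0' : n%:Z != 0 by lia.
  pose q := (m %/ n%:Z)%Z; pose r := (m %% n%:Z)%Z.
  have em : m = n%:Z * q + r by rewrite mulrC; apply: divz_eq.
  have r0 : 0 <= r by apply: modz_ge0.
  have rn : r < n%:Z by have := ltz_pmod m (_ : 0 < n%:Z); apply.
  have Gr : G (v *~ r, e - d *~ q).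
    have := GB _ _ Gm (GMz _ q Gd); rewrite pairMz; congr (G (_, _)).
    by rewrite em pmulrn -mulrzA /= mulrzDr addrAC subrr add0r.
  have er0 : r = 0.
    apply: contrapT => r1; have := nmin `|r|%N.
    rewrite /Q absz_gt0; case: eqP => //= _ /(_ _).
    suff -> : `[< exists d, G (v *+ `|r|, d) >] by move=> /(_ isT); lia.
    by apply/asboolP; exists (e - d *~ q); rewrite pmulrn gez0_abs.
  have : e - d *~ q = 0.
    by apply: (Gfun 0) => //; rewrite -?(mulr0z v) -?er0 //; rewrite er0; case: sG.
  move/eqP; rewrite subr_eq0 => /eqP ->.
  by rewrite em er0 addr0 -ed0 pmulrn -mulrzA.
have [chi hchi] := choice Gtot; exists chi; split.
- by move=> x y; apply: (Gfun (x - y)) => //; apply: (GB (_, _) (_, _)).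
- by move=> v d /G0G; apply: Gfun.
Qed.
End ExtendCharacter.

Definition int_rat : {pred rat} := fun x => x \is a Num.int.

Lemma int_rat_zmod_closed : zmod_closed int_rat.
Proof. by split=> [|x y]; rewrite !unfold_in; [exact: rpred0|exact: rpredB]. Qed.
HB.instance Definition _ := GRing.isZmodClosed.Build rat int_rat int_rat_zmod_closed.

Definition QmodZ := Quotient.quot int_rat.
HB.instance Definition _ := GRing.Zmodule.on QmodZ.

Definition toQZ (x : rat) : QmodZ := \pi_(Quotient.quot int_rat)%qT x.

Lemma toQZMn x n : toQZ (x *+ n) = toQZ x *+ n.
Proof. exact: raddfMn. Qed.

Lemma toQZ_eq0 x : toQZ x = 0 <-> x \is a Num.int.
Proof.
have -> : 0 = toQZ 0 by rewrite [RHS]raddf0.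
rewrite -[x in _ <-> x]/(is_true (x \in int_rat)) -{2}[x]subr0.
by split=> [/eqmodP|h]; last apply/eqmodP.
Qed.

Lemma QmodZ_divisible : divisible QmodZ.
Proof.
move=> n d n0; rewrite -[d]reprK -/(toQZ _); set x := repr _.
exists (toQZ (x / n%:R)); rewrite -toQZMn; congr toQZ.
by rewrite -[LHS]mulr_natr divfK // pnatr_eq0 -lt0n.
Qed.

Lemma toQZ_inv_neq0 n : (1 < n)%N -> toQZ n%:R^-1 <> 0.
Proof.
move=> n1 /toQZ_eq0 /intrP[m em].
have n0 : (0 : rat) < n%:R by rewrite ltr0n; lia.
have : 0 < m%:~R :> rat by rewrite -em invr_gt0.
have : m%:~R < 1 :> rat by rewrite -em invf_lt1 // ltr1n.
by rewrite ltr0z (ltrz1 rat m); lia.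
Qed.

Lemma toQZ_inv_torsion n : (0 < n)%N -> toQZ n%:R^-1 *+ n = 0.
Proof.
move=> n0; rewrite -toQZMn; apply/toQZ_eq0.
by rewrite -[_ *+ n]mulr_natr mulVf ?pnatr_eq0 ?rpred1 // -lt0n.
Qed.

(** A nonzero [q] that satisfies every relation satisfied by [u] defines a character on the cyclic
    group of [u], which then extends. If [u] has order n, take [q] to be the class of 1/n. *)
Lemma character_separation (U : zmodType) (u : U) : u <> 0 ->
  exists chi : U -> QmodZ, subtractive chi /\ chi u <> 0.
Proof.
move=> u0.
suff [q [q0 hq]] : exists q : QmodZ, q <> 0 /\ forall m : int, u *~ m = 0 -> q *~ m = 0.
  pose G0 : set (U * QmodZ) := [set p | exists m : int, p = (u *~ m, q *~ m)]%classic.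
  have [||d [m [/esym/hq -> ->]]//|chi [cB cG]] := @extend_graph U QmodZ QmodZ_divisible G0.
  - by exists 0; rewrite !mulr0z.
  - by move=> _ _ [m ->] [m' ->]; exists (m - m'); rewrite !mulrzBr.
  - exists chi; split=> //; rewrite (cG _ q) //.
    by exists 1; rewrite !mulr1z.
pose Q n := (0 < n)%N && (u *+ n == 0).
have [exQ|nQ] := pselect (exists n, Q n).
  have [n /andP[n0 /eqP un] nmin] := ex_minnP exQ.
  have n1 : (1 < n)%N.
    by case: n n0 un {nmin} => [|[|n]] // _; rewrite mulr1n => /u0.
  exists (toQZ n%:R^-1); split; first exact: toQZ_inv_neq0.
  move=> m um; pose r := (m %% n%:Z)%Z.
  have em : m = n%:Z * (m %/ n%:Z)%Z + r by rewrite mulrC; apply: divz_eq.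
  have r0 : 0 <= r by apply: modz_ge0; lia.
  have rn : r < n%:Z by have := ltz_pmod m (_ : 0 < n%:Z); apply.
  have ur : u *~ r = 0.
    by move: um; rewrite em mulrzDr mulrzA -pmulrn un mul0rz add0r.
  have er0 : r = 0.
    apply: contrapT => r1; have := nmin `|r|%N; rewrite /Q absz_gt0 pmulrn gez0_abs // ur eqxx.
    by case: eqP => // _ /(_ isT); lia.
  by rewrite em er0 addr0 mulrzA -pmulrn toQZ_inv_torsion ?mul0rz.
(* Here [u] has infinite order and imposes no relation, so any nonzero class will do. *)
exists (toQZ 2%:R^-1); split; first exact: toQZ_inv_neq0.
move=> m um; case: (eqVneq m 0) => [->|m0]; first by rewrite mulr0z.
case: nQ; exists `|m|%N; rewrite /Q absz_gt0 m0 /= pmulrn abszEsg mulrC mulrzA um.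
by rewrite mul0rz.
Qed.

(** * Embedding a module in an injective one *)

Section EnoughInjectives.
Variables (R : pzRingType) (U : lmodType R).

Definition characters := {chi : U -> QmodZ | subtractive chi}.

Definition coind_pred : {pred (characters -> R -> QmodZ)} :=
  fun F => `[< forall chi, subtractive (F chi) >].

Lemma coind_zmod_closed : zmod_closed coind_pred.
Proof.
split=> [|F G /asboolP FB /asboolP GB]; apply/asboolP => chi x y.
  by rewrite subr0.
rewrite -[LHS]/(F chi (x - y) - G chi (x - y)) FB GB.
by rewrite -[RHS]/(F chi x - G chi x - (F chi y - G chi y)) !opprD !opprK addrACA.
Qed.
HB.instance Definition _ := GRing.isZmodClosed.Build (characters -> R -> QmodZ)
  coind_pred coind_zmod_closed.

(* The product of copies of Hom_Z(R, Q/Z) indexed by the characters of [U]. *)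
Definition coind := {F : characters -> R -> QmodZ | F \in coind_pred}.
HB.instance Definition _ := SubChoice.on coind.
HB.instance Definition _ := [SubChoice_isSubZmodule of coind by <:].

Definition mk_coind F (hF : forall chi, subtractive (F chi)) : coind :=
  exist _ F (introT (asboolP _) hF).

Lemma coindB (F : coind) chi : subtractive (val F chi).
Proof. by case: F => F /= /asboolP. Qed.

Lemma coind_scale_subproof (r : R) (F : coind) chi :
  subtractive (fun a => val F chi (a * r)).
Proof. by move=> x y; rewrite mulrBl coindB. Qed.

Definition coind_scale (r : R) (F : coind) : coind :=
  mk_coind (coind_scale_subproof r F).

Lemma coind_scaleA a b F : coind_scale a (coind_scale b F) = coind_scale (a * b) F.
Proof. by apply: val_inj; apply/funext => chi; apply/funext => x /=; rewrite mulrA. Qed.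

Lemma coind_scale1 F : coind_scale 1 F = F.
Proof. by apply: val_inj; apply/funext => chi; apply/funext => x /=; rewrite mulr1. Qed.

Lemma coind_scaleDr a F G :
  coind_scale a (F + G) = coind_scale a F + coind_scale a G.
Proof. by apply: val_inj; apply/funext => chi; apply/funext => x. Qed.

Lemma coind_scaleDl F a b :
  coind_scale (a + b) F = coind_scale a F + coind_scale b F.
Proof.
apply: val_inj; apply/funext => chi; apply/funext => x /=.
by rewrite mulrDr (sub_fD (coindB F chi)).
Qed.
HB.instance Definition _ := GRing.Zmodule_isLmodule.Build R coind
  coind_scaleA coind_scale1 coind_scaleDr coind_scaleDl.

(** By evaluation at 1, a linear map into Hom_Z(R, Q/Z) is the same as a character of its source,
    and characters extend by [extend_graph]; this is done separately for each [chi]. *)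
Lemma coind_injective : injective_module (coind : Mod R).
Proof.
move=> W V i f injf.
have /choice[ext hext] (chi : characters) : exists h : V -> QmodZ, subtractive h /\
    forall w, h (i w) = val (f w) chi 1.
  pose G0 : set (V * QmodZ) := [set p | exists w, p = (i w, val (f w) chi 1)]%classic.
  have [||d [w [/esym]]|h [hB hG]] := @extend_graph V QmodZ QmodZ_divisible G0.
  - by exists 0; rewrite !linear0.
  - by move=> _ _ [w ->] [w' ->]; exists (w - w'); rewrite !linearB.
  - by move=> iw0 ->; rewrite (_ : w = 0) ?linear0 //; apply: injf; rewrite linear0.
  - by exists h; split=> // w; apply: hG; exists w.
have gB v chi : subtractive (fun a : R => ext chi (a *: v)).
  by move=> a b; rewrite scalerBl; have [-> _] := hext chi.
pose g v := mk_coind (gB v).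
have gL : linear g.
  move=> r x y; apply: val_inj; apply/funext => chi; apply/funext => a /=.
  by have [eB _] := hext chi; rewrite scalerDr (sub_fD eB) scalerA.
pose gM := GRing.isLinear.Build R V coind *:%R g gL.
pose gL' : {linear V -> coind} := HB.pack g gM.
exists gL' => w; apply: val_inj; apply/funext => chi; apply/funext => a /=.
by have [_ eE] := hext chi; rewrite -linearZ eE linearZ /= mul1r.
Qed.
End EnoughInjectives.

(** The embedding sends [u] to the family of maps [a -> chi (a *: u)]; it is injective because
    characters separate points. *)
Lemma enough_injectives (R : pzRingType) (U : lmodType R) :
  exists (J : lmodType R) (e : {linear U -> J}),
    injective_module (J : Mod R) /\ injective e.
Proof.
have eB (u : U) (chi : characters U) : subtractive (fun a : R => sval chi (a *: u)).
  by move=> a b; rewrite scalerBl; case: chi => chi /= ->.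
pose e u := mk_coind (eB u).
have eL : linear e.
  move=> r x y; apply: val_inj; apply/funext => chi; apply/funext => a /=.
  by case: chi => chi chiB; rewrite /= scalerDr (sub_fD chiB) scalerA.
pose eM := GRing.isLinear.Build R U (coind U) *:%R e eL.
pose eL' : {linear U -> coind U} := HB.pack e eM.
exists (coind U), eL'; split; first exact: coind_injective.
move=> x y exy; apply/eqP; rewrite -subr_eq0; apply/eqP; apply: contrapT.
move=> /character_separation[chi [cB]]; case.
have := congr1 (fun F : coind U => val F (exist _ chi cB) 1) exy.
by rewrite /= !scale1r cB => ->; rewrite subrr.
Qed.

Definition submodule_axiom (R : pzRingType) (V : lmodType R) (P : V -> Prop) :=
  P 0 /\ forall (a : R) x y, P x -> P y -> P (a *: x + y).

Section Submodule.
Variables (R : pzRingType) (V : lmodType R) (P : V -> Prop).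

(* Indexed by the closure proof, so that the module structure can be inferred. *)
Definition sub_pred (_ : submodule_axiom P) : {pred V} := fun v => `[< P v >].

Variable sP : submodule_axiom P.

Lemma sub_pred_closed : submod_closed (sub_pred sP).
Proof.
case: sP => P0 PL; split=> [|a x y /asboolP Px /asboolP Py]; apply/asboolP => //.
exact: PL.
Qed.
HB.instance Definition _ :=
  GRing.isSubmodClosed.Build R V (sub_pred sP) sub_pred_closed.

Definition submodule := {v : V | v \in sub_pred sP}.
HB.instance Definition _ := SubChoice.on submodule.
HB.instance Definition _ := [SubChoice_isSubLmodule of submodule by <:].

Definition mk_sub v (Pv : P v) : submodule := exist _ v (introT (asboolP _) Pv).

Lemma subP (x : submodule) : P (val x).
Proof. by case: x => x /= /asboolP. Qed.

Definition sub_incl : {linear submodule -> V} := val.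
End Submodule.

Definition pack_linear (R : pzRingType) (U V : lmodType R) (f : U -> V)
  (fL : linear f) : {linear U -> V} :=
  HB.pack f (GRing.isLinear.Build R U V *:%R f fL).

(** The form in which injectivity is used below: a partial map is a total function that is linear on
    [P] and arbitrary elsewhere. *)
Lemma injective_extend (R : pzRingType) (X V : lmodType R) (P : V -> Prop) (f : V -> X) :
  injective_module (X : Mod R) -> submodule_axiom P ->
  (forall (a : R) x y, P x -> P y -> f (a *: x + y) = a *: f x + f y) ->
  exists g : {linear V -> X}, forall v, P v -> g v = f v.
Proof.
move=> injX sP fL.
have fL' : linear (fun x : submodule sP => f (val x)).
  by move=> a x y; rewrite linearP fL //; apply: subP.
have [|g hg] := injX _ _ (sub_incl sP) (pack_linear fL'); first exact: val_inj.
by exists g => v Pv; have := hg (mk_sub sP Pv).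
Qed.

Lemma injective_retract (R : pzRingType) (J X : lmodType R)
    (i : {linear J -> X}) (r : {linear X -> J}) :
  cancel i r -> injective_module (X : Mod R) -> injective_module (J : Mod R).
Proof.
move=> ir injX U V j f injj; have [g hg] := injX _ _ j (i \o f) injj.
by exists (r \o g) => x /=; rewrite hg /= ir.
Qed.

Section ModIso.
Variables (R : pzRingType) (U V : lmodType R) (f : {linear U -> V}).

Lemma bijective_is_iso :
  injective f -> (forall y, exists x, f x = y) -> @is_iso (Mod R) U V f.
Proof.
move=> injf /choice[g fg].
have gL : linear g by move=> a x y; apply: injf; rewrite linearP !fg.
by exists (pack_linear gL); split; apply: linear_eq => x /=; [apply: injf|]; rewrite fg.
Qed.

Lemma is_iso_inj : @is_iso (Mod R) U V f -> injective f.
Proof.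
case=> g [gf _] x y fxy; move: (congr1 (fun h : {linear U -> U} => h x) gf).
by move: (congr1 (fun h : {linear U -> U} => h y) gf) => /= <- <-; rewrite fxy.
Qed.

Lemma is_iso_surj : @is_iso (Mod R) U V f -> forall y, exists x, f x = y.
Proof.
case=> g [_ fg] y; exists ((g : {linear V -> U}) y).
exact: (congr1 (fun h : {linear V -> V} => h y) fg).
Qed.
End ModIso.

(* Complement submodules of an injective module are direct summands: if [X] is
   maximal with [X] meeting [L] trivially, and [K] is maximal meeting [X]
   trivially, the projection [X + K -> X] extends to a retraction onto [X]. *)
Lemma injective_complement (R : pzRingType) (Q : lmodType R) (J L : Q -> Prop) :
  injective_module (Q : Mod R) ->
  submodule_axiom J ->
  (forall (a : R) x, L x -> L (a *: x)) ->
  (forall x, J x -> L x -> x = 0) ->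
  exists (X : lmodType R) (e : {linear X -> Q}),
    [/\ injective_module (X : Mod R), injective e,
        forall x, J x -> exists y, e y = x & forall y, L (e y) -> y = 0].
Proof.
move=> injQ sJ LZ JL0.
pose op (a : R) (x : Q) := a *: x.
have stabP P : stable_subgroup op P <-> submodule_axiom P.
  split=> [sP|[P0 PL]].
    by case: (sP) => P0 _ PZ; split=> // a x y Px Py; apply: (stable_subgroupD sP) => //; apply: PZ.
  split=> // [x y Px Py|a x Px]; last by have := PL a _ _ Px P0; rewrite addr0.
  by rewrite addrC -scaleN1r; apply: PL.
have [X [sX JX XL Xmax]] := @maximal_avoiding _ _ op J L ((stabP J).2 sJ) JL0.
have [| |K [sK _ KX Kmax]] := @maximal_avoiding _ _ op [set 0]%classic X.
- apply/stabP; split=> // a x y -> ->; by rewrite scaler0 addr0.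
- by move=> x ->.
have sX' := (stabP X).1 sX; have [X0 XP] := sX'; have [K0 KP] := (stabP K).1 sK.
have XB x y : X x -> X y -> X (x - y) by case: (sX) => _ + _; apply.
have KB x y : K x -> K y -> K (x - y) by case: (sK) => _ + _; apply.
pose S v := exists x k, [/\ X x, K k & v = x + k].
have [p hp] : exists p : Q -> Q, forall x k, X x -> K k -> p (x + k) = x.
  have /choice[p hp] v : exists x, S v -> X x /\ K (v - x).
    have [[x [k [Xx Kk ->]]]|nS] := pselect (S v); last by exists 0.
    by exists x => _; rewrite addrAC subrr add0r.
  exists p => x k Xx Kk; have [|Xp Kp] := hp (x + k); first by exists x, k.
  apply/eqP; rewrite -subr_eq0; apply/eqP/KX; last exact: XB.
  by have := KB _ _ Kk Kp; rewrite opprB addrCA opprD [k + (_ - _)]addrCA subrr addr0.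
have SP : submodule_axiom S.
  split=> [|a x y [x1 [k1 [X1 K1 ->]]] [x2 [k2 [X2 K2 ->]]]]; first by exists 0, 0; rewrite addr0.
  exists (a *: x1 + x2), (a *: k1 + k2); split; [exact: XP|exact: KP|].
  by rewrite scalerDr addrACA.
have [|r hr] := @injective_extend R Q Q S p injQ SP.
  move=> a _ _ [x1 [k1 [X1 K1 ->]]] [x2 [k2 [X2 K2 ->]]].
  by rewrite scalerDr addrACA !hp //; [exact: XP|exact: KP].
have rX x : X x -> r x = x.
  by move=> Xx; rewrite hr; [rewrite -[x in p x]addr0 hp|exists x, 0; rewrite addr0].
have rK k : K k -> r k = 0.
  by move=> Kk; rewrite hr; [rewrite -[k]add0r hp|exists 0, k; rewrite add0r].
have kerK v : r v = 0 -> K v.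
  apply: (Kmax [set v | r v = 0]%classic).
  - apply/stabP; split=> [|a x y]; first exact: linear0.
    by rewrite /= linearP => -> ->; rewrite scaler0 addr0.
  - exact: rK.
  - by move=> x /= rx0 /rX; rewrite rx0.
have imX v : X (r v).
  apply: (Xmax [set w | exists v, w = r v]%classic); last by exists v.
  - apply/stabP; split=> [|a _ _ [x ->] [y ->]]; first by exists 0; rewrite linear0.
    by exists (a *: x + y); rewrite linearP.
  - by move=> x Xx; exists x; rewrite rX.
  (* If [r y] lies in [L], an element [k + a *: y] of [X] equals its image [a *: r y], so it lies in
     [L] and vanishes. Thus [K] enlarged by [y] still meets [X] trivially, and maximality puts [y]
     in [K]. *)
  - move=> _ [y ->] Lry; apply: (rK).
    apply: (Kmax [set w | exists (a : R) k, K k /\ w = k + a *: y]%classic).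
    + apply/stabP; split=> [|b _ _ [a1 [k1 [K1 ->]]] [a2 [k2 [K2 ->]]]].
        by exists 0, 0; rewrite scale0r addr0.
      exists (b * a1 + a2), (b *: k1 + k2); split; first exact: KP.
      by rewrite scalerDr scalerA addrACA -scalerDl.
    + by move=> k Kk; exists 0, k; rewrite scale0r addr0.
    + move=> _ [a [k [Kk ->]]] Xx.
      have e := rX _ Xx; rewrite linearD rK // add0r linearZ /= in e.
      by rewrite -e; apply: XL; [rewrite e|exact: LZ].
    + by exists 1, 0; rewrite scale1r add0r.
have rL : linear (fun v => mk_sub sX' (imX v)).
  by move=> a x y; apply: val_inj; rewrite [RHS]linearP; apply: linearP.
exists (submodule sX'), (sub_incl sX'); split.
- apply: (@injective_retract R _ Q (sub_incl sX') (pack_linear rL) _ injQ).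
  by move=> x; apply: val_inj; rewrite /= rX //; apply: subP.
- exact: val_inj.
- by move=> x /JX Xx; exists (mk_sub sX' Xx).
- by move=> y Ly; apply: val_inj; apply: XL => //; apply: subP.
Qed.

(** * The ring of degree-zero cocycles *)

Section RestrictScalars.
Variables (R S : pzRingType) (rho : {rmorphism R -> S}) (V : lmodType S).

(** The vacuous [let] makes the type mention [rho], so that the module structure can be inferred
    from the type. *)
Definition restrict_scalars : Type := let _ := rho in V.
HB.instance Definition _ := GRing.Zmodule.on restrict_scalars.

Definition restrict_scale (a : R) (x : restrict_scalars) : restrict_scalars :=
  rho a *: (x : V).

Lemma restrict_scaleA a b x :
  restrict_scale a (restrict_scale b x) = restrict_scale (a * b) x.
Proof. by rewrite /restrict_scale scalerA rmorphM. Qed.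

Lemma restrict_scale1 : left_id 1 restrict_scale.
Proof. by move=> x; rewrite /restrict_scale rmorph1 scale1r. Qed.

Lemma restrict_scaleDr : right_distributive restrict_scale +%R.
Proof. by move=> a x y; rewrite /restrict_scale scalerDr. Qed.

Lemma restrict_scaleDl x : {morph restrict_scale^~ x : a b / a + b}.
Proof. by move=> a b; rewrite /restrict_scale rmorphD scalerDl. Qed.
HB.instance Definition _ := GRing.Zmodule_isLmodule.Build R restrict_scalars
  restrict_scaleA restrict_scale1 restrict_scaleDr restrict_scaleDl.
End RestrictScalars.

Section CocycleRing.
Variable A : dgRing.

(** For non-positive [A] this is all of A^0, since the differential of A^0 lands in A^1 = 0. *)
Definition Z0 := cocycles (dgr_cpx A) 0.
HB.instance Definition _ := GRing.Zmodule.on Z0.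

Definition Z0_val (a : Z0) : A := val a.

Lemma Z0_homogeneous a : homogeneous (dgr_cpx A) 0 (Z0_val a).
Proof. by case/cocycleP: (valP a). Qed.

Lemma Z0_diff a : diff (dgr_cpx A) (Z0_val a) = 0.
Proof. by case/cocycleP: (valP a). Qed.

Definition Z0_mul (a b : Z0) : Z0 := @cocycle_act A (regular_dgModule A) 0 a b.

Lemma Z0_mulA : associative Z0_mul.
Proof. by move=> a b c; apply: val_inj; apply: mulrA. Qed.

Definition Z0_one : Z0 := cocycles_mk (cocycle1P A).

Lemma Z0_mul1 : left_id Z0_one Z0_mul.
Proof. by move=> a; apply: val_inj; apply: mul1r. Qed.

Lemma Z0_mulr1 : right_id Z0_one Z0_mul.
Proof. by move=> a; apply: val_inj; apply: mulr1. Qed.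

Lemma Z0_mulDl : left_distributive Z0_mul +%R.
Proof. by move=> a b c; apply: val_inj; apply: mulrDl. Qed.

Lemma Z0_mulDr : right_distributive Z0_mul +%R.
Proof. by move=> a b c; apply: val_inj; apply: mulrDr. Qed.
HB.instance Definition _ := GRing.Zmodule_isPzRing.Build Z0
  Z0_mulA Z0_mul1 Z0_mulr1 Z0_mulDl Z0_mulDr.

Lemma Z0_val_zmod_morphism : zmod_morphism Z0_val.
Proof. by []. Qed.
HB.instance Definition _ := GRing.isZmodMorphism.Build Z0 A Z0_val Z0_val_zmod_morphism.

Lemma Z0_val_monoid_morphism : monoid_morphism Z0_val.
Proof. by []. Qed.
HB.instance Definition _ := GRing.isMonoidMorphism.Build Z0 A Z0_val Z0_val_monoid_morphism.

Definition Z0_class (a : Z0) : H0 A := coh_class a.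

Lemma Z0_class_zmod_morphism : zmod_morphism Z0_class.
Proof. by move=> a b; apply: raddfB. Qed.
HB.instance Definition _ := GRing.isZmodMorphism.Build Z0 (H0 A) Z0_class Z0_class_zmod_morphism.

Lemma Z0_class_monoid_morphism : monoid_morphism Z0_class.
Proof.
by split=> // a b; rewrite /Z0_class [RHS](@coh_actE A (regular_dgModule A)).
Qed.
HB.instance Definition _ := GRing.isMonoidMorphism.Build Z0 (H0 A) Z0_class
  Z0_class_monoid_morphism.

Definition is_boundary (b : Z0) : Prop :=
  exists2 y, homogeneous (dgr_cpx A) (-1) y & diff (dgr_cpx A) y = val b.

Lemma Z0_class_eq0 b : Z0_class b = 0 <-> is_boundary b.
Proof.
rewrite -[0 : H0 A](_ : Z0_class 0 = 0); last exact: raddf0.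
by rewrite /Z0_class coh_classP subr0.
Qed.

Lemma Z0_classW (P : H0 A -> Prop) : (forall a, P (Z0_class a)) -> forall h, P h.
Proof. by move=> Pc h; elim/cohW: h. Qed.

(* [X] need not be an essential extension of [J]: only its elements annihilated by
   the boundaries matter, and these are exactly those of [J]. *)
Record hull (J : lmodType (H0 A)) := Hull {
  hull_mod :> lmodType Z0;
  hull_inj : injective_module (hull_mod : Mod Z0);
  hull_in : J -> hull_mod;
  hull_inD : forall x y, hull_in (x + y) = hull_in x + hull_in y;
  hull_inZ : forall a x, hull_in (Z0_class a *: x) = a *: hull_in x;
  hull_in_inj : injective hull_in;
  hull_in_surj : forall y, (forall b, is_boundary b -> b *: y = 0) ->
    exists x, y = hull_in x }.

Section Annihilated.
Variable Q : lmodType Z0.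

Definition annihilated_pred (x : Q) := forall b, is_boundary b -> b *: x = 0.

Lemma is_boundary_mulr a b : is_boundary b -> is_boundary (b * a).
Proof.
move=> /Z0_class_eq0 b0; apply/Z0_class_eq0.
by rewrite (rmorphM Z0_class) /= b0 mul0r.
Qed.

Lemma annihilated_axiom : submodule_axiom annihilated_pred.
Proof.
split=> [b _|a x y ax ay b bb]; first by rewrite scaler0.
by rewrite scalerDr scalerA ax ?ay ?addr0 //; apply: is_boundary_mulr.
Qed.

(** This is Hom_Z0(H0 A, Q), the largest submodule of [Q] on which [Z0] acts through [H0 A]. *)
Definition annihilated : Type := submodule annihilated_axiom.
HB.instance Definition _ := GRing.Zmodule.on annihilated.

Definition annihilated_scale (h : H0 A) (x : annihilated) : annihilated :=
  ((coh_repr h : Z0) *: (x : submodule annihilated_axiom)).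

Lemma annihilated_scaleE a x :
  annihilated_scale (Z0_class a) x = a *: (x : submodule annihilated_axiom).
Proof.
apply/eqP; rewrite -subr_eq0 -scalerBl; apply/eqP/val_inj.
have /(subP x) // : is_boundary (coh_repr (Z0_class a) - a : Z0).
by apply/Z0_class_eq0; rewrite raddfB /= /Z0_class coh_reprK subrr.
Qed.

Lemma annihilated_scaleA a b x :
  annihilated_scale a (annihilated_scale b x) = annihilated_scale (a * b) x.
Proof.
elim/Z0_classW: a => a; elim/Z0_classW: b => b.
by rewrite -rmorphM !annihilated_scaleE scalerA.
Qed.

Lemma annihilated_scale1 : left_id 1 annihilated_scale.
Proof. by move=> x; rewrite -(rmorph1 Z0_class) annihilated_scaleE scale1r. Qed.

Lemma annihilated_scaleDr : right_distributive annihilated_scale +%R.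
Proof. by elim/Z0_classW => a x y; rewrite !annihilated_scaleE [LHS]scalerDr. Qed.

Lemma annihilated_scaleDl x : {morph annihilated_scale^~ x : a b / a + b}.
Proof.
elim/Z0_classW => a; elim/Z0_classW => b.
by rewrite -raddfD !annihilated_scaleE scalerDl.
Qed.
HB.instance Definition _ := GRing.Zmodule_isLmodule.Build (H0 A) annihilated
  annihilated_scaleA annihilated_scale1 annihilated_scaleDr annihilated_scaleDl.
End Annihilated.

(** In an injective [Q] containing [J], the annihilated part may exceed [J]. As [J] is injective
    over [H0 A], it is a summand there, with complement the kernel [LQ] of a retraction [r]. An
    injective [X] inside [Q] that contains [J] and avoids [LQ] is a hull: an annihilated [z] in [X]
    differs from [i (r z)] by an element of [LQ], which must be 0. *)
Lemma hull_exists (J : lmodType (H0 A)) :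
  injective_module (J : Mod (H0 A)) -> exists h : hull J, True.
Proof.
move=> injJ; have [Q [e [injQ inje]]] := enough_injectives (restrict_scalars Z0_class J).
have eA (x : J) : annihilated_pred (e x).
  move=> b /Z0_class_eq0 b0; rewrite -linearZ [_ *: _](_ : _ = 0) ?linear0 //.
  by rewrite [LHS]/GRing.scale /= /restrict_scale /= b0 scale0r.
pose i (x : J) : annihilated Q := mk_sub (annihilated_axiom Q) (eA x).
have iL : linear i.
  elim/Z0_classW => a x y; apply: val_inj; rewrite [_ *: i x]annihilated_scaleE /=.
  exact: (linearP e a x y).
have [|r ri] := injJ _ _ (pack_linear iL) idfun.
  by move=> x y /(congr1 val) /inje.
pose JQ (y : Q) := exists x : J, y = e x.
pose LQ (y : Q) := exists2 z : annihilated Q, r z = 0 & y = val z.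
have sJ : submodule_axiom JQ.
  split=> [|a _ _ [x ->] [y ->]]; first by exists 0; rewrite linear0.
  by exists (Z0_class a *: x + y); rewrite -(linearP e a x y).
have LZ (a : Z0) y : LQ y -> LQ (a *: y).
  move=> [z rz ->]; exists (Z0_class a *: z); first by rewrite linearZ /= rz scaler0.
  by rewrite [Z0_class a *: z]annihilated_scaleE.
have JL y : JQ y -> LQ y -> y = 0.
  move=> [x ->] [z rz exz]; rewrite (_ : x = 0) ?linear0 //.
  by rewrite -[x]ri /= (_ : i x = z) ?rz //; apply: val_inj.
have [X [f [injX injf fJ fL]]] := injective_complement injQ sJ LZ JL.
have /choice[g gE] x : exists y, f y = e x by apply: fJ; exists x.
have gD (x y : J) : g ((x : J) + y) = g x + g y.
  by apply: injf; rewrite linearD !gE -linearD.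
have gZ a (x : J) : g (Z0_class a *: x) = a *: g x.
  by apply: injf; rewrite linearZ !gE -linearZ.
have g_inj : injective (g : J -> X) by move=> x y /(congr1 f); rewrite !gE => /inje.
have g_surj y : (forall b, is_boundary b -> b *: y = 0) -> exists x : J, y = g x.
  move=> ay.
  have ay' : annihilated_pred (f y) by move=> b /ay yb; rewrite -linearZ yb linear0.
  pose z : annihilated Q := mk_sub (annihilated_axiom Q) ay'.
  exists (r z); apply/eqP; rewrite -subr_eq0; apply/eqP/fL.
  exists (z - i (r z)); first by rewrite linearB [r (i _)]ri subrr.
  by rewrite linearB gE.
by exists (Hull injX gD gZ g_inj g_surj).
Qed.
End CocycleRing.

(** * Graded coextension of scalars *)

Section RingGrading.
Variable A : dgRing.
Local Notation cA := (dgr_cpx A).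
Implicit Types (a b : A) (x : Z0 A).

Lemma gpr_mulr n i a b : homogeneous cA i b -> gpr cA n (a * b) = gpr cA (n - i) a * b.
Proof.
move=> hb; elim/(@gpr_ind _ cA): a => [|x y ex ey|k x hx].
- by rewrite mul0r !gpr0 mul0r.
- by rewrite mulrDl !gprD ex ey mulrDl.
- rewrite (gpr_homogeneous _ (dgrM hx hb)) (gpr_homogeneous _ hx).
  by rewrite subr_eq; case: eqP; rewrite ?mul0r.
Qed.

Lemma twist_mulr k i a b : homogeneous cA i b ->
  twist cA k (a * b) = sg (k * i) (twist cA k a * b).
Proof.
move=> hb; apply: (@gpr_ext _ cA) => n.
rewrite gpr_twist gpr_sg !(gpr_mulr _ _ hb) gpr_twist sgMl -sg_add.
by apply: eq_sg; rewrite !odd_intE; case: (odd_int k); case: (odd_int n); case: (odd_int i).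
Qed.

Lemma twist_gpr (V : zmodType) (c : complex_on V) k n (x : V) :
  twist c k (gpr c n x) = gpr c n (twist c k x).
Proof. by rewrite (twist_homogeneous _ (homogeneous_gpr _ _ _)) gpr_twist. Qed.

Lemma gpr_Z0_scale (M : dgModule A) n x (m : M) :
  gpr (dgm_cpx M) n (Z0_val x *: m) = Z0_val x *: gpr (dgm_cpx M) n m.
Proof. by rewrite (gpr_scale _ _ (Z0_homogeneous x)) subr0. Qed.

Lemma diff_Z0_scale (M : dgModule A) x (m : M) :
  diff (dgm_cpx M) (Z0_val x *: m) = Z0_val x *: diff (dgm_cpx M) m.
Proof. by rewrite (diff_scale _ (Z0_homogeneous x)) Z0_diff scale0r add0r. Qed.

Lemma twist_Z0_scale (M : dgModule A) k x (m : M) :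
  twist (dgm_cpx M) k (Z0_val x *: m) = Z0_val x *: twist (dgm_cpx M) k m.
Proof. by rewrite (twist_scale _ _ (Z0_homogeneous x)) mulr0. Qed.

Lemma diff1 : diff cA 1 = 0.
Proof. by case/cocycleP: (cocycle1P A). Qed.
End RingGrading.

Section Coextension.
Variables (A : dgRing) (X : lmodType (Z0 A)).
Local Notation cA := (dgr_cpx A).

(** Vanishing on all but finitely many degrees selects the direct sum of the graded parts inside
    their product, as the decomposition required of a complex is finite. *)
Definition coext_axiom (f : A -> X) := [/\ subtractive f,
  forall (z : Z0 A) a, f (Z0_val z * a) = z *: f a &
  exists s : seq int, forall n a, n \notin s -> homogeneous cA n a -> f a = 0].

Definition coext_pred : {pred A -> X} := fun f => `[< coext_axiom f >].

Lemma coext_zmod_closed : zmod_closed coext_pred.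
Proof.
split=> [|f g /asboolP[fB fZ [s sf]] /asboolP[gB gZ [t tg]]]; apply/asboolP.
  by split=> [x y|z a|]; [rewrite subr0|rewrite scaler0|exists [::]].
split=> [x y|z a|].
- rewrite -[LHS]/(f (x - y) - g (x - y)) fB gB.
  by rewrite -[RHS]/(f x - g x - (f y - g y)) !opprD !opprK addrACA.
- by rewrite -[LHS]/(f (Z0_val z * a) - g (Z0_val z * a)) fZ gZ -scalerBr.
- exists (s ++ t) => n a; rewrite mem_cat negb_or => /andP[ns nt] ha.
  by rewrite -[LHS]/(f a - g a) (sf n) ?(tg n) // subrr.
Qed.
HB.instance Definition _ := GRing.isZmodClosed.Build (A -> X) coext_pred coext_zmod_closed.

(* The graded coextension of scalars Hom_{Z0}(A, X): the degree [n] part consists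
   of the maps supported on A^(-n). *)
Definition coext := {f : A -> X | f \in coext_pred}.
HB.instance Definition _ := SubChoice.on coext.
HB.instance Definition _ := [SubChoice_isSubZmodule of coext by <:].

Definition mk_coext f (fP : coext_axiom f) : coext := exist _ f (introT (asboolP _) fP).

Implicit Types (f g : coext) (a b : A).

Lemma coextB f : subtractive (val f).
Proof. by case: f => f /= /asboolP[]. Qed.

Lemma coextZ f (z : Z0 A) a : val f (Z0_val z * a) = z *: val f a.
Proof. by case: f => f /= /asboolP[]. Qed.

Lemma coext_fin f :
  exists s : seq int, forall n a, n \notin s -> homogeneous cA n a -> val f a = 0.
Proof. by case: f => f /= /asboolP[]. Qed.

Lemma coext_eq f g : (forall n a, homogeneous cA n a -> val f a = val g a) -> f = g.
Proof.
move=> e; apply: val_inj; apply/funext.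
exact: (subtractive_ext (coextB f) (coextB g) e).
Qed.

Lemma coext_scale_axiom b f : coext_axiom (fun a => val f (a * b)).
Proof.
split=> [x y|z a|]; first by rewrite mulrBl coextB.
  by rewrite -mulrA coextZ.
elim/(@gpr_ind _ cA): b => [|b c [s hs] [t ht]|k b hb].
- by exists [::] => n a _ _; rewrite mulr0 (sub_f0 (coextB f)).
- exists (s ++ t) => n a; rewrite mem_cat negb_or => /andP[ns nt] ha.
  by rewrite mulrDr (sub_fD (coextB f)) (hs n) // (ht n) // addr0.
- have [s hs] := coext_fin f; exists [seq n - k | n <- s] => n a ns ha.
  apply: (hs (n + k)); last exact: dgrM.
  by apply: contra ns => ns; apply/mapP; exists (n + k) => //; rewrite addrK.
Qed.

Definition coext_scale b f : coext := mk_coext (coext_scale_axiom b f).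

Lemma coext_scaleA a b f : coext_scale a (coext_scale b f) = coext_scale (a * b) f.
Proof. by apply: val_inj; apply/funext => x /=; rewrite mulrA. Qed.

Lemma coext_scale1 : left_id 1 coext_scale.
Proof. by move=> f; apply: val_inj; apply/funext => x /=; rewrite mulr1. Qed.

Lemma coext_scaleDr : right_distributive coext_scale +%R.
Proof. by move=> a f g; apply: val_inj; apply/funext. Qed.

Lemma coext_scaleDl f : {morph coext_scale^~ f : a b / a + b}.
Proof.
move=> a b; apply: val_inj; apply/funext => x /=.
by rewrite mulrDr (sub_fD (coextB f)).
Qed.
HB.instance Definition _ := GRing.Zmodule_isLmodule.Build A coext
  coext_scaleA coext_scale1 coext_scaleDr coext_scaleDl.

Lemma coext_gpr_axiom n f : coext_axiom (fun a => val f (gpr cA (- n) a)).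
Proof.
split=> [x y|z a|]; first by rewrite gprB coextB.
  by rewrite (@gpr_Z0_scale A (regular_dgModule A)) coextZ.
have [s hs] := coext_fin f; exists s => m a ms ha; rewrite (gpr_homogeneous _ ha).
by case: eqP => _; [exact: (hs m)|rewrite (sub_f0 (coextB f))].
Qed.

Definition coext_gpr n f : coext := mk_coext (coext_gpr_axiom n f).

Lemma coext_diff_axiom f : coext_axiom (fun a => val f (twist cA 1 (diff cA a))).
Proof.
split=> [x y|z a|]; first by rewrite diffB twistB coextB.
  rewrite (@diff_Z0_scale A (regular_dgModule A)).
  by rewrite (@twist_Z0_scale A (regular_dgModule A)) coextZ.
have [s hs] := coext_fin f; exists [seq n - 1 | n <- s] => n a ns ha.
apply: (hs (n + 1)); last exact/homogeneous_twist/homogeneous_diff.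
by apply: contra ns => ns; apply/mapP; exists (n + 1) => //; rewrite addrK.
Qed.

(** The degree-dependent sign is the one for which the Leibniz rule holds with the unsigned action
    of [b] by precomposition with right multiplication. *)
Definition coext_diff f : coext := mk_coext (coext_diff_axiom f).

Lemma coext_gprB n : subtractive (coext_gpr n).
Proof. by move=> f g; apply: val_inj; apply/funext. Qed.

Lemma coext_gprK m n f : coext_gpr m (coext_gpr n f) = if m == n then coext_gpr n f else 0.
Proof.
apply: val_inj; apply/funext => a /=; rewrite gprK eqr_opp eq_sym.
by case: eqP => [->//|_]; rewrite (sub_f0 (coextB f)).
Qed.

Lemma coext_gpr_fin f : exists s : seq int, forall n, n \notin s -> coext_gpr n f = 0.
Proof.
have [s hs] := coext_fin f; exists [seq - n | n <- s] => n ns.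
apply: val_inj; apply/funext => a /=; apply: (hs (- n)); last exact: homogeneous_gpr.
by apply: contra ns => ns; apply/mapP; exists (- n) => //; rewrite opprK.
Qed.

Lemma coext_gpr_sep f : (forall n, coext_gpr n f = 0) -> f = 0.
Proof.
move=> f0; apply: coext_eq => n a ha.
by have := congr1 (fun g : coext => val g a) (f0 (- n)); rewrite /= opprK ha.
Qed.

Lemma coext_diffB : subtractive coext_diff.
Proof. by move=> f g; apply: val_inj; apply/funext. Qed.

Lemma coext_diff_deg n f : coext_gpr n f = f ->
  coext_gpr (n + 1) (coext_diff f) = coext_diff f.
Proof.
move=> hf; apply: val_inj; apply/funext => a /=; rewrite -hf /=.
by rewrite -!twist_gpr !gpr_diff' !gprK opprD eqxx.
Qed.

Lemma coext_diffK f : coext_diff (coext_diff f) = 0.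
Proof.
apply: val_inj; apply/funext => a /=.
by rewrite twist_diff twistK diffK sg0 (sub_f0 (coextB f)).
Qed.

Definition coext_complex : complex_on coext :=
  make_complex coext_gprB coext_gprK coext_gpr_fin coext_gpr_sep
    coext_diffB coext_diff_deg coext_diffK.

Lemma coext_dgmZ i j a f : homogeneous cA i a -> homogeneous coext_complex j f ->
  homogeneous coext_complex (i + j) (a *: f).
Proof.
move=> ha hf; apply: val_inj; apply/funext => x /=.
have e y : val f (gpr cA (- j) y) = val f y.
  exact: (congr1 (fun g : coext => val g y) hf).
by rewrite -e -[RHS]e (gpr_mulr _ _ ha) (gpr_mulr _ _ ha) gprK opprD addrC eqxx.
Qed.

Lemma coext_leibniz i a f : homogeneous cA i a ->
  diff coext_complex (a *: f) =
  diff cA a *: f + (isign A i * a) *: diff coext_complex f.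
Proof.
move=> ha; apply: coext_eq => n x hx.
rewrite isignM sgZl.
have -> : val (diff cA a *: f + sg i (a *: diff coext_complex f)) x =
  val f (x * diff cA a) + sg i (val f (twist cA 1 (diff cA (x * a)))).
  by rewrite /sg; case: odd_int.
rewrite /= (dgr_leibniz _ hx) isignM sgMl twistD (sub_fD (coextB f)).
have h1 := dgrM (homogeneous_diff hx) ha.
have h2 := dgrM hx (homogeneous_diff ha).
rewrite (twist_homogeneous _ h1) (twist_homogeneous _ (homogeneous_diff hx)).
rewrite (twist_homogeneous 1 (homogeneous_sg n h2)) sgMl !mul1r.
rewrite !(sub_f_sg _ _ (coextB f)) sgD -!sg_add.
set u := val f _; set v := val f _.
rewrite (@eq_sg _ (i + (n + 1 + i)) (n + 1)); last first.
  by rewrite !odd_intE; case: (odd_int n); case: (odd_int i).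
rewrite (@eq_sg _ (i + (n + (i + 1)) + n) 1); last first.
  by rewrite !odd_intE; case: (odd_int n); case: (odd_int i).
by rewrite sg1 addrCA subrr addr0.
Qed.

Definition coext_dgModule : dgModule A :=
  @DGModule A coext coext_complex coext_dgmZ coext_leibniz.
End Coextension.

(** * The coextension adjunction and its exactness *)

Section MapsToCoextension.
Variables (A : dgRing) (X : lmodType (Z0 A)).
Local Notation cA := (dgr_cpx A).
Local Notation E := (coext_dgModule X).
Local Notation cE := (dgm_cpx E).

Definition coext_eval (f : E) (a : A) : X := val (f : coext X) a.

Lemma coext_evalB f : subtractive (coext_eval f).
Proof. exact: coextB. Qed.

Lemma coext_evalZl f (z : Z0 A) a : coext_eval f (Z0_val z * a) = z *: coext_eval f a.
Proof. exact: coextZ. Qed.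

Lemma coext_evalBl (f g : E) a : coext_eval (f - g) a = coext_eval f a - coext_eval g a.
Proof. by []. Qed.

Lemma coext_eval_sg k f a : coext_eval (sg k f) a = sg k (coext_eval f a).
Proof. by rewrite /sg; case: odd_int. Qed.

Lemma coext_eval_scale b f a : coext_eval (b *: f) a = coext_eval f (a * b).
Proof. by []. Qed.

Lemma coext_eval_gpr n f a : coext_eval (gpr cE n f) a = coext_eval f (gpr cA (- n) a).
Proof. by []. Qed.

Lemma coext_eval_diff f a :
  coext_eval (diff cE f) a = coext_eval f (twist cA 1 (diff cA a)).
Proof. by []. Qed.

Lemma coext_eval_eq (f g : E) :
  (forall n a, homogeneous cA n a -> coext_eval f a = coext_eval g a) -> f = g.
Proof. exact: coext_eq. Qed.

Lemma coext_eval_homogeneous n f m a : homogeneous cE n f -> homogeneous cA m a ->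
  m != - n -> coext_eval f a = 0.
Proof.
move=> hf ha mn; rewrite -hf coext_eval_gpr (gpr_homogeneous _ ha) eq_sym.
by rewrite (negbTE mn) (sub_f0 (coext_evalB f)).
Qed.

Section Lift.
Variable N : dgModule A.
Local Notation cN := (dgm_cpx N).

Definition Z0_linear (G : N -> X) :=
  subtractive G /\ forall z x, G (Z0_val z *: x) = z *: G x.

Definition supported m (G : N -> X) := forall x, G (gpr cN m x) = G x.

Lemma supported_eq0 m n G x : Z0_linear G -> supported m G ->
  homogeneous cN n x -> n != m -> G x = 0.
Proof.
move=> [GB _] Gs hx nm; rewrite -Gs (gpr_homogeneous _ hx) eq_sym (negbTE nm).
exact: sub_f0.
Qed.

(** The adjunction between maps [N -> E] of degree [k] and [Z0]-linear maps N^(-k) -> X: [G] is [L]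
    followed by evaluation at 1, and the twist is the sign that linearity of degree [k] attaches to
    [a]. *)
Definition lifts k (L : N -> E) (G : N -> X) :=
  forall x a, coext_eval (L x) a = G (twist cA k a *: x).

Lemma lift_axiom k G x : Z0_linear G -> supported (- k) G ->
  coext_axiom (fun a => G (twist cA k a *: x)).
Proof.
move=> [GB GZ] Gs; split=> [a b|z a|]; first by rewrite twistB scalerBl GB.
  by rewrite (@twist_Z0_scale A (regular_dgModule A)) -scalerA GZ.
have [s hs] := gpr_fin cN x; exists [seq - k - n | n <- s] => n a ns ha.
rewrite -Gs (gpr_scale _ _ (homogeneous_twist k ha)) hs ?scaler0 ?(sub_f0 GB) //.
by apply: contra ns => ns; apply/mapP; exists (- k - n) => //; lia.
Qed.

Lemma lift_exists k G : Z0_linear G -> supported (- k) G -> exists L, lifts k L G.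
Proof. by move=> Gl Gs; exists (fun x => mk_coext (lift_axiom x Gl Gs)). Qed.

Lemma lift_hom_degree k L G : Z0_linear G -> supported (- k) G ->
  lifts k L G -> hom_degree k L.
Proof.
move=> Gl Gs LG; case: (Gl) => GB GZ; split.
- by move=> x y; apply: coext_eval_eq => n a _; rewrite coext_evalBl !LG scalerBr GB.
- move=> n x hx; apply: coext_eval_eq => m a ha.
  rewrite coext_eval_gpr (gpr_homogeneous _ ha); case: eqVneq => // nm.
  rewrite (sub_f0 (coext_evalB _)) LG.
  rewrite (supported_eq0 Gl Gs (dgmZ (homogeneous_twist k ha) hx)) //.
  by apply: contra nm => /eqP e; apply/eqP; lia.
- move=> j a x ha; apply: coext_eval_eq => n b hb.
  rewrite isignZ coext_eval_sg coext_eval_scale !LG (twist_mulr _ _ ha) sgZl.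
  by rewrite (sub_f_sg _ _ GB) sgK scalerA.
Qed.

(** Under the adjunction the differential of Hom becomes precomposition with that of [N], up to
    sign: at 1 the differential of [E] contributes nothing because d 1 = 0. *)
Lemma lift_diff k L L' G : Z0_linear G -> lifts k L G ->
  lifts (k + 1) L' (fun x => sg (k + 1) (G (diff cN x))) -> hom_diff k L = L'.
Proof.
move=> [GB GZ] LG LG'; apply/funext => x; apply: coext_eval_eq => j a ha.
rewrite /hom_diff coext_evalBl coext_eval_diff isignZ coext_eval_sg LG' !LG.
rewrite (twist_homogeneous 1 (homogeneous_diff ha)).
rewrite (twist_homogeneous k (homogeneous_sg _ (homogeneous_diff ha))).
rewrite !(twist_homogeneous _ ha) !sgZl !diff_sg (diff_scale _ ha).
rewrite !(sub_f_sg _ _ GB) (sub_fD GB) (sub_f_sg _ _ GB) !sgD -!sg_add -sgN.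
congr (_ + _); first apply: eq_sg; last rewrite -sg1 -sg_add; last apply: eq_sg;
  by rewrite !odd_intE; case: (odd_int k); case: (odd_int j).
Qed.

Definition evaluation1 (f : N -> E) (x : N) : X := coext_eval (f x) 1.

Lemma hom_degree_lifts k f : hom_degree k f ->
  [/\ Z0_linear (evaluation1 f), supported (- k) (evaluation1 f) &
    lifts k f (evaluation1 f)].
Proof.
move=> [fB fh fZ]; rewrite /evaluation1.
have GB : subtractive (evaluation1 f) by move=> x y; rewrite /evaluation1 fB.
split; first split=> // z x.
- rewrite (fZ _ _ _ (Z0_homogeneous z)) mulr0 isignZ sg_even0 coext_eval_scale.
  by rewrite mul1r -[Z0_val z]mulr1 coext_evalZl.
- apply: (@subtractive_ext _ cN _ (fun x => evaluation1 f (gpr cN (- k) x))) => //.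
    by move=> x y; rewrite /= gprB GB.
  move=> n x hx; rewrite (gpr_homogeneous _ hx); case: eqVneq => // nk.
  rewrite (sub_f0 GB) /evaluation1.
  rewrite (coext_eval_homogeneous (fh _ _ hx) (dgr1 A)) //.
  by apply: contra nk => /eqP e; apply/eqP; lia.
- move=> x.
  apply: (@subtractive_ext _ cA _ _ (fun a => evaluation1 f (twist cA k a *: x))).
  + exact: coext_evalB.
  + by move=> a b; rewrite twistB scalerBl GB.
  + move=> n a ha; rewrite (twist_homogeneous _ ha) sgZl (sub_f_sg _ _ GB).
    rewrite /evaluation1 (fZ _ _ _ ha) isignZ coext_eval_sg sgK.
    by rewrite coext_eval_scale mul1r.
Qed.

Lemma lift_dgHom L G : Z0_linear G -> supported 0 G ->
  (forall x, G (diff cN x) = 0) -> lifts 0 L G -> exists g : dgHom N E, g =1 L.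
Proof.
move=> Gl Gs Gd LG; have {}Gs : supported (- 0) G := Gs.
have [LB Lh LZ] := lift_hom_degree Gl Gs LG.
apply: make_dgHom => //.
- by move=> i a x ha; rewrite (LZ _ _ _ ha) mul0r isignZ sg_even0.
- by move=> n x hx; have := Lh n x hx; rewrite addr0.
- move=> x; have L0 : lifts (0 + 1) (fun=> 0) (fun x => sg (0 + 1) (G (diff cN x))).
    by move=> y a; rewrite Gd sg0.
  have := congr1 (@^~ x) (lift_diff Gl LG L0); rewrite /hom_diff isignZ sg_even0.
  by move/eqP; rewrite subr_eq0 => /eqP ->.
Qed.

Lemma dgHom_hom_degree (M : dgModule A) (f : dgHom N M) : hom_degree 0 f.
Proof.
split=> [|n x hx|j a x ha]; first exact: linearB.
- by rewrite addr0; apply: dgHom_homogeneous.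
- by rewrite mul0r isignZ sg_even0 linearZ.
Qed.

Hypothesis injX : injective_module (X : Mod (Z0 A)).

(** Since [G] kills the cocycles of degree [m], it descends along the differential to the boundaries
    of degree [m + 1], and injectivity of [X] extends the result. This is where exactness of
    Hom_Z0(-, X) enters. *)
Lemma contract_along_diff m (G : N -> X) : Z0_linear G -> supported m G ->
  (forall x, homogeneous cN m x -> diff cN x = 0 -> G x = 0) ->
  exists F, [/\ Z0_linear F, supported (m + 1) F & forall x, F (diff cN x) = G x].
Proof.
move=> [GB GZ] Gs G0.
pose NZ := restrict_scalars (Z0_val (A := A)) N.
pose W (v y : N) := homogeneous cN m y /\ gpr cN (m + 1) v = diff cN y.
pose P (v : NZ) := exists y, W v y.
have WL (z : Z0 A) v v' y y' : W v y -> W v' y' -> W (Z0_val z *: v + v') (Z0_val z *: y + y').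
  move=> [hy ey] [hy' ey']; split.
    apply: homogeneousD => //.
    by have := dgmZ (Z0_homogeneous z) hy; rewrite add0r.
  by rewrite gprD gpr_Z0_scale ey ey' diffD diff_Z0_scale.
have Wfun v y y' : W v y -> W v y' -> G y = G y'.
  move=> [hy ey] [hy' ey']; apply/eqP; rewrite -subr_eq0 -GB; apply/eqP/G0.
    exact: homogeneousB.
  by rewrite diffB -ey ey' subrr.
have W0 v : gpr cN (m + 1) v = 0 -> W v 0.
  by move=> e; split; [exact: homogeneous0|rewrite e diff0].
have /choice[y0 hy0] (v : NZ) : exists y, P v -> W v y.
  by have [[y Wy]|nP] := pselect (P v); [exists y|exists 0].
have sP : submodule_axiom P.
  split=> [|z v v' [y Wy] [y' Wy']]; first by exists 0; apply: W0; rewrite gpr0.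
  by exists (Z0_val z *: y + y'); apply: WL.
have [z v v' Pv Pv'|F hF] := @injective_extend _ X NZ P (fun v => G (y0 v)) injX sP.
  rewrite (Wfun _ _ _ (hy0 _ (sP.2 z _ _ Pv Pv')) (WL z _ _ _ _ (hy0 _ Pv) (hy0 _ Pv'))).
  by rewrite (sub_fD GB) GZ.
have FW v y : W v y -> F v = G y.
  by move=> Wy; rewrite hF; [apply: (Wfun v) => //; apply: hy0; exists y|exists y].
exists F; split.
- by split=> [x y|z x]; [exact: linearB|exact: (linearZZ F z x)].
- move=> x; apply/eqP; rewrite -subr_eq0 -linearB; apply/eqP.
  rewrite -(sub_f0 GB); apply/FW/W0.
  by rewrite gprB gprK eqxx subrr.
- move=> x; rewrite -Gs; apply: FW; split; first exact: homogeneous_gpr.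
  by rewrite gpr_diff.
Qed.

(** A primitive along the differential of the functional adjoint to [f] is adjoint to a homotopy;
    the factor [sg k] offsets the sign in [lift_diff]. *)
Lemma coext_null_homotopic k f : hom_degree k f -> hom_diff k f = (fun=> 0) ->
  (forall x, homogeneous cN (- k) x -> diff cN x = 0 -> coext_eval (f x) 1 = 0) ->
  exists2 g, hom_degree (k - 1) g & hom_diff (k - 1) g = f.
Proof.
move=> fk df f0; have [Gl Gs fG] := hom_degree_lifts fk.
case: (Gl) => GB GZ.
have [|||F [Fl Fs Fd]] :=
    @contract_along_diff (- k) (fun x => sg k (evaluation1 f x)).
- split=> [x y|z x]; first by rewrite GB sgB.
  by rewrite GZ sgZr.
- by move=> x; rewrite Gs.
- by move=> x hx dx; rewrite /evaluation1 f0 ?sg0.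
have {}Fs : supported (- (k - 1)) F by rewrite opprB addrC.
have [g gF] := lift_exists Fl Fs; exists g; first exact: (lift_hom_degree Fl Fs gF).
apply: (lift_diff Fl gF); rewrite subrK => x a.
by rewrite Fd sgK fG.
Qed.
End Lift.
End MapsToCoextension.

(** * Cohomology, cones and direct sums *)

Section CohomologyCriteria.
Variables (A : dgRing) (n : int).

Definition exact_cocycle (M : dgModule A) (z : M) : Prop :=
  exists2 y, homogeneous (dgm_cpx M) (n - 1) y & diff (dgm_cpx M) y = z.

Definition is_cocycle (M : dgModule A) (z : M) : Prop :=
  homogeneous (dgm_cpx M) n z /\ diff (dgm_cpx M) z = 0.

Definition coh (M : dgModule A) (z : M) (hz : is_cocycle z) : H n M :=
  coh_class (cocycles_mk (introT (cocycleP _ _ _) hz)).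

Lemma cohP (M : dgModule A) (P : H n M -> Prop) :
  (forall z (hz : is_cocycle z), P (coh hz)) -> forall h, P h.
Proof.
move=> Pc; elim/cohW => z; have hz := elimT (cocycleP _ _ _) (valP z).
suff <- : coh hz = coh_class z by apply: Pc.
by congr coh_class; apply: val_inj.
Qed.

Lemma coh_eq (M : dgModule A) (z t : M) (hz : is_cocycle z) (ht : is_cocycle t) :
  coh hz = coh ht <-> exact_cocycle (z - t).
Proof. exact: coh_classP. Qed.

Lemma is_cocycle0 (M : dgModule A) : is_cocycle (0 : M).
Proof. by split; [exact: homogeneous0|exact: diff0]. Qed.

Lemma coh0 (M : dgModule A) : coh (is_cocycle0 M) = 0.
Proof.
rewrite -[RHS](raddf0 \pi_(Quotient.quot (@coboundary _ (dgm_cpx M) n))%qT).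
by congr coh_class; apply: val_inj.
Qed.

Lemma coh_eq0 (M : dgModule A) (z : M) (hz : is_cocycle z) :
  coh hz = 0 <-> exact_cocycle z.
Proof. by rewrite -coh0 coh_eq subr0. Qed.

Lemma H_zeroP (M : dgModule A) :
  H_zero n (M : D A) <-> forall z : M, is_cocycle z -> exact_cocycle z.
Proof.
split=> [h z hz|h]; first exact/(coh_eq0 hz)/h.
by elim/cohP => z hz; apply/coh_eq0/h.
Qed.

Section Map.
Variables (M N : dgModule A) (f : dgHom M N).

Lemma is_cocycle_map z : is_cocycle z -> is_cocycle (f z).
Proof.
by move=> [hz dz]; split; [exact: dgHom_homogeneous|rewrite -dgh_diff dz linear0].
Qed.

Lemma H_map_coh z (hz : is_cocycle z) : H_map n f (coh hz) = coh (is_cocycle_map hz).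
Proof. by rewrite /= H_mapE; congr coh_class; apply: val_inj. Qed.

Lemma H_map_injP : injective (H_map n f) <->
  forall z, is_cocycle z -> exact_cocycle (f z) -> exact_cocycle z.
Proof.
split=> [inj z hz ez|h].
  apply/(coh_eq0 hz)/inj; rewrite H_map_coh linear0.
  exact/coh_eq0.
elim/cohP => z hz; elim/cohP => t ht; rewrite !H_map_coh => /coh_eq e.
apply/coh_eq/h; last by rewrite linearB.
split; first by apply: homogeneousB; [case: hz|case: ht].
by rewrite diffB; case: hz => _ ->; case: ht => _ ->; rewrite subrr.
Qed.

Lemma H_map_surjP : (forall h, exists x, H_map n f x = h) <->
  forall t, is_cocycle t -> exists2 z, is_cocycle z & exact_cocycle (f z - t).
Proof.
split=> [h t ht|h].
  have [x] := h (coh ht); elim/cohP: x => z hz; rewrite H_map_coh => /coh_eq e.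
  by exists z.
elim/cohP => t ht; have [z hz e] := h t ht.
by exists (coh hz); rewrite H_map_coh; apply/coh_eq.
Qed.

Lemma H_map_isoP : @is_iso (Mod (H0 A)) (H n M) (H n N) (H_map n f) <->
  injective (H_map n f) /\ (forall h, exists x, H_map n f x = h).
Proof.
split=> [fi|[fi fs]]; last exact: bijective_is_iso.
by split; [exact: is_iso_inj fi|exact: is_iso_surj fi].
Qed.
End Map.
End CohomologyCriteria.

(** * Twisted extensions: cones and direct sums *)

Section ExtensionModule.
Variables (A : dgRing) (N M : dgModule A) (k : int) (h : M -> N).
Local Notation cN := (dgm_cpx N).
Local Notation cM := (dgm_cpx M).
Hypotheses (hB : subtractive h)
  (h_deg : forall n y, homogeneous cM n y -> homogeneous cN (n - k + 1) (h y))
  (hZ : forall i (a : A) y, homogeneous (dgr_cpx A) i a -> h (a *: y) = sg i (a *: h y))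
  (hd : forall y, diff cN (h y) + h (diff cM y) = 0).

Let V := (N * M)%type : lmodType A.

(** One construction for both cases: [k = 1] gives cones, and [k = 0] with [h] zero gives direct
    sums. *)
Definition ext_gpr n (v : V) : V := (gpr cN n v.1, gpr cM (n + k) v.2).
Definition ext_diff (v : V) : V := (diff cN v.1 + h v.2, diff cM v.2).

Lemma ext_gprB n : subtractive (ext_gpr n).
Proof. by move=> [x y] [x' y']; congr (_, _); apply: gprB. Qed.

Lemma ext_gprK m n v : ext_gpr m (ext_gpr n v) = if m == n then ext_gpr n v else 0.
Proof. by rewrite /ext_gpr /= !gprK (inj_eq (addIr _)); case: ifP. Qed.

Lemma ext_gpr_fin v : exists s : seq int, forall n, n \notin s -> ext_gpr n v = 0.
Proof.
have [s hs] := gpr_fin cN v.1; have [t ht] := gpr_fin cM v.2.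
exists (s ++ [seq n - k | n <- t]) => n; rewrite mem_cat negb_or => /andP[ns nt].
rewrite /ext_gpr hs // ht //.
by apply: contra nt => nt; apply/mapP; exists (n + k) => //; rewrite addrK.
Qed.

Lemma ext_gpr_sep v : (forall n, ext_gpr n v = 0) -> v = 0.
Proof.
case: v => x y v0; congr (_, _).
  by apply: (@gpr_sep _ cN) => n; have [] := v0 n.
apply: (@gpr_sep _ cM) => n; have [_] := v0 (n - k).
by rewrite subrK.
Qed.

Lemma ext_diffB : subtractive ext_diff.
Proof.
move=> [x y] [x' y']; congr (_, _); last exact: diffB.
rewrite -[LHS]/(diff cN (x - x') + h (y - y')) diffB hB.
by rewrite -[RHS]/(diff cN x + h y - (diff cN x' + h y')) opprD addrACA.
Qed.

Lemma ext_diff_deg n v : ext_gpr n v = v -> ext_gpr (n + 1) (ext_diff v) = ext_diff v.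
Proof.
case: v => x y [hx hy]; rewrite /ext_gpr /ext_diff /=; congr (_, _).
  rewrite gprD (homogeneous_diff hx); congr (_ + _).
  by have := h_deg hy; rewrite addrK.
by rewrite addrAC; apply: homogeneous_diff.
Qed.

Lemma ext_diffK v : ext_diff (ext_diff v) = 0.
Proof. by rewrite /ext_diff /= !diffK diffD diffK add0r hd. Qed.

Definition ext_complex : complex_on V :=
  make_complex ext_gprB ext_gprK ext_gpr_fin ext_gpr_sep ext_diffB ext_diff_deg ext_diffK.

Lemma ext_homogeneousP n (x : N) (y : M) : homogeneous ext_complex n (x, y) <->
  homogeneous cN n x /\ homogeneous cM (n + k) y.
Proof. by split=> [[]|[ex ey]] //; rewrite /homogeneous /= /ext_gpr /= ex ey. Qed.

Lemma ext_dgmZ i j (a : A) v : homogeneous (dgr_cpx A) i a ->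
  homogeneous ext_complex j v -> homogeneous ext_complex (i + j) (a *: v).
Proof.
case: v => x y ha /ext_homogeneousP[hx hy]; apply/ext_homogeneousP.
by split; rewrite -?addrA; apply: dgmZ.
Qed.

Lemma ext_leibniz i (a : A) v : homogeneous (dgr_cpx A) i a ->
  diff ext_complex (a *: v) =
  diff (dgr_cpx A) a *: v + (isign A i * a) *: diff ext_complex v.
Proof.
case: v => x y ha; rewrite isignM; congr (_, _); rewrite /= (diff_scale _ ha) ?sgZl //.
by rewrite (hZ _ ha) scalerDr sgD addrA.
Qed.

Definition ext_dgModule : dgModule A := @DGModule A V ext_complex ext_dgmZ ext_leibniz.
End ExtensionModule.

Section Cone.
Variables (A : dgRing) (M N : dgModule A) (f : dgHom M N).
Local Notation cN := (dgm_cpx N).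
Local Notation cM := (dgm_cpx M).

Definition cone_twist (y : M) : N := f (twist cM 1 y).

Lemma cone_twistB : subtractive cone_twist.
Proof. by move=> x y; rewrite /cone_twist twistB linearB. Qed.

Lemma cone_twist_deg n y :
  homogeneous cM n y -> homogeneous cN (n - 1 + 1) (cone_twist y).
Proof. by move=> hy; rewrite subrK; apply/dgHom_homogeneous/homogeneous_twist. Qed.

Lemma cone_twistZ i (a : A) y : homogeneous (dgr_cpx A) i a ->
  cone_twist (a *: y) = sg i (a *: cone_twist y).
Proof.
move=> ha; rewrite /cone_twist (twist_scale _ _ ha) mul1r.
by rewrite (sub_f_sg _ _ (subtractive_linear f)) linearZ.
Qed.

Lemma cone_twist_diff y : diff cN (cone_twist y) + cone_twist (diff cM y) = 0.
Proof. by rewrite /cone_twist twist_diff sg1 linearN dgh_diff subrr. Qed.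

(* In degree [n] the cone is [N^n + M^(n+1)]. The scalars act on the second
   summand without sign, the usual sign being carried by [cone_twist]. *)
Definition cone : dgModule A :=
  ext_dgModule cone_twistB cone_twist_deg cone_twistZ cone_twist_diff.

Lemma cone_homogeneousP n x y : homogeneous (dgm_cpx cone) n (x, y) <->
  homogeneous cN n x /\ homogeneous cM (n + 1) y.
Proof. exact: ext_homogeneousP. Qed.

Lemma cone_diffE x y :
  diff (dgm_cpx cone) (x, y) = (diff cN x + f (twist cM 1 y), diff cM y).
Proof. by []. Qed.

Lemma cone_in_exists : exists j : dgHom N cone, forall x, j x = (x, 0).
Proof.
apply: (@make_dgHom A N cone (fun x => (x, 0))) => [x y|i a x ha|n x hx|x].
- by congr (_, _); rewrite subr0.
- by congr (_, _); rewrite scaler0.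
- by apply/cone_homogeneousP; split=> //; apply: homogeneous0.
- by rewrite cone_diffE twist0 linear0 addr0 diff0.
Qed.

Definition cone_in : dgHom N cone := projT1 (cid cone_in_exists).

Lemma cone_inE x : cone_in x = (x, 0).
Proof. by rewrite /cone_in; case: cid. Qed.
End Cone.

Lemma cone_id_acyclic (A : dgRing) (M : dgModule A) : acyclic (cone (dgHom_id M)).
Proof.
move=> n; apply/H_zeroP => -[x y] [/cone_homogeneousP[hx hy]].
rewrite cone_diffE => -[exy dy].
exists (0, twist (dgm_cpx M) 1 x).
  apply/cone_homogeneousP; split; first exact: homogeneous0.
  by rewrite subrK; apply: homogeneous_twist.
rewrite cone_diffE diff0 add0r /= twistK; congr (_, _).
have -> : diff (dgm_cpx M) (twist (dgm_cpx M) 1 x) = - twist (dgm_cpx M) 1 (diff (dgm_cpx M) x).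
  by rewrite twist_diff sg1 opprK.
by move/eqP: exy; rewrite addr_eq0 => /eqP ->; rewrite twistN opprK /= twistK.
Qed.

Section DirectSum.
Variables (A : dgRing) (N K : dgModule A).
Local Notation cN := (dgm_cpx N).
Local Notation cK := (dgm_cpx K).

Let z (y : K) : N := 0.

Let zB : subtractive z.
Proof. by move=> x y; rewrite subr0. Qed.

Let z_deg n y : homogeneous cK n y -> homogeneous cN (n - 0 + 1) (z y).
Proof. by move=> _; apply: homogeneous0. Qed.

Let zZ i (a : A) y : homogeneous (dgr_cpx A) i a -> z (a *: y) = sg i (a *: z y).
Proof. by rewrite scaler0 sg0. Qed.

Let zd y : diff cN (z y) + z (diff cK y) = 0.
Proof. by rewrite diff0 addr0. Qed.

Definition sum_dgModule : dgModule A := ext_dgModule zB z_deg zZ zd.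

Lemma sum_homogeneousP n x y : homogeneous (dgm_cpx sum_dgModule) n (x, y) <->
  homogeneous cN n x /\ homogeneous cK n y.
Proof.
rewrite /homogeneous -[gpr _ n (x, y)]/(gpr cN n x, gpr cK (n + 0) y) addr0.
by split=> [[-> ->]|[-> ->]].
Qed.

Lemma sum_diffE x y : diff (dgm_cpx sum_dgModule) (x, y) = (diff cN x, diff cK y).
Proof. by congr (_, _); apply: addr0. Qed.

Lemma sum_pair (M : dgModule A) (f : dgHom M N) (g : dgHom M K) :
  exists h : dgHom M sum_dgModule, forall x, h x = (f x, g x).
Proof.
apply: (@make_dgHom A M sum_dgModule (fun x => (f x, g x))) => [x y|i a x ha|n x hx|x].
- by rewrite !linearB.
- by rewrite !linearZ.
- by apply/sum_homogeneousP; split; apply: dgHom_homogeneous.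
- by rewrite sum_diffE !dgh_diff.
Qed.

Lemma sum_copair (M : dgModule A) (f : dgHom N M) (g : dgHom K M) :
  exists h : dgHom sum_dgModule M, forall x y, h (x, y) = f x + g y.
Proof.
have [||||h hE] := @make_dgHom A sum_dgModule M (fun v => f v.1 + g v.2).
- by move=> x y; rewrite !linearB opprD addrACA.
- by move=> i a x ha; rewrite !linearZ scalerDr.
- move=> n [x y] /sum_homogeneousP[hx hy].
  by apply: homogeneousD; apply: dgHom_homogeneous.
- by move=> [x y]; rewrite sum_diffE !dgh_diff diffD.
by exists h => x y; rewrite hE.
Qed.
End DirectSum.

Lemma dgHom_zero_exists (A : dgRing) (M N : dgModule A) :
  exists f : dgHom M N, forall x, f x = 0.
Proof.
apply: (@make_dgHom A M N (fun=> 0)) => [x y|i a x ha|n x hx|x].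
- by rewrite subr0.
- by rewrite scaler0.
- exact: homogeneous0.
- by rewrite diff0.
Qed.

(** * Equivalences and the derived category *)

Section CategoryBasics.
Variables C D : category.

Lemma is_iso_comp (x y z : C) (g : hom y z) (f : hom x y) :
  is_iso g -> is_iso f -> is_iso (compm g f).
Proof.
move=> [g' [g'g gg']] [f' [f'f ff']]; exists (compm f' g'); split.
- by rewrite -compmA (compmA g') g'g comp1m f'f.
- by rewrite -compmA (compmA f) ff' comp1m gg'.
Qed.

Lemma is_iso_mono (x y z : C) (g : hom y z) (f f' : hom x y) :
  is_iso g -> compm g f = compm g f' -> f = f'.
Proof.
move=> [h [hg _]] e; rewrite -[f]comp1m -hg -compmA e.
by rewrite compmA hg comp1m.
Qed.

Lemma fmap_iso (F : functor C D) (x y : C) (f : hom x y) :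
  is_iso f -> is_iso (fmap F f).
Proof.
by move=> [g [gf fg]]; exists (fmap F g); split; rewrite -fmapM ?gf ?fg fmap1.
Qed.

Lemma inverse_is_iso (x y : C) (f : hom x y) (g : hom y x) :
  inverse_of f g -> is_iso g.
Proof. by case=> gf fg; exists f. Qed.

Lemma fully_faithful_equivalence (F : functor C D) :
  (forall (x y : C) (f g : hom x y), fmap F f = fmap F g -> f = g) ->
  (forall (x y : C) (h : hom (F x) (F y)), exists f : hom x y, fmap F f = h) ->
  (forall d : D, exists x : C, isomorphic (F x) d) ->
  is_equivalence F.
Proof.
move=> faith full ess.
have /choice[G0 hG0] : forall d, exists x, isomorphic (F x) d by [].
pose e d : hom (F (G0 d)) d := projT1 (cid (hG0 d)).
have e_iso d : is_iso (e d) by rewrite /e; case: cid.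
pose e' d : hom d (F (G0 d)) := projT1 (cid (e_iso d)).
have e'P d : inverse_of (e d) (e' d) by rewrite /e'; case: cid.
pose lift x y (h : hom (F x) (F y)) : hom x y := projT1 (cid (full x y h)).
have liftP x y (h : hom (F x) (F y)) : fmap F (lift x y h) = h by rewrite /lift; case: cid.
pose Gm d d' (h : hom d d') : hom (G0 d) (G0 d') :=
  lift _ _ (compm (e' d') (compm h (e d))).
have Gm1 d : Gm d d (idm d) = idm (G0 d).
  by apply: faith; rewrite liftP comp1m fmap1; case: (e'P d).
have GmM d d' d'' (g : hom d' d'') (f : hom d d') :
    Gm _ _ (compm g f) = compm (Gm _ _ g) (Gm _ _ f).
  apply: faith; rewrite fmapM !liftP -!compmA; do 2 congr compm.
  by rewrite (compmA (e d')) (e'P d').2 comp1m.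
pose G := @Functor D C G0 Gm Gm1 GmM.
exists G; split.
- exists (fun x => lift (G0 (F x)) x (e (F x))); split.
    move=> x; exists (lift _ _ (e' (F x))); split; apply: faith.
    + by rewrite fmapM !liftP fmap1 (e'P _).1.
    + by rewrite fmapM !liftP fmap1 (e'P _).2.
  move=> x y f; apply: faith; rewrite /= !fmapM !liftP.
  by rewrite compmA (e'P _).2 comp1m.
- exists e; split; first exact: e_iso.
  by move=> d d' f; rewrite /= liftP compmA (e'P _).2 comp1m.
Qed.
End CategoryBasics.

Section DerivedCategory.
Variable A : dgRing.

Definition loc_arr (M N : dgModule A) (f : dgHom M N) : @hom (D A) M N :=
  loc_class (@zz_arr (DGMod A) (@quasi_iso A) M N f).

Lemma loc_arr_comp (M N P : dgModule A) (g : dgHom N P) (f : dgHom M N) :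
  @compm (D A) _ _ _ (loc_arr g) (loc_arr f) = loc_arr (dgHom_comp g f).
Proof.
rewrite [LHS](@loc_compE (DGMod A) (@quasi_iso A)); apply/loc_class_eqP.
exact: zz_arr_comp.
Qed.

Lemma loc_arr_is_iso (M N : dgModule A) (s : dgHom M N) :
  @quasi_iso A M N s -> @is_iso (D A) M N (loc_arr s).
Proof.
move=> qs; exists (loc_class (@zz_inv (DGMod A) (@quasi_iso A) M N s qs)); split.
- by rewrite [LHS](@loc_compE (DGMod A) (@quasi_iso A)); apply/loc_class_eqP/zz_inv_l.
- by rewrite [LHS](@loc_compE (DGMod A) (@quasi_iso A)); apply/loc_class_eqP/zz_inv_r.
Qed.

Lemma HD_loc_arr n (M N : dgModule A) (f : dgHom M N) : fmap (HD A n) (loc_arr f) = H_map n f.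
Proof.
exact: (@zz_map_eq (DGMod A) (@quasi_iso A) (Mod (H0 A)) (H_functor A n)
  (fun M N f qf => qf n) M N _ _ (loc_class_repr _)).
Qed.

Lemma quasi_isoP (M N : dgModule A) (f : dgHom M N) : @quasi_iso A M N f <->
  forall n, injective (H_map n f) /\ (forall h, exists x, H_map n f x = h).
Proof. by split=> h n; apply/H_map_isoP/h. Qed.

(* Two strict morphisms that differ by a morphism factoring through an acyclic
   module agree in the derived category: both are obtained from one morphism on
   [N + K] by composition with sections of the quasi-isomorphism [N + K -> N]. *)
Lemma loc_arr_eq_of_acyclic (N K E : dgModule A) (f g : dgHom N E) (i : dgHom N K) (k : dgHom K E) :
  acyclic K -> (forall x, f x = g x + k (i x)) -> loc_arr f = loc_arr g.
Proof.
move=> Kac fE.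
have [z0 z0E] := dgHom_zero_exists N K; have [zN zNE] := dgHom_zero_exists K N.
have [p pE] := sum_copair (dgHom_id N) zN.
have [i0 i0E] := sum_pair (dgHom_id N) z0.
have [i1 i1E] := sum_pair (dgHom_id N) i.
have [h hE] := sum_copair g k.
have qp : @quasi_iso A _ _ p.
  apply/quasi_isoP => n; split.
    apply/H_map_injP => -[x y] [/sum_homogeneousP[hx hy]].
    rewrite sum_diffE => -[dx dy]; rewrite pE zNE addr0 => -[u hu du].
    have [v hv dv] := (H_zeroP n K).1 (Kac n) y (conj hy dy).
    exists (u, v); first exact/sum_homogeneousP.
    by rewrite sum_diffE du dv.
  apply/H_map_surjP => t [ht dt]; exists (t, 0).
    split; first by apply/sum_homogeneousP; split=> //; apply: homogeneous0.
    by rewrite sum_diffE dt diff0.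
  by rewrite pE zNE addr0 subrr; exists 0; [exact: homogeneous0|exact: diff0].
have e : loc_arr i0 = loc_arr i1.
  apply: (is_iso_mono (loc_arr_is_iso qp)); rewrite !loc_arr_comp; congr loc_arr.
  by apply: dgHom_eq => x; rewrite /= i0E i1E !pE !zNE.
have -> : f = dgHom_comp h i1 by apply: dgHom_eq => x; rewrite /= i1E hE fE.
have -> : g = dgHom_comp h i0.
  by apply: dgHom_eq => x; rewrite /= i0E hE z0E linear0 addr0.
by rewrite -!loc_arr_comp e.
Qed.

(* If morphisms to [E] extend along quasi-isomorphisms up to equality in the
   derived category, then formal inverses can be eliminated from zigzags. *)
Lemma derived_hom_strict (E : dgModule A) :
  (forall (N N' : dgModule A) (s : dgHom N N') (f : dgHom N E), @quasi_iso A N N' s ->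
     exists g : dgHom N' E, loc_arr (dgHom_comp g s) = loc_arr f) ->
  forall (N : dgModule A) (u : @hom (D A) N E), exists f, u = loc_arr f.
Proof.
move=> ext N u.
suff zz (M M' : dgModule A) (v : @zigzag (DGMod A) (@quasi_iso A) M M') (f : dgHom M' E) :
    exists g : dgHom M E, @compm (D A) _ _ _ (loc_arr f) (loc_class v) = loc_arr g.
  move: u; apply: (@loc_homW (DGMod A)) => v; have [g gE] := zz _ _ v (dgHom_id E).
  by exists g; apply: etrans gE; apply: esym; apply: (@comp1m (D A)).
elim: v f => {M M'} [M M' h|M M' s qs|M M' M'' v IHv w IHw] f.
- by exists (dgHom_comp f h); rewrite -loc_arr_comp.
- have [g gE] := ext _ _ s f qs; exists g.
  rewrite -gE -loc_arr_comp -(@compmA (D A)) -[RHS](@compm1 (D A)); congr compm.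
  by rewrite [LHS](@loc_compE (DGMod A) (@quasi_iso A)); apply/loc_class_eqP/zz_inv_r.
- have [g gE] := IHv f; have [g' g'E] := IHw g; exists g'.
  by rewrite -g'E -gE -(@compmA (D A)) [X in _ = compm _ X](@loc_compE (DGMod A) (@quasi_iso A)).
Qed.
End DerivedCategory.

(** * Morphisms to a coextension *)

Lemma coh_linear (A : dgRing) n (M : dgModule A) (a : Z0 A) (z t u : M)
    (hz : is_cocycle n z) (ht : is_cocycle n t) (hu : is_cocycle n u) :
  u = Z0_val a *: z + t -> coh hu = Z0_class a *: coh hz + coh ht.
Proof.
move=> e; rewrite [_ *: _]coh_actE -coh_classD.
by congr coh_class; apply: val_inj.
Qed.

Section HullCoextension.
Variables (A : dgRing) (J : lmodType (H0 A)) (h : hull J).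
Local Notation E := (coext_dgModule h).
Local Notation cE := (dgm_cpx E).

Lemma hull_in0 : hull_in h 0 = 0.
Proof.
have := hull_inD h 0 0; rewrite addr0 => e.
by apply: (addrI (hull_in h 0)); rewrite -e addr0.
Qed.

Lemma exact_eval1 n (f : E) : exact_cocycle n f -> coext_eval f 1 = 0.
Proof.
by move=> [y _ <-]; rewrite coext_eval_diff diff1 twist0 (sub_f0 (coext_evalB y)).
Qed.

(** The composite of degree-zero cocycles -> H^0(N) -> J -> hull is [Z0]-linear and kills
    boundaries. Injectivity of the hull extends it to [N], and the adjunction turns the extension
    into a strict morphism. *)
Lemma strict_lift (N : dgModule A) (f0 : {linear H 0 N -> J}) :
  exists phi : dgHom N E, forall z (hz : is_cocycle 0 z),
    coext_eval (phi z) 1 = hull_in h (f0 (coh hz)).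
Proof.
pose cN := dgm_cpx N.
pose NZ := restrict_scalars (Z0_val (A := A)) N.
(* Elements whose degree-zero component is 0 also belong to [P], so the extension is forced to
   vanish outside degree 0. *)
pose P (v : NZ) := diff cN (gpr cN 0 v) = 0.
have cP v : P v -> is_cocycle 0 (gpr cN 0 v : N) by split=> //; apply: homogeneous_gpr.
have /choice[c cE] (v : NZ) : exists x : H 0 N, forall hv : P v, x = coh (cP v hv).
  have [Pv|nP] := pselect (P v); last by exists 0.
  by exists (coh (cP v Pv)) => hv; congr (coh (cP v _)); apply: Prop_irrelevance.
have sP : submodule_axiom P.
  split=> [|a x y Px Py]; first by rewrite /P gpr0 diff0.
  by rewrite /P gprD diffD gpr_Z0_scale diff_Z0_scale Px Py scaler0 addr0.
have [a x y Px Py|G GE] :=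
    @injective_extend _ h NZ P (fun v => hull_in h (f0 (c v))) (hull_inj (h := h)) sP.
  rewrite (cE _ Px) (cE _ Py) (cE _ (sP.2 a _ _ Px Py)).
  rewrite (coh_linear (a := a) (cP _ Px) (cP _ Py)); last by rewrite gprD gpr_Z0_scale.
  by rewrite linearD hull_inD linearZ hull_inZ.
have Gcoh v (hv : is_cocycle 0 (gpr cN 0 v)) : G v = hull_in h (f0 (coh hv)).
  have Pv : P v by case: hv.
  by rewrite GE // (cE _ Pv); do 2 congr (_ _); congr coh; apply: Prop_irrelevance.
have Gl : Z0_linear (N := N) G.
  by split=> [x y|z x]; [exact: linearB|exact: (linearZZ G z x)].
have Gexact v : exact_cocycle 0 (gpr cN 0 v) -> G v = 0.
  move=> ev; have hv : is_cocycle 0 (gpr cN 0 v).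
    by split; [exact: homogeneous_gpr|case: ev => y _ <-; exact: diffK].
  by rewrite (Gcoh _ hv) ((coh_eq0 hv).2 ev) linear0 hull_in0.
have Gs : supported (N := N) 0 G.
  move=> x; apply/eqP; rewrite -subr_eq0 -linearB; apply/eqP/Gexact.
  rewrite gprB gprK eqxx subrr.
  by exists 0; [exact: homogeneous0|exact: diff0].
have Gd x : G (diff cN x) = 0.
  apply: Gexact; rewrite gpr_diff'; exists (gpr cN (0 - 1) x) => //.
  exact: homogeneous_gpr.
have [L LG] := @lift_exists _ _ N 0 G Gl Gs.
have [phi phiL] := lift_dgHom Gl Gs Gd LG.
exists phi => z hz; rewrite phiL LG twist_by0 scale1r.
have hz' : is_cocycle 0 (gpr cN 0 z) by case: (hz) => -> .
rewrite (Gcoh _ hz'); do 2 congr (_ _).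
by apply/coh_eq; case: (hz) => -> _; rewrite subrr; exists 0; [exact: homogeneous0|exact: diff0].
Qed.

(** The difference [Delta] of the evaluations at 1 kills cocycles, so it is some [G] composed with
    the differential. Together [Delta] and [- G] form a functional on the cone of the identity of
    [N]; its adjoint [k] is a morphism through which [f - g] factors, and that cone is acyclic. *)
Lemma loc_arr_eq_coext (N : dgModule A) (f g : dgHom N E) :
  (forall z, is_cocycle 0 z -> coext_eval (f z) 1 = coext_eval (g z) 1) ->
  loc_arr f = loc_arr g.
Proof.
move=> fg; pose cN := dgm_cpx N.
have [[fB fZ] fs fl] := hom_degree_lifts (dgHom_hom_degree f).
have [[gB gZ] gs gl] := hom_degree_lifts (dgHom_hom_degree g).
pose Delta (x : N) := evaluation1 f x - evaluation1 g x.
have Dl : Z0_linear Delta.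
  split=> [x y|z x]; last by rewrite /Delta fZ gZ scalerBr.
  by rewrite /Delta fB gB !opprD !opprK addrACA.
have Ds : supported 0 Delta by move=> x; rewrite /Delta fs gs.
have Dd x : Delta (diff cN x) = 0.
  by rewrite /Delta /evaluation1 !dgh_diff !coext_eval_diff diff1 twist0
    !(sub_f0 (coext_evalB _)) subrr.
have [|G [[GB GZ] Gs Gd]] := contract_along_diff (hull_inj (h := h)) Dl Ds.
  by move=> x hx dx; apply/eqP; rewrite subr_eq0; apply/eqP/fg.
pose K := cone (dgHom_id N).
pose F (v : K) := Delta v.1 - G v.2.
have [DB DZ] := Dl.
have Fl : Z0_linear F.
  split=> [[x y] [x' y']|z [x y]]; last first.
    rewrite -[LHS]/(Delta (Z0_val z *: x) - G (Z0_val z *: y)) DZ GZ.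
    by rewrite -[RHS]/(z *: (Delta x - G y)) [RHS]scalerBr.
  rewrite -[LHS]/(Delta (x - x') - G (y - y')) DB GB.
  by rewrite -[RHS]/(Delta x - G y - (Delta x' - G y')) !opprD !opprK addrACA.
have Fs : supported 0 F 
  by move=> [x y]; rewrite -[LHS]/(Delta (gpr cN 0 x) - G (gpr cN (0 + 1) y)) Ds Gs.
have Fd v : F (diff (dgm_cpx K) v) = 0.
  case: v => x y; rewrite -[LHS]/(Delta (diff cN x + twist cN 1 y) - G (diff cN y)).
  by rewrite Gd (sub_fD DB) Dd add0r -Ds gpr_twist mulr0 sg_even0 Ds subrr.
have [L LF] := @lift_exists _ _ K 0 F Fl Fs.
have [k kL] := lift_dgHom Fl Fs Fd LF.
apply: (@loc_arr_eq_of_acyclic _ _ _ _ f g (cone_in (dgHom_id N)) k).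
  exact: cone_id_acyclic.
move=> x; apply/eqP; rewrite addrC -subr_eq; apply/eqP/esym.
apply: coext_eval_eq => n a _; rewrite kL cone_inE LF /F /=.
by rewrite scaler0 (sub_f0 GB) subr0 coext_evalBl fl gl.
Qed.

Hypothesis hA : nonpositive A.

Lemma nonpositive_cocycle (a : A) : homogeneous (dgr_cpx A) 0 a ->
  exists z : Z0 A, a = Z0_val z.
Proof.
move=> ha; have da : diff (dgr_cpx A) a = 0.
  by apply: (hA (i := 0 + 1)) => //; exact: homogeneous_diff.
by exists (cocycles_mk (introT (cocycleP _ _ _) (conj ha da))).
Qed.

Lemma coext_nonneg n (f : E) : n < 0 -> homogeneous cE n f -> f = 0.
Proof.
move=> n0 hf; apply: coext_eval_eq => m a ha.
have [e|mn] := eqVneq m (- n); last exact: coext_eval_homogeneous hf ha mn.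
by rewrite (hA _ ha) ?(sub_f0 (coext_evalB _)) // e oppr_gt0.
Qed.

Lemma coext_eval1_inj (f : E) : homogeneous cE 0 f -> coext_eval f 1 = 0 -> f = 0.
Proof.
move=> hf f1; apply: coext_eval_eq => m a ha.
have [m0|mn] := eqVneq m (- 0); last exact: coext_eval_homogeneous hf ha mn.
rewrite m0 in ha; have [z ->] := nonpositive_cocycle ha.
by rewrite -[Z0_val z]mulr1 coext_evalZl f1 scaler0.
Qed.

(** The map is evaluation at 1. For a cocycle this value is killed by the boundaries, hence lies in
    [J]; it determines the cocycle because A^0 consists of cocycles and [E] is zero in degree -1
    modulo nothing else. *)
Lemma coext_H0 : exists theta : {linear H 0 E -> J},
  [/\ injective theta, forall x, exists y, theta y = x &
    forall z (hz : is_cocycle 0 z), hull_in h (theta (coh hz)) = coext_eval z 1].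
Proof.
have /choice[t tE] (x : H 0 E) :
    exists j, forall z (hz : is_cocycle 0 z), coh hz = x -> hull_in h j = coext_eval z 1.
  elim/cohP: x => z hz.
  have [j jE] : exists j, coext_eval z 1 = hull_in h j.
    apply: hull_in_surj => b [y hy dy]; rewrite -coext_evalZl mulr1.
    case: hz => _ /(congr1 (fun f => coext_eval f y)).
    by rewrite coext_eval_diff (twist_homogeneous _ (homogeneous_diff hy)) dy.
  exists j => z' hz' /coh_eq /exact_eval1; rewrite coext_evalBl => /eqP.
  by rewrite subr_eq0 -jE => /eqP.
have tL : linear t.
  elim/Z0_classW => a x y; elim/cohP: x => x hx; elim/cohP: y => y hy.
  have hu : is_cocycle 0 (Z0_val a *: x + y).
    split; first apply: homogeneousD; last by rewrite diffD diff_Z0_scale hx.2 hy.2 scaler0 addr0.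
      by have := dgmZ (Z0_homogeneous a) hx.1; rewrite add0r.
    exact: hy.1.
  rewrite -(coh_linear hx hy hu) //; apply: (hull_in_inj (h := h)).
  rewrite hull_inD hull_inZ (tE _ _ hu) // (tE _ _ hx) // (tE _ _ hy) //.
  by rewrite -[Z0_val a]mulr1 -[LHS]/(coext_eval x _ + coext_eval y _) mul1r coext_evalZl.
exists (pack_linear tL); split.
- move=> x y; elim/cohP: x => x hx; elim/cohP: y => y hy /= /(congr1 (hull_in h)).
  rewrite !(tE _ _ _ erefl) => /eqP; rewrite -subr_eq0 -coext_evalBl => /eqP xy.
  apply/coh_eq; rewrite (coext_eval1_inj _ xy); last by apply: homogeneousB; [case: hx|case: hy].
  by exists 0; [exact: homogeneous0|exact: diff0].
(* For surjectivity, [j] is the value at 1 of the map [a -> a *: j] on H^0 of the regular module,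
   and that map lifts strictly. *)
- move=> j; pose f0 (a : H 0 (regular_dgModule A)) := (a : H0 A) *: j.
  have f0L : linear f0 by move=> a x y; rewrite /f0 scalerDl -scalerA.
  have [phi phiE] := @strict_lift (regular_dgModule A) (pack_linear f0L).
  have h1 : is_cocycle 0 (1 : regular_dgModule A) by split; [exact: dgr1|exact: diff1].
  exists (coh (is_cocycle_map phi h1)); apply: (hull_in_inj (h := h)) => /=.
  rewrite (tE _ _ (is_cocycle_map phi h1)) // phiE /= /f0.
  rewrite (_ : coh h1 = 1 :> H0 A) ?scale1r //.
  by congr coh_class; apply: val_inj.
- by move=> z hz; apply: tE.
Qed.

Definition coext_theta : {linear H 0 E -> J} := projT1 (cid coext_H0).

Lemma coext_theta_inj : injective coext_theta.
Proof. by case: (projT2 (cid coext_H0)). Qed.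

Lemma coext_theta_surj x : exists y, coext_theta y = x.
Proof. by case: (projT2 (cid coext_H0)) => _ + _; apply. Qed.

Lemma coext_thetaE z (hz : is_cocycle 0 z) :
  hull_in h (coext_theta (coh hz)) = coext_eval z 1.
Proof. by case: (projT2 (cid coext_H0)) => _ _; apply. Qed.

Lemma coext_H0_injective : injective_module (J : Mod (H0 A)) ->
  injective_module (H 0 E : Mod (H0 A)).
Proof.
have /choice[g gE] := coext_theta_surj.
have gL : linear g by move=> a x y; apply: coext_theta_inj; rewrite linearP !gE.
apply: (@injective_retract _ _ _ coext_theta (pack_linear gL)).
by move=> x; apply: coext_theta_inj; rewrite /= gE.
Qed.

Lemma coext_full (N : dgModule A) (f0 : {linear H 0 N -> H 0 E}) :
  exists phi : dgHom N E, H_map 0 phi = f0.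
Proof.
have [phi phiE] := strict_lift (coext_theta \o f0); exists phi.
apply: linear_eq; elim/cohP => z hz; rewrite H_map_coh.
apply/coext_theta_inj/(hull_in_inj (h := h)).
by rewrite coext_thetaE phiE.
Qed.

Lemma coext_faithful_strict (N : dgModule A) (f g : dgHom N E) :
  H_map 0 f = H_map 0 g -> loc_arr f = loc_arr g.
Proof.
move=> e; apply: loc_arr_eq_coext => z hz.
rewrite -(coext_thetaE (is_cocycle_map f hz)) -(coext_thetaE (is_cocycle_map g hz)).
by rewrite -!H_map_coh e.
Qed.

(** On H^0 the quasi-isomorphism [s] is invertible, so [H_map 0 f] extends along it; [coext_full]
    realizes the extension, and [coext_faithful_strict] shows that it restricts to [f]. *)
Lemma coext_hom_strict (N : dgModule A) (u : @hom (D A) N E) :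
  exists f : dgHom N E, u = loc_arr f.
Proof.
apply: derived_hom_strict u => M M' s f qs.
have [r [rs sr]] := qs 0.
have [g gE] := coext_full (H_map 0 f \o (r : {linear H 0 M' -> H 0 M})).
exists g; apply: coext_faithful_strict.
apply: linear_eq => x.
apply: (etrans (congr1 (fun q : {linear H 0 M -> H 0 E} => q x)
  (fmapM (H_functor A 0) (g : @hom (DGMod A) M' E) s))).
rewrite -[LHS]/(H_map 0 g (H_map 0 s x)) gE /=; congr (H_map 0 f _).
exact: (congr1 (fun q : {linear H 0 M -> H 0 M} => q x) rs).
Qed.

Lemma coext_derived_full (N : dgModule A) (f0 : {linear H 0 N -> H 0 E}) :
  exists u : @hom (D A) N E, fmap (HD A 0) u = f0.
Proof. by have [phi e] := coext_full f0; exists (loc_arr phi); rewrite HD_loc_arr. Qed.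

Lemma coext_derived_faithful (N : dgModule A) (u v : @hom (D A) N E) :
  fmap (HD A 0) u = fmap (HD A 0) v -> u = v.
Proof.
have [f ->] := coext_hom_strict u; have [g ->] := coext_hom_strict v.
by rewrite !HD_loc_arr; apply: coext_faithful_strict.
Qed.
End HullCoextension.

(** * Truncations and infima *)

Section Truncation.
Variables (A : dgRing) (hA : nonpositive A) (C : dgModule A) (c : int).
Local Notation cC := (dgm_cpx C).

Definition trunc_pred (x : C) :=
  (forall n, c < n -> gpr cC n x = 0) /\ diff cC (gpr cC c x) = 0.

(** Non-positivity makes the truncation stable under scalars: those of negative degree leave nothing
    in degrees [>= c], and those of degree 0 are cocycles, so they preserve the cocycle condition in
    degree [c]. *)
Lemma trunc_axiom : submodule_axiom trunc_pred.
Proof.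
have T0 : trunc_pred 0 by split=> [n _|]; rewrite gpr0 ?diff0.
have TD x y : trunc_pred x -> trunc_pred y -> trunc_pred (x + y).
  move=> [x1 x2] [y1 y2]; split=> [n cn|]; first by rewrite gprD x1 // y1 // addr0.
  by rewrite gprD diffD x2 y2 addr0.
split=> // a x y Tx Ty; apply: (TD) => //.
elim/(@gpr_ind _ (dgr_cpx A)): a => [|a b Ta Tb|i a ha]; first by rewrite scale0r.
  by rewrite scalerDl; apply: TD.
have [i0|i0|i0] := ltgtP i 0; first last.
- subst i; case: (Tx) => x1 x2; have [z ->] := nonpositive_cocycle hA ha.
  split=> [n cn|]; first by rewrite gpr_Z0_scale x1 // scaler0.
  by rewrite gpr_Z0_scale diff_Z0_scale x2 scaler0.
- by rewrite (hA i0 ha) scale0r.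
- case: Tx => x1 x2; split=> [n cn|]; rewrite (gpr_scale _ _ ha) x1 ?scaler0 ?diff0 //; lia.
Qed.

Local Notation T := (submodule trunc_axiom).

Lemma trunc_gpr_axiom n (x : T) : trunc_pred (gpr cC n (val x)).
Proof.
have [x1 x2] := subP x; split=> [m cm|]; rewrite gprK; case: eqP => // e.
- by rewrite x1 // -e.
- by rewrite -e.
- by rewrite diff0.
Qed.

Lemma trunc_diff_axiom (x : T) : trunc_pred (diff cC (val x)).
Proof.
have [x1 x2] := subP x; split=> [m cm|]; rewrite gpr_diff'; last by rewrite diffK.
have [->|mc] := eqVneq (m - 1) c; first exact: x2.
by rewrite x1 ?diff0 //; move/eqP: mc; lia.
Qed.

Definition trunc_gpr n (x : T) : T := mk_sub trunc_axiom (trunc_gpr_axiom n x).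
Definition trunc_diff (x : T) : T := mk_sub trunc_axiom (trunc_diff_axiom x).

Lemma trunc_gprB n : subtractive (trunc_gpr n).
Proof. by move=> x y; apply: val_inj; apply: gprB. Qed.

Lemma trunc_gprK m n x : trunc_gpr m (trunc_gpr n x) = if m == n then trunc_gpr n x else 0.
Proof. by apply: val_inj; rewrite /= gprK; case: eqP. Qed.

Lemma trunc_gpr_fin x : exists s : seq int, forall n, n \notin s -> trunc_gpr n x = 0.
Proof.
by have [s hs] := gpr_fin cC (val x); exists s => n /hs e; apply: val_inj.
Qed.

Lemma trunc_gpr_sep x : (forall n, trunc_gpr n x = 0) -> x = 0.
Proof.
move=> x0; apply: val_inj; apply: (@gpr_sep _ cC) => n.
exact: (congr1 val (x0 n)).
Qed.

Lemma trunc_diffB : subtractive trunc_diff.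
Proof. by move=> x y; apply: val_inj; apply: diffB. Qed.

Lemma trunc_diff_deg n x : trunc_gpr n x = x -> trunc_gpr (n + 1) (trunc_diff x) = trunc_diff x.
Proof. by move=> /(congr1 val) hx; apply: val_inj; apply: homogeneous_diff. Qed.

Lemma trunc_diffK x : trunc_diff (trunc_diff x) = 0.
Proof. by apply: val_inj; apply: diffK. Qed.

Definition trunc_complex : complex_on T :=
  make_complex trunc_gprB trunc_gprK trunc_gpr_fin trunc_gpr_sep
    trunc_diffB trunc_diff_deg trunc_diffK.

Lemma trunc_homogeneousP n (x : T) : homogeneous trunc_complex n x <-> homogeneous cC n (val x).
Proof. by split=> [/(congr1 val)|hx] //; apply: val_inj. Qed.

Lemma trunc_dgmZ i j (a : A) x : homogeneous (dgr_cpx A) i a ->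
  homogeneous trunc_complex j x -> homogeneous trunc_complex (i + j) (a *: x).
Proof. by move=> ha /trunc_homogeneousP hx; apply/trunc_homogeneousP/dgmZ. Qed.

Lemma trunc_leibniz i (a : A) x : homogeneous (dgr_cpx A) i a ->
  diff trunc_complex (a *: x) =
  diff (dgr_cpx A) a *: x + (isign A i * a) *: diff trunc_complex x.
Proof. by move=> ha; apply: val_inj; apply: (dgm_leibniz _ ha). Qed.

Definition trunc : dgModule A := @DGModule A T trunc_complex trunc_dgmZ trunc_leibniz.

Definition trunc_in : dgHom trunc C :=
  @DGHom A trunc C (sub_incl trunc_axiom) (fun _ _ => erefl) (fun _ => erefl).

Lemma trunc_in_inj : injective trunc_in.
Proof. exact: val_inj. Qed.

Lemma trunc_lift n (x : C) : homogeneous cC n x -> n < c \/ n = c /\ diff cC x = 0 ->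
  exists t : trunc, homogeneous (dgm_cpx trunc) n t /\ trunc_in t = x.
Proof.
move=> hx nc; suff Tx : trunc_pred x.
  by exists (mk_sub trunc_axiom Tx); split=> //; apply/trunc_homogeneousP.
split=> [m cm|]; rewrite (gpr_homogeneous _ hx); case: eqP => // e.
- by case: nc => [|[]]; lia.
- by case: nc => [|[_ ->]] //; lia.
- by rewrite diff0.
Qed.

Lemma trunc_H_gt n : c < n -> H_zero n (trunc : D A).
Proof.
move=> cn; apply/H_zeroP => z [hz _]; have [x1 _] := subP z.
suff -> : z = 0 by exists 0; [exact: homogeneous0|exact: diff0].
by apply: val_inj; rewrite -((trunc_homogeneousP _ _).1 hz) x1.
Qed.

Lemma trunc_H_lt n : n < c -> H_zero n (C : D A) -> H_zero n (trunc : D A).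
Proof.
move=> nc /H_zeroP C0; apply/H_zeroP => z hz.
have [y hy dy] := C0 _ (is_cocycle_map trunc_in hz).
have [|t [ht te]] := trunc_lift hy; first by left; lia.
by exists t => //; apply: trunc_in_inj; rewrite dgh_diff te.
Qed.

Lemma trunc_H_iso : injective (H_map c trunc_in) /\
  forall x, exists y, H_map c trunc_in y = x.
Proof.
split.
- apply/H_map_injP => z hz [y hy dy].
  have [|t [ht te]] := trunc_lift hy; first by left; lia.
  by exists t => //; apply: trunc_in_inj; rewrite dgh_diff te.
- apply/H_map_surjP => t [ht dt]; have [|z [hz ze]] := trunc_lift ht; first by right.
  exists z; last by rewrite ze subrr; exists 0; [exact: homogeneous0|exact: diff0].
  by split=> //; apply: trunc_in_inj; rewrite dgh_diff ze dt linear0.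
Qed.

Lemma trunc_bounded : (forall n, n < c -> H_zero n (C : D A)) -> bounded (trunc : D A).
Proof.
move=> C0; exists `|c|%N => n cn.
have [nc|nc|nc] := ltgtP n c; [exact/trunc_H_lt/C0|exact: trunc_H_gt|].
by rewrite nc ltnn in cn.
Qed.
End Truncation.

Section ExtendedInfimum.
Local Open Scope classical_set_scope.
Implicit Types (S : set int) (n m : int) (z : \bar int).

Lemma int_min S : S !=set0 -> (exists b, forall n, S n -> b <= n) ->
  exists m, S m /\ forall n, S n -> m <= n.
Proof.
move=> [s Ss] [b hb].
pose Q (k : nat) := `[< S (b + k%:Z) >].
have exQ : exists k, Q k.
  exists `|(s - b)%R|%N; apply/asboolP; have bs := hb _ Ss.
  by rewrite (_ : _ + _ = s) //; lia.
have [k /asboolP Sk kmin] := ex_minnP exQ.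
exists (b + k%:Z); split=> // n Sn; have bn := hb _ Sn.
have : (k <= `|(n - b)%R|)%N.
  by apply: kmin; apply/asboolP; rewrite (_ : _ + _ = n) //; lia.
by lia.
Qed.

Let I S := [set (n%:E)%E | n in S].

(** [infimum] selects an element of [infimums] and falls back on a default if there is none, so
    existence has to be established before it can be used. *)
Lemma extinf_infimums S : S !=set0 -> infimums (I S) !=set0.
Proof.
move=> S0; have [lb|nlb] := pselect (exists b, forall n, S n -> b <= n).
  have [m [Sm hm]] := int_min S0 lb; exists m%:E; split.
    by move=> _ [n Sn <-]; rewrite lee_fin; apply: hm.
  by move=> z; apply; exists m.
exists -oo%E; split=> [z _|z hz]; first exact: leNye.
move: z hz => [b||//] hz.
  by case: nlb; exists b => n Sn; rewrite -lee_fin; apply: hz; exists n.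
by case: S0 => s Ss; have := hz _ (imageP _ Ss).
Qed.

Lemma extinf_le S n : S n -> (extinf S <= n%:E)%E.
Proof.
move=> Sn; apply: le_infimum_Nmem; last by exists n.
by apply: extinf_infimums; exists n.
Qed.

Lemma le_extinf S z : (forall n, S n -> (z <= n%:E)%E) -> (z <= extinf S)%E.
Proof.
move=> hz; rewrite /extinf /infimum; case: eqP => [_|nS]; first exact: leey.
have : infimums (I S) !=set0.
  by apply: extinf_infimums; apply/set0P/eqP => S0; apply: nS; rewrite S0 image_set0.
case=> x xI; case: xgetP => [y _ [_ hy]|/(_ x)] //.
by apply: hy => _ [n Sn <-]; apply: hz.
Qed.

(** An integer infimum is attained, since otherwise [n + 1] would be a lower bound. Hence injective
    dimension 0 yields the Ext vanishing for the bound 0 itself. *)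
Lemma extinf_mem S n : extinf S = n%:E -> S n.
Proof.
move=> e; apply: contrapT => nSn.
have : ((n + 1)%:E <= extinf S)%E.
  apply: le_extinf => m Sm; rewrite lee_fin; have := extinf_le Sm; rewrite e lee_fin.
  suff : n <> m by lia.
  by move=> nm; apply: nSn; rewrite nm.
by rewrite e lee_fin; lia.
Qed.
End ExtendedInfimum.

Section InfFacts.
Variable A : dgRing.
Implicit Types (M N : D A).

Lemma inf_ge0 N : (forall n, n < 0 -> H_zero n N) -> (0 <= inf N)%E.
Proof.
move=> h; apply: le_extinf => n /= nz; rewrite lee_fin leNgt.
by apply/negP => /h.
Qed.

Lemma inf_eq0_H_zero M n : inf M = 0%E -> n < 0 -> H_zero n M.
Proof.
move=> e n0; apply: contrapT => nz.
have : (inf M <= n%:E)%E by apply: extinf_le.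
by rewrite e lee_fin; lia.
Qed.

Lemma inj_dim0_Ext M N : inj_dim M = 0%E -> bounded N ->
  (forall n, n < 0 -> H_zero n N) -> Ext_zero 1 N M.
Proof.
move=> e bN hN; have /(_ N bN) := extinf_mem (n := 0) e; apply.
rewrite sub0e; apply: (@le_lt_trans _ _ 0%E); last by rewrite lte_fin.
by rewrite oppe_le0; apply: inf_ge0.
Qed.
End InfFacts.

(** * Coextension models of injective DG-modules *)

Section Splitting.
Variables (A : dgRing) (hA : nonpositive A) (J : lmodType (H0 A)) (h : hull J).
Local Notation E := (coext_dgModule h).
Local Notation cE := (dgm_cpx E).
Variables (M : dgModule A) (phi : dgHom M E).
Local Notation cM := (dgm_cpx M).
Local Notation C := (cone phi).
Hypothesis M_ext : forall N : D A, bounded N -> (forall n, n < 0 -> H_zero n N) ->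
  Ext_zero 1 N (M : D A).

(* The obstruction to lifting [tau_(<= c) C -> C] along [E -> C] lies in [Ext^1]
   of a module with cohomology in degree [c >= 0] only, with values in [M]. *)
Lemma cone_splitting c : 0 <= c -> (forall n, n < c -> H_zero n (C : D A)) ->
  exists s : {linear H c C -> H c E},
    (forall x, H_map c (cone_in phi) (s x) = x) /\ (0 < c -> forall x, s x = 0).
Proof.
move=> c0 C0; pose N := trunc hA C c.
have N0 n : n < 0 -> H_zero n (N : D A).
  by move=> n0; have nc := lt_le_trans n0 c0; apply: trunc_H_lt (C0 _ nc).
have [P [p [_ qp PM]]] := M_ext (trunc_bounded hA C0) N0.
pose cP := dgm_cpx P.
pose psi : dgHom P C := dgHom_comp (trunc_in hA C c) p.
pose alpha x : E := (psi x).1; pose beta x : M := (psi x).2.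
have psiE x : psi x = (alpha x, beta x) by rewrite /alpha /beta; case: (psi x).
have alphaB : subtractive alpha by move=> x y; rewrite /alpha linearB.
have betaB : subtractive beta by move=> x y; rewrite /beta linearB.
have psi_d x : alpha (diff cP x) = diff cE (alpha x) + phi (twist cM 1 (beta x)) /\
    beta (diff cP x) = diff cM (beta x).
  have := dgh_diff psi x; rewrite !psiE cone_diffE => -[]; by split.
have psi_h n x : homogeneous cP n x ->
    homogeneous cE n (alpha x) /\ homogeneous cM (n + 1) (beta x).
  by move=> /(dgHom_homogeneous psi); rewrite psiE => /cone_homogeneousP.
(* The twist turns the second component of [psi] into a degree-1 cocycle of Hom(P, M). A primitive
   [g] of it corrects the first component [alpha] to a morphism [alpha'] into [E]. *)
pose beta' x := twist cM 1 (beta x).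
have [||g gk gd] := PM beta'.
- split.
  + by move=> x y; rewrite /beta' betaB twistB.
  + by move=> n x /psi_h[_ bx]; apply: homogeneous_twist.
  + move=> j a x ha; rewrite /beta' /beta linearZ /= (twist_scale _ _ ha).
    by rewrite isignZ.
- apply/funext => x; rewrite /hom_diff isignZ /beta' (psi_d x).2 twist_diff.
  by rewrite !sg1 opprK addrC addNr.
rewrite subrr in gk gd; case: gk => gB gh gZ.
have {}gd x : diff cM (g x) - g (diff cP x) = beta' x by rewrite -gd /hom_diff isignZ.
have [|||x|alpha' alphaE'] := @make_dgHom A P E (fun x => alpha x + phi (g x)).
- by move=> x y; rewrite alphaB gB linearB opprD addrACA.
- move=> i a x ha; rewrite (gZ _ _ _ ha) mul0r isignZ sg_even0 linearZ scalerDr.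
  by rewrite /alpha linearZ.
- move=> n x hx; apply: homogeneousD; first by case: (psi_h _ _ hx).
  by apply: dgHom_homogeneous; have := gh _ _ hx; rewrite addr0.
- rewrite (psi_d x).1 diffD -dgh_diff -addrA -linearD -/(beta' x) -gd.
  by rewrite subrK.
have psi_alpha : forall x, H_map c (cone_in phi) (H_map c alpha' x) = H_map c psi x.
  elim/cohP => z hz; rewrite !H_map_coh; apply/coh_eq.
  rewrite cone_inE alphaE' psiE.
  (* The map [x -> (0, twist cM 1 (g x))] is the homotopy between [psi] and [alpha'] followed by
     [cone_in phi]. *)
  exists (0, twist cM 1 (g z)).
    apply/cone_homogeneousP; split; first exact: homogeneous0.
    by rewrite subrK; apply: homogeneous_twist; have := gh _ _ hz.1; rewrite addr0.
  rewrite cone_diffE diff0 add0r twistK.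
  rewrite -[RHS]/(alpha z + phi (g z) - alpha z, 0 - beta z) addrAC subrr add0r sub0r.
  congr (_, _); have := gd z; rewrite hz.2 (sub_f0 gB) subr0 => dg.
  by rewrite -[beta z](@twistK _ cM 1) -/(beta' z) -dg twist_diff sg1 opprK.
have [ip sp] := (quasi_isoP p).1 qp c.
have [it st] := trunc_H_iso hA C c.
have psi_comp : forall x, H_map c psi x = H_map c (trunc_in hA C c) (H_map c p x).
  elim/cohP => z hz; rewrite !H_map_coh; apply/coh_eq.
  by rewrite subrr; exists 0; [exact: homogeneous0|exact: diff0].
have psi_inj : injective (H_map c psi) by move=> x y; rewrite !psi_comp => /it /ip.
have /choice[q qE] y : exists x, H_map c psi x = y.
  by have [t <-] := st y; have [x <-] := sp t; exists x; rewrite psi_comp.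
have qL : linear q by move=> a x y; apply: psi_inj; rewrite linearP !qE.
exists (H_map c alpha' \o pack_linear qL); split=> [x|cpos x].
  by rewrite /= psi_alpha qE.
(* For [0 < c] the module [P] has no cohomology in degree 0. Faithfulness of H^0 on maps to [E]
   makes [alpha'] zero in the derived category, hence zero on H^c as well. *)
have [z zE] := dgHom_zero_exists P E.
have /(congr1 (fmap (HD A c))) : loc_arr alpha' = loc_arr z.
  apply: (coext_faithful_strict hA); apply: linear_eq => y.
  rewrite (_ : y = 0) ?linear0 //.
  have [i0 _] := (quasi_isoP p).1 qp 0; apply: i0; rewrite linear0.
  exact: (trunc_H_lt (hA := hA) cpos (C0 0 cpos)).
rewrite !HD_loc_arr => e; rewrite -[LHS]/(H_map c alpha' (q x)) e; elim/cohP: (q x) => t ht.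
by rewrite H_map_coh; apply/coh_eq0; rewrite zE; exists 0; [exact: homogeneous0|exact: diff0].
Qed.

(** A negative-degree cocycle of the cone has no component in [E], so it is a cocycle of [M] killed
    by [phi]. Injectivity on H^0 makes it exact for [n = -1], and vanishing of the cohomology of [M]
    does so below. *)
Lemma cone_H_neg : (forall n, n < 0 -> H_zero n (M : D A)) ->
  injective (H_map 0 phi) -> forall n, n < 0 -> H_zero n (C : D A).
Proof.
move=> M0 /H_map_injP phi_inj n n0; apply/H_zeroP => -[e m].
rewrite /is_cocycle cone_diffE => -[/cone_homogeneousP[he hm] d0].
have de : diff cE e + phi (twist cM 1 m) = 0 := congr1 (fun v : E * M => v.1) d0.
have dm : diff cM m = 0 := congr1 (fun v : E * M => v.2) d0.
have e0 : e = 0 by apply: (coext_nonneg hA n0 he).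
have m0 : phi m = 0.
  move: de; rewrite e0 diff0 add0r (twist_homogeneous _ hm).
  by rewrite (sub_f_sg _ _ (subtractive_linear phi)) => /sg_eq0.
have [m' hm' dm'] : exact_cocycle (n + 1) m.
  have [n1|n1] := eqVneq (n + 1) 0.
    rewrite n1; apply: phi_inj; first by rewrite -n1.
    by rewrite m0; exists 0; [exact: homogeneous0|exact: diff0].
  by apply: (H_zeroP _ _).1 => //; apply: M0; move/eqP: n1; lia.
rewrite addrK in hm'.
exists (0, m'); first by apply/cone_homogeneousP; rewrite subrK; split=> //; apply: homogeneous0.
rewrite cone_diffE diff0 add0r dm' e0; congr (_, _).
by apply: (coext_nonneg hA n0); apply/dgHom_homogeneous/homogeneous_twist.
Qed.

Lemma cone_in_phi : forall x, H_map 0 (cone_in phi) (H_map 0 phi x) = 0.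
Proof.
elim/cohP => m hm; rewrite !H_map_coh; apply/coh_eq0; rewrite cone_inE.
exists (0, twist cM 1 m).
  apply/cone_homogeneousP; split; first exact: homogeneous0.
  by rewrite subrK; apply: homogeneous_twist hm.1.
rewrite cone_diffE diff0 add0r twistK.
have := twist_diff cM 1 m; rewrite hm.2 twist0 sg1 => /esym/eqP.
by rewrite oppr_eq0 => /eqP ->.
Qed.

Lemma cone_in_ker : forall x, H_map 0 (cone_in phi) x = 0 -> exists y, x = H_map 0 phi y.
Proof.
elim/cohP => e he; rewrite H_map_coh => /coh_eq0[[e' m'] /cone_homogeneousP[he' hm']].
rewrite cone_inE cone_diffE => d0.
have de : diff cE e' + phi (twist cM 1 m') = e := congr1 (fun v : E * M => v.1) d0.
have dm : diff cM m' = 0 := congr1 (fun v : E * M => v.2) d0.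
have e'0 : e' = 0 by apply: coext_nonneg he'.
have hm : is_cocycle 0 (twist cM 1 m').
  split; first by rewrite subrK in hm'; apply: homogeneous_twist hm'.
  have := twist_diff cM 1 m'; rewrite dm twist0 sg1 => /esym/eqP.
  by rewrite oppr_eq0 => /eqP.
exists (coh hm); rewrite H_map_coh; apply/coh_eq.
rewrite -de e'0 diff0 add0r subrr.
by exists 0; [exact: homogeneous0|exact: diff0].
Qed.

Lemma quasi_iso_of_acyclic_cone : acyclic C -> @quasi_iso A M E phi.
Proof.
move=> C0; apply/quasi_isoP => n; split.
- apply/H_map_injP => m [hm dm] [y hy dy].
  (* When [phi m] is the differential of [y], the sign on [y] cancels the twist of [m], giving a
     cocycle of the cone in degree [n - 1]. The second component of a primitive is a primitive of
     [m]. *)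
  have [|[e' m'] /cone_homogeneousP[_ hm']] :=
    (H_zeroP _ _).1 (C0 (n - 1)) (- sg n y, m).
    split.
      apply/cone_homogeneousP; rewrite subrK; split=> //.
      exact/homogeneousN/homogeneous_sg.
    rewrite cone_diffE dm (twist_homogeneous _ hm) mul1r diffN diff_sg dy.
    by rewrite (sub_f_sg _ _ (subtractive_linear phi)) addNr.
  by rewrite subrK in hm'; rewrite cone_diffE => -[_ dm'']; exists m'.
- apply/H_map_surjP => t [ht dt].
  have [|[e' m'] /cone_homogeneousP[he' hm']] := (H_zeroP _ _).1 (C0 n) (t, 0).
    split; first by apply/cone_homogeneousP; split=> //; apply: homogeneous0.
    by rewrite cone_diffE dt twist0 linear0 addr0 diff0.
  rewrite cone_diffE => d0.
  have de : diff cE e' + phi (twist cM 1 m') = t := congr1 (fun v : E * M => v.1) d0.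
  have dm : diff cM m' = 0 := congr1 (fun v : E * M => v.2) d0.
  exists (twist cM 1 m').
    split; first by rewrite subrK in hm'; apply: homogeneous_twist hm'.
    have := twist_diff cM 1 m'; rewrite dm twist0 sg1 => /esym/eqP.
    by rewrite oppr_eq0 => /eqP.
  exists (- e'); first exact: homogeneousN.
  by rewrite diffN -de opprD addrCA subrr addr0.
Qed.
End Splitting.

Lemma theta_lift (A : dgRing) (hA : nonpositive A) (J : lmodType (H0 A)) (h : hull J)
    (N : dgModule A) (f0 : {linear H 0 N -> J}) :
  exists phi : dgHom N (coext_dgModule h),
    forall x, coext_theta h hA (H_map 0 phi x) = f0 x.
Proof.
have [phi phiE] := strict_lift h f0; exists phi; elim/cohP => z hz.
by apply: (hull_in_inj (h := h)); rewrite H_map_coh coext_thetaE phiE.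
Qed.

Lemma injective_model (A : dgRing) (hA : nonpositive A) (M : dgModule A) :
  (forall n, n < 0 -> H_zero n (M : D A)) ->
  (forall N : D A, bounded N -> (forall n, n < 0 -> H_zero n N) ->
     Ext_zero 1 N (M : D A)) ->
  injective_module (H 0 M : Mod (H0 A)) /\
  exists (h : hull (H 0 M)) (phi : dgHom M (coext_dgModule h)),
    @quasi_iso A M (coext_dgModule h) phi.
Proof.
move=> M0 M_ext.
have injM : injective_module (H 0 M : Mod (H0 A)).
  have [J [e [injJ inje]]] := enough_injectives (H 0 M).
  have [h _] := hull_exists injJ.
  have [phi phiE] := theta_lift hA h e.
  have phi_inj : injective (H_map 0 phi).
    by move=> x y exy; apply: inje; rewrite -!phiE exy.
  have [s [sK _]] := cone_splitting hA M_ext (lexx 0) (cone_H_neg hA M0 phi_inj).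
  (* On H^0, the part of [x] left after splitting off its image in the cone comes from [M]; this
     defines a retraction of H^0(E) onto H^0(M). *)
  have /choice[r rE] x : exists y, x - s (H_map 0 (cone_in phi) x) = H_map 0 phi y.
    by apply: (cone_in_ker hA); rewrite linearB sK subrr.
  have rL : linear r.
    move=> a x y; apply: phi_inj; rewrite [RHS]linearP -!rE.
    rewrite (linearP (H_map 0 (cone_in phi)) a x y) (linearP s).
    by rewrite scalerBr opprD addrACA.
  apply: (@injective_retract _ _ _ (H_map 0 phi) (pack_linear rL)).
    by move=> x; apply: phi_inj; rewrite /= -rE cone_in_phi linear0 subr0.
  exact: coext_H0_injective.
split=> //; have [h _] := hull_exists injM.
have [phi phiE] := theta_lift hA h idfun.
exists h, phi; apply: quasi_iso_of_acyclic_cone.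
have phi_inj : injective (H_map 0 phi) by move=> x y exy; rewrite -[x]phiE exy phiE.
have C_neg := cone_H_neg hA M0 phi_inj.
suff C_nat (k : nat) : H_zero k%:Z (cone phi : D A).
  by move=> n; have [n0|n0] := ltP n 0; [exact: C_neg|rewrite -(gez0_abs n0); exact: C_nat].
elim/ltn_ind: k => k IH.
have [|n nk|s [sK s0]] := cone_splitting (phi := phi) hA M_ext (c := k%:Z).
- by [].
- have [n0|n0] := ltP n 0; first exact: C_neg.
  by rewrite -(gez0_abs n0); apply: IH; lia.
move=> x; rewrite -[x]sK; have [k0|k0] := posnP k; last by rewrite s0 ?linear0.
subst k; set y := s x.
(* With [J] equal to H^0(M), [phi] is bijective on H^0, so the map to the cone vanishes there. *)
have -> : y = H_map 0 phi (coext_theta h hA y).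
  by apply: (@coext_theta_inj _ _ h hA); rewrite phiE.
by rewrite cone_in_phi.
Qed.

(** * Semi-free resolutions *)

Section FreeModule.
Variables (A : pzRingType) (S : choiceType).

Definition finite_support (f : S -> A^o) :=
  exists s : seq S, forall c, c \notin s -> f c = 0.

Lemma finite_support_axiom : submodule_axiom finite_support.
Proof.
split=> [|a f g [s hs] [t ht]]; first by exists [::].
exists (s ++ t) => c; rewrite mem_cat negb_or => /andP[cs ct].
by rewrite -[LHS]/(a *: f c + g c) hs // ht // scaler0 addr0.
Qed.

Definition free_module := submodule finite_support_axiom.
HB.instance Definition _ := GRing.Lmodule.on free_module.

Definition coef (f : free_module) (c : S) : A := val f c.

Lemma coef_ext f g : coef f =1 coef g -> f = g.
Proof. by move=> e; apply: val_inj; apply/funext. Qed.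

Lemma coefB f g c : coef (f - g) c = coef f c - coef g c.
Proof. by []. Qed.

Lemma coefZ a f c : coef (a *: f) c = a * coef f c.
Proof. by []. Qed.

Lemma coef_fin f : exists s : seq S, forall c, c \notin s -> coef f c = 0.
Proof. exact: subP f. Qed.

Lemma mono_axiom a c : finite_support (fun c' => if c' == c then a else 0).
Proof. by exists [:: c] => c'; rewrite inE => /negbTE ->. Qed.

Definition mono a c : free_module := mk_sub finite_support_axiom (mono_axiom a c).

Lemma coef_mono a c c' : coef (mono a c) c' = if c' == c then a else 0.
Proof. by []. Qed.

Lemma monoB c : subtractive (mono^~ c).
Proof.
move=> a b; apply: coef_ext => c'; rewrite coefB !coef_mono.
by case: eqP; rewrite ?subrr.
Qed.

Lemma scale_mono a b c : a *: mono b c = mono (a * b) c.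
Proof.
by apply: coef_ext => c'; rewrite coefZ !coef_mono; case: eqP; rewrite ?mulr0.
Qed.

Section Extension.
Variables (W : zmodType) (beta : S -> A -> W).
Hypothesis betaB : forall c, subtractive (beta c).

Definition free_ext (f : free_module) : W :=
  \sum_(c <- undup (projT1 (cid (coef_fin f)))) beta c (coef f c).

Lemma free_ext_sum f s : uniq s -> (forall c, c \notin s -> coef f c = 0) ->
  free_ext f = \sum_(c <- s) beta c (coef f c).
Proof.
move=> us hs; rewrite /free_ext; case: cid => t ht /=.
suff sub r r' : uniq r -> uniq r' -> {subset r <= r'} ->
    (forall c, c \notin r -> coef f c = 0) ->
    \sum_(c <- r') beta c (coef f c) = \sum_(c <- r) beta c (coef f c).
  rewrite -(sub (undup t) (undup (t ++ s))) ?undup_uniq //.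
  - by apply: sub; rewrite ?undup_uniq // => c; rewrite mem_undup mem_cat orbC => ->.
  - by move=> c; rewrite !mem_undup mem_cat => ->.
  - by move=> c; rewrite mem_undup; apply: ht.
move=> ur ur' rr' hr; rewrite (bigID (mem r)) /= [X in _ + X]big1_seq ?addr0; last first.
  by move=> c /andP[/hr -> _]; rewrite (sub_f0 (betaB c)).
rewrite -big_filter; apply: perm_big; apply: uniq_perm => //; first exact: filter_uniq.
by move=> c; rewrite mem_filter; apply: andb_idr; apply: rr'.
Qed.

Lemma free_extB : subtractive free_ext.
Proof.
move=> f g; have [s hs] := coef_fin f; have [t ht] := coef_fin g.
have hs' c : c \notin undup (s ++ t) -> coef f c = 0.
  by rewrite mem_undup mem_cat negb_or => /andP[/hs].
have ht' c : c \notin undup (s ++ t) -> coef g c = 0.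
  by rewrite mem_undup mem_cat negb_or => /andP[_ /ht].
rewrite !(free_ext_sum (s := undup (s ++ t))) ?undup_uniq //.
  by rewrite -sumrB; apply: eq_bigr => c _; rewrite coefB betaB.
by move=> c cst; rewrite coefB hs' // ht' // subrr.
Qed.

Lemma free_ext_mono a c : free_ext (mono a c) = beta c a.
Proof.
rewrite (free_ext_sum (s := [:: c])) // => [|c'].
  by rewrite big_seq1 coef_mono eqxx.
by rewrite inE coef_mono => /negbTE ->.
Qed.
End Extension.

Lemma free_sum f : exists s : seq S, f = \sum_(c <- s) mono (coef f c) c.
Proof.
have [s hs] := coef_fin f; exists (undup s); apply: coef_ext => c.
have coef_f0 : subtractive (coef^~ c) by [].
rewrite (sub_f_sum coef_f0); under eq_bigr do rewrite coef_mono.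
have [cs|cs] := boolP (c \in undup s).
  rewrite (bigD1_seq c) ?undup_uniq //= eqxx big1_seq ?addr0 // => c' /andP[+ _].
  by rewrite eq_sym => /negbTE ->.
rewrite big1_seq => [|c' /andP[_ c's]]; first by rewrite hs // -mem_undup.
by case: eqP => // e; rewrite e c's in cs.
Qed.

Lemma free_ind (Q : free_module -> Prop) :
  Q 0 -> (forall x y, Q x -> Q y -> Q (x + y)) -> (forall a c, Q (mono a c)) ->
  forall x, Q x.
Proof.
by move=> Q0 QD Qm x; have [s ->] := free_sum x; elim/big_rec: _ => // c y _; apply: QD.
Qed.
End FreeModule.

Section SemiFree.
Variables (A : dgRing) (S : choiceType) (deg : S -> int).
Local Notation F := (free_module A S).
Local Notation cA := (dgr_cpx A).
Variable bd : S -> F.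

Lemma free_gpr_axiom n (f : F) : finite_support (fun c => gpr cA (n - deg c) (coef f c)).
Proof. by have [s hs] := coef_fin f; exists s => c /hs ->; rewrite gpr0. Qed.

Definition free_gpr n (f : F) : F := mk_sub (finite_support_axiom A S) (free_gpr_axiom n f).

Lemma coef_gpr n f c : coef (free_gpr n f) c = gpr cA (n - deg c) (coef f c).
Proof. by []. Qed.

Definition free_diff : F -> F :=
  free_ext (fun c a => mono (diff cA a) c + twist cA 1 a *: bd c).

Let betaB c : subtractive (fun a => mono (diff cA a) c + twist cA 1 a *: bd c : F).
Proof. by move=> a b; rewrite diffB twistB monoB scalerBl opprD addrACA. Qed.

Lemma free_diffB : subtractive free_diff.
Proof. exact: free_extB. Qed.

Lemma free_diff_mono a c : free_diff (mono a c) = mono (diff cA a) c + twist cA 1 a *: bd c.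
Proof. exact: free_ext_mono. Qed.

Lemma free_homogeneous_ind (Q : F -> Prop) :
  Q 0 -> (forall x y, Q x -> Q y -> Q (x + y)) ->
  (forall j a c, homogeneous cA j a -> Q (mono a c)) -> forall x, Q x.
Proof.
move=> Q0 QD Qm; apply: free_ind => // a c.
elim/(@gpr_ind _ cA): a => [|a b Qa Qb|j a ha]; last exact: Qm ha.
- by rewrite (sub_f0 (@monoB A S c)).
- by rewrite (sub_fD (@monoB A S c)); apply: QD.
Qed.

Lemma free_subtractive_ext (W : zmodType) (f g : F -> W) : subtractive f -> subtractive g ->
  (forall j a c, homogeneous cA j a -> f (mono a c) = g (mono a c)) -> f =1 g.
Proof.
move=> fB gB e; apply: free_homogeneous_ind => [|x y ex ey|j a c ha]; last exact: e ha.
- by rewrite (sub_f0 fB) (sub_f0 gB).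
- by rewrite (sub_fD fB) (sub_fD gB) ex ey.
Qed.

Lemma free_gprB n : subtractive (free_gpr n).
Proof. by move=> f g; apply: coef_ext => c; rewrite coefB !coef_gpr coefB gprB. Qed.

Lemma free_gprK m n f : free_gpr m (free_gpr n f) = if m == n then free_gpr n f else 0.
Proof.
apply: coef_ext => c; rewrite !coef_gpr gprK (inj_eq (addIr _)).
by case: eqP.
Qed.

Lemma free_gpr_fin f : exists s : seq int, forall n, n \notin s -> free_gpr n f = 0.
Proof.
elim/free_homogeneous_ind: f => [|x y [s hs] [t ht]|j a c ha].
- by exists [::] => n _; apply: (sub_f0 (free_gprB n)).
- exists (s ++ t) => n; rewrite mem_cat negb_or => /andP[ns nt].
  by rewrite (sub_fD (free_gprB n)) hs // ht // addr0.
- exists [:: j + deg c] => n; rewrite inE => nj; apply: coef_ext => c'.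
  rewrite coef_gpr coef_mono; case: eqP => [->|_]; last by rewrite gpr0.
  rewrite (gpr_homogeneous _ ha); case: eqP => // e.
  by rewrite -e subrK eqxx in nj.
Qed.

Lemma free_gpr_sep f : (forall n, free_gpr n f = 0) -> f = 0.
Proof.
move=> f0; apply: coef_ext => c; apply: (@gpr_sep _ cA) => n.
have := congr1 (fun x : F => coef x c) (f0 (n + deg c)).
by rewrite coef_gpr addrK.
Qed.

Definition free_homogeneous n f := free_gpr n f = f.

Lemma free_homogeneous_mono j a c :
  homogeneous cA j a -> free_homogeneous (j + deg c) (mono a c).
Proof.
move=> ha; apply: coef_ext => c'; rewrite coef_gpr !coef_mono.
by case: eqP => [->|_]; [rewrite addrK|rewrite gpr0].
Qed.

Lemma free_homogeneous_scale i j a f : homogeneous cA i a ->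
  free_homogeneous j f -> free_homogeneous (i + j) (a *: f).
Proof.
move=> ha hf; apply: coef_ext => c; rewrite coef_gpr coefZ.
rewrite (@gpr_scale A (regular_dgModule A) _ _ _ _ ha) /=.
rewrite (_ : i + j - deg c - i = j - deg c); last by lia.
by rewrite -{2}hf coef_gpr.
Qed.

Lemma free_homogeneousD n x y :
  free_homogeneous n x -> free_homogeneous n y -> free_homogeneous n (x + y).
Proof. by rewrite /free_homogeneous (sub_fD (free_gprB n)) => -> ->. Qed.

Lemma free_gpr_mono n j a c : homogeneous cA j a ->
  free_gpr n (mono a c) = if n == j + deg c then mono a c else 0.
Proof.
move=> ha; rewrite -(free_homogeneous_mono c ha) free_gprK.
by case: eqP => // ->.
Qed.

Lemma free_diff_scale i a f : homogeneous cA i a ->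
  free_diff (a *: f) = diff cA a *: f + sg i (a *: free_diff f).
Proof.
move=> ha; move: f; apply: free_subtractive_ext => [x y|x y|j b c _].
- by rewrite scalerBr free_diffB.
- by rewrite free_diffB !scalerBr sgB opprD addrACA.
rewrite scale_mono !free_diff_mono (@diff_scale A (regular_dgModule A) _ _ _ ha).
rewrite (@twist_scale A (regular_dgModule A) 1 _ _ _ ha) mul1r.
rewrite (sub_fD (@monoB A S c)) (sub_f_sg _ _ (@monoB A S c)) scalerDr sgD.
by rewrite !scale_mono sgZl scalerA addrA.
Qed.

Hypotheses (bd_deg : forall c, free_homogeneous (deg c + 1) (bd c))
  (bdK : forall c, free_diff (bd c) = 0).

Lemma free_gpr_diff n f : free_gpr (n + 1) (free_diff f) = free_diff (free_gpr n f).
Proof.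
move: f; apply: free_subtractive_ext => [x y|x y|j a c ha].
- by rewrite free_diffB free_gprB.
- by rewrite free_gprB free_diffB.
have hd : free_homogeneous (j + deg c + 1) (free_diff (mono a c)).
  rewrite free_diff_mono; apply: free_homogeneousD.
    by rewrite addrAC; apply/free_homogeneous_mono/homogeneous_diff.
  by rewrite -addrA; apply: free_homogeneous_scale (bd_deg c); apply: homogeneous_twist.
rewrite (free_gpr_mono _ _ ha) -hd free_gprK (inj_eq (addIr _)).
by case: eqP => _; rewrite ?hd // (sub_f0 free_diffB).
Qed.

Lemma free_diff_deg n f : free_gpr n f = f -> free_gpr (n + 1) (free_diff f) = free_diff f.
Proof. by move=> hf; rewrite free_gpr_diff hf. Qed.

Lemma free_diffK f : free_diff (free_diff f) = 0.
Proof.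
elim/free_homogeneous_ind: f => [|x y ex ey|j a c ha].
- by rewrite !(sub_f0 free_diffB).
- by rewrite !(sub_fD free_diffB) ex ey addr0.
rewrite free_diff_mono (sub_fD free_diffB) free_diff_mono diffK.
rewrite (sub_f0 (@monoB A S c)) add0r (free_diff_scale _ (homogeneous_twist 1 ha)) bdK.
by rewrite scaler0 sg0 addr0 twist_diff sg1 scaleNr addNr.
Qed.

Definition free_complex : complex_on F :=
  make_complex free_gprB free_gprK free_gpr_fin free_gpr_sep
    free_diffB free_diff_deg free_diffK.

Lemma free_leibniz i a f : homogeneous cA i a ->
  diff free_complex (a *: f) = diff cA a *: f + (isign A i * a) *: diff free_complex f.
Proof. by move=> ha; rewrite isignM sgZl; apply: free_diff_scale. Qed.

(** No filtration of the basis is assumed, so K-projectivity is not automatic; for cells it will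
    come from the well-foundedness of the type [cell]. *)
Definition free_dgModule : dgModule A :=
  @DGModule A F free_complex free_homogeneous_scale free_leibniz.

Lemma free_diff_gen c : diff free_complex (mono 1 c) = bd c.
Proof.
rewrite -[LHS]/(free_diff _) free_diff_mono diff1 (sub_f0 (@monoB A S c)) add0r.
by rewrite (twist_homogeneous _ (dgr1 A)) mulr0 scale1r.
Qed.

Lemma free_gen_homogeneous c : homogeneous free_complex (deg c) (mono 1 c).
Proof. by have := free_homogeneous_mono c (dgr1 A); rewrite add0r. Qed.

Section FreeMaps.
Variables (M : dgModule A) (k : int) (v : S -> M).
Hypothesis v_deg : forall c, homogeneous (dgm_cpx M) (deg c + k) (v c).

Definition free_map : F -> M := free_ext (fun c a => twist cA k a *: v c).

Let gammaB c : subtractive (fun a => twist cA k a *: v c).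
Proof. by move=> a b; rewrite twistB scalerBl. Qed.

Lemma free_mapB : subtractive free_map.
Proof. exact: free_extB. Qed.

Lemma free_map_mono a c : free_map (mono a c) = twist cA k a *: v c.
Proof. exact: free_ext_mono. Qed.

Lemma free_map_gen c : free_map (mono 1 c) = v c.
Proof. by rewrite free_map_mono (twist_homogeneous _ (dgr1 A)) mulr0 scale1r. Qed.

Lemma free_map_hom_degree : hom_degree (P := free_dgModule) k free_map.
Proof.
split; first exact: free_mapB.
- move=> n x; rewrite /homogeneous -[gpr _ n x]/(free_gpr n x) => <-.
  elim/free_homogeneous_ind: x => [|x y hx hy|j a c ha].
  + by rewrite (sub_f0 (free_gprB n)) (sub_f0 free_mapB) gpr0.
  + by rewrite (sub_fD (free_gprB n)) (sub_fD free_mapB) gprD hx hy.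
  + rewrite (free_gpr_mono _ _ ha); case: eqP => [->|_]; last by rewrite (sub_f0 free_mapB) gpr0.
    by rewrite free_map_mono -addrA; apply: dgmZ (v_deg c); apply: homogeneous_twist.
- move=> j a x ha; rewrite isignZ; move: x; apply: free_subtractive_ext => [x y|x y|i b c _].
  + by rewrite scalerBr free_mapB.
  + by rewrite free_mapB scalerBr sgB.
  rewrite scale_mono !free_map_mono (@twist_scale A (regular_dgModule A) k _ _ _ ha).
  by rewrite sgZl scalerA.
Qed.
End FreeMaps.

Lemma hom_degree_eq_gen (M : dgModule A) i (f g : free_dgModule -> M) (x : free_dgModule) :
  hom_degree i f -> hom_degree i g ->
  (forall c, f (mono 1 c) = g (mono 1 c)) -> f x = g x.
Proof.
move=> [fB _ fZ] [gB _ gZ] e; move: x; apply: free_subtractive_ext => // j a c ha.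
by rewrite -[a]mulr1 -scale_mono (fZ _ _ _ ha) (gZ _ _ _ ha) e.
Qed.

End SemiFree.

Lemma hom_diff_degree (A : dgRing) (P M : dgModule A) k (g : P -> M) :
  hom_degree k g -> hom_degree (k + 1) (hom_diff k g).
Proof.
move=> [gB gh gZ]; split.
- by move=> x y; rewrite /hom_diff !isignZ gB !diffB gB sgB !opprD !opprK addrACA.
- move=> n x hx; rewrite /hom_diff isignZ; apply: homogeneousB.
    by rewrite addrA; apply/homogeneous_diff/gh.
  by rewrite [k + 1]addrC addrA; apply/homogeneous_sg/gh/homogeneous_diff.
- move=> j a x ha; rewrite /hom_diff !isignZ (gZ _ _ _ ha) (diff_scale _ ha).
  rewrite (sub_fD gB) (gZ _ _ _ (homogeneous_diff ha)) (sub_f_sg _ _ gB) (gZ _ _ _ ha).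
  rewrite !isignZ diff_sg (diff_scale _ ha) !sgD scalerBr sgB sgZr -!sg_add opprD addrACA.
  rewrite (@eq_sg _ (k + k * (j + 1)) (k * j)); last first.
    by rewrite !odd_intE; case: (odd_int k); case: (odd_int j).
  rewrite subrr add0r; congr (_ - _); apply: eq_sg; rewrite !odd_intE;
    by case: (odd_int k); case: (odd_int j).
Qed.

(* A cell of degree [i] attached along the formal combination [l], to be sent to
   [n]. All possible attachments are indexed at once by well-founded trees, which
   replaces the usual transfinite union of stages of a semi-free resolution. *)
Inductive cell (A : dgRing) (N : dgModule A) :=
  Cell of int & seq (A * cell N) & N.

(** * The resolution by cells *)

Section CellResolution.
Variables (A : dgRing) (N : dgModule A).
Local Notation cA := (dgr_cpx A).
Local Notation cN := (dgm_cpx N).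

HB.instance Definition _ := gen_eqMixin (cell N).
HB.instance Definition _ := gen_choiceMixin (cell N).

Local Notation F := (free_module A (cell N)).

Fixpoint cell_ind' (P : cell N -> Prop)
  (IH : forall i l n, foldr (fun p Q => P p.2 /\ Q) True l -> P (Cell i l n))
  (c : cell N) : P c :=
  match c with
  | Cell i l n => IH i l n
      ((fix all (l : seq (A * cell N)) : foldr (fun p Q => P p.2 /\ Q) True l :=
         match l with
         | [::] => I
         | (_, c') :: l' => conj (cell_ind' IH c') (all l')
         end) l)
  end.

Definition cell_deg (c : cell N) : int := let: Cell i _ _ := c in i.

Definition realize (l : seq (A * cell N)) : F := foldr (fun p x => mono p.1 p.2 + x) 0 l.

Lemma realize_surj (x : F) : exists l, realize l = x.
Proof.
have [s ->] := free_sum x; exists [seq (coef x c, c) | c <- s].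
elim: s => [|c s IH]; first by rewrite big_nil.
by rewrite big_cons -IH.
Qed.

(** [z] and [e] stand for the differential and the image of [realize l]. They are parameters because
    [cell_val] has to compute them during its own recursion, before [cell_diff] and [cell_map] are
    available. *)
Definition valid_attachment (i : int) (l : seq (A * cell N)) (n : N) (z : F) (e : N) :=
  [/\ free_homogeneous cell_deg (i + 1) (realize l), z = 0, e = diff cN n
    & homogeneous cN i n].

(* Boundary and image of the generator of a cell; both are [0] if the attaching
   data are not those of a cocycle of the right degree. *)
Fixpoint cell_val (c : cell N) : F * N :=
  match c with
  | Cell i l n =>
    let z := foldr (fun p x =>
      mono (diff cA p.1) p.2 + twist cA 1 p.1 *: (cell_val p.2).1 + x) 0 l in
    let e := foldr (fun p x => p.1 *: (cell_val p.2).2 + x) 0 l in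
    if `[< valid_attachment i l n z e >] then (realize l, n) else (0, 0)
  end.

Definition cell_bd (c : cell N) : F := (cell_val c).1.
Definition cell_im (c : cell N) : N := (cell_val c).2.

Definition cell_diff : F -> F := free_diff cell_bd.
Definition cell_map : F -> N := free_map 0 cell_im.

Lemma cell_valE i l n : cell_val (Cell i l n) =
  if `[< valid_attachment i l n (cell_diff (realize l)) (cell_map (realize l)) >]
  then (realize l, n) else (0, 0).
Proof.
rewrite /= (_ : foldr _ 0 l = cell_diff (realize l)).
  rewrite (_ : foldr _ 0 l = cell_map (realize l)) //.
  elim: l => [|[a c] l IH] /=; first exact/esym/(sub_f0 (free_mapB _ _)).
  rewrite IH [RHS](sub_fD (free_mapB _ _)); congr (_ + _).
  by rewrite /cell_map free_map_mono twist_by0.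
elim: l => [|[a c] l IH] /=; first exact/esym/(sub_f0 (@free_diffB _ _ _)).
rewrite IH [RHS](sub_fD (@free_diffB _ _ _)); congr (_ + _).
by rewrite free_diff_mono.
Qed.

Lemma cell_bd_deg c : free_homogeneous cell_deg (cell_deg c + 1) (cell_bd c).
Proof.
case: c => i l n; rewrite /cell_bd cell_valE.
by case: asboolP => [[hl _ _ _]|_] //=; apply: (sub_f0 (free_gprB _ _)).
Qed.

Lemma cell_bdK c : free_diff cell_bd (cell_bd c) = 0.
Proof.
case: c => i l n; rewrite {2}/cell_bd cell_valE.
by case: asboolP => [[_ dl _ _]|_] //=; apply: (sub_f0 (@free_diffB _ _ _)).
Qed.

Lemma cell_im_deg c : homogeneous cN (cell_deg c + 0) (cell_im c).
Proof.
case: c => i l n; rewrite addr0 /cell_im cell_valE.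
by case: asboolP => [[_ _ _ hn]|_] //=; apply: homogeneous0.
Qed.

Lemma cell_im_bd c : cell_map (cell_bd c) = diff cN (cell_im c).
Proof.
case: c => i l n; rewrite /cell_bd /cell_im cell_valE.
case: asboolP => [[_ _ el _]|_] //=.
by rewrite diff0; apply: (sub_f0 (free_mapB _ _)).
Qed.

Definition cell_dgModule : dgModule A := free_dgModule cell_bd_deg cell_bdK.
Local Notation P := cell_dgModule.
Local Notation cP := (dgm_cpx P).

Lemma cell_augmentation : exists eps : dgHom P N, forall x, eps x = cell_map x.
Proof.
have [fB fh fZ] := free_map_hom_degree cell_bd_deg cell_bdK cell_im_deg.
apply: (@make_dgHom A P N cell_map) => //.
- by move=> i a x ha; have := fZ _ _ x ha; rewrite mul0r isignZ.
- by move=> n x hx; have := fh _ _ hx; rewrite addr0.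
apply: (@free_subtractive_ext A (cell N) N (fun x => cell_map (diff cP x))
  (fun x => diff cN (cell_map x))).
- by move=> x y; rewrite diffB; apply: fB.
- by move=> x y; rewrite -diffB; congr diff; apply: fB.
move=> j a c ha; rewrite -[diff cP _]/(free_diff _ _) free_diff_mono.
rewrite [LHS](sub_fD fB) /cell_map !free_map_mono !twist_by0.
rewrite (diff_scale _ ha) (twist_homogeneous _ ha) mul1r sgZl.
rewrite (sub_f_sg _ _ fB) -cell_im_bd; congr (_ + sg _ _).
by have := fZ _ _ (cell_bd c) ha; rewrite mul0r isignZ.
Qed.

(** A cocycle of [P] whose image is exact bounds the cell attached along it; a cocycle of [N] is the
    image of a cell attached along nothing. *)
Lemma cell_quasi_iso (eps : dgHom P N) :
  (forall x, eps x = cell_map x) -> @quasi_iso A P N eps.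
Proof.
move=> epsE; apply/quasi_isoP => n; split.
- apply/H_map_injP => z [hz dz] [y hy dy].
  have [l zE] := realize_surj z.
  pose c := Cell (n - 1) l y.
  have cE : cell_bd c = z.
    rewrite /cell_bd /c cell_valE; case: asboolP => // -[].
    by split=> //; rewrite zE // ?subrK // dy epsE.
  exists (mono 1 c); first exact: (free_gen_homogeneous cell_bd_deg cell_bdK c).
  by rewrite -[LHS]/(diff (free_complex cell_bd_deg cell_bdK) (mono 1 c)) free_diff_gen.
- apply/H_map_surjP => t [ht dt].
  pose c := Cell n [::] t.
  have val : cell_val c = (0, t).
    rewrite /c cell_valE; case: asboolP => // -[]; split=> //=.
    + exact: (sub_f0 (free_gprB _ _)).
    + exact: (sub_f0 (@free_diffB _ _ _)).
    + by rewrite dt; apply: (sub_f0 (free_mapB _ _)).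
  exists (mono 1 c); last first.
    rewrite epsE /cell_map free_map_gen /cell_im val subrr.
    by exists 0; [exact: homogeneous0|exact: diff0].
  split; first exact: (free_gen_homogeneous cell_bd_deg cell_bdK c).
  rewrite -[LHS]/(diff (free_complex cell_bd_deg cell_bdK) (mono 1 c)) free_diff_gen.
  by rewrite /cell_bd val.
Qed.

Section KProjective.
Variables (M : dgModule A) (k : int) (f : P -> M).
Local Notation cM := (dgm_cpx M).
Hypotheses (M0 : acyclic M) (f_deg : hom_degree (k + 1) f)
  (f_cocycle : hom_diff (k + 1) f = (fun=> 0)).

Definition primitive (n : int) (t : M) : M :=
  match pselect (exists m, homogeneous cM n m /\ diff cM m = t) with
  | left ex => projT1 (cid ex)
  | right _ => 0
  end.

Lemma primitive_homogeneous n t : homogeneous cM n (primitive n t).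
Proof.
rewrite /primitive; case: pselect => [ex|_]; last exact: homogeneous0.
by case: (projT2 (cid ex)).
Qed.

Lemma primitiveK n t : homogeneous cM (n + 1) t -> diff cM t = 0 ->
  diff cM (primitive n t) = t.
Proof.
move=> ht dt; rewrite /primitive; case: pselect => [ex|[]].
  by case: (projT2 (cid ex)).
have [|m hm dm] := (H_zeroP (n + 1) M).1 (@M0 (n + 1)) t; first by split.
by exists m; rewrite addrK in hm.
Qed.

(** A null-homotopy of [f], built on generators: its value at [c] has to be a primitive of f(c) plus
    (-1)^k times its value on the boundary of [c]. The test handles invalid attaching data, for
    which the boundary is 0 instead of [realize l]. *)
Fixpoint cell_htpy (c : cell N) : M :=
  match c with
  | Cell i l n =>
    let g := foldr (fun p x => twist cA k p.1 *: cell_htpy p.2 + x) 0 l in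
    primitive (i + k) (f (mono 1 c) +
      sg k (if `[< cell_bd c = realize l >] then g else 0))
  end.

Lemma cell_htpyE c : cell_htpy c =
  primitive (cell_deg c + k) (f (mono 1 c) + sg k (free_map k cell_htpy (cell_bd c))).
Proof.
case: c => i l n; rewrite [LHS]/=; congr (primitive _ (_ + sg _ _)).
have gB := free_mapB k cell_htpy.
case: asboolP => [->|nbd].
  elim: l => [|[a c] l IH] /=; first by rewrite (sub_f0 gB).
  by rewrite IH [RHS](sub_fD gB) free_map_mono.
suff -> : cell_bd (Cell i l n) = 0 by rewrite (sub_f0 gB).
by move: nbd; rewrite /cell_bd cell_valE; case: asboolP.
Qed.

Lemma cell_htpy_deg c : homogeneous cM (cell_deg c + k) (cell_htpy c).
Proof. by rewrite cell_htpyE; apply: primitive_homogeneous. Qed.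

Let g : P -> M := free_map k cell_htpy.

Let g_deg : hom_degree k g := free_map_hom_degree cell_bd_deg cell_bdK cell_htpy_deg.

(** By induction the equation holds on the boundary of [c]. With [f_cocycle] this makes the element
    handed to [primitive] a cocycle, and it has a primitive because [M] is acyclic. *)
Lemma cell_htpy_diff c : hom_diff k g (mono 1 c : F) = f (mono 1 c : F).
Proof.
have [fB fh fZ] := f_deg.
have [gB gh gZ] := g_deg.
have [hgB _ hgZ] := hom_diff_degree g_deg.
elim/cell_ind': c => i l n IH; set c := Cell i l n.
have bd_eq : hom_diff k g (cell_bd c) = f (cell_bd c).
  have : cell_bd c = realize l \/ cell_bd c = 0.
    by rewrite /cell_bd cell_valE; case: asboolP => _; [left|right].
  case=> ->; last by rewrite (sub_f0 hgB) (sub_f0 fB).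
  elim: l IH {c} => [|[a c] l IHl] /=; first by rewrite (sub_f0 hgB) (sub_f0 fB).
  move=> [ec /IHl el]; rewrite [LHS](sub_fD hgB) [RHS](sub_fD fB) el; congr (_ + _).
  apply: (@subtractive_ext _ cA _ (fun a => hom_diff k g (mono a c : F))
    (fun a => f (mono a c : F))).
  - by move=> x y; rewrite [mono _ _]monoB hgB.
  - by move=> x y; rewrite [mono _ _]monoB fB.
  move=> j b hb; rewrite -[b]mulr1 -scale_mono.
  by rewrite [LHS](hgZ _ _ _ hb) [RHS](fZ _ _ _ hb) ec.
have bd_c : diff cP (mono 1 c : F) = cell_bd c := free_diff_gen cell_bd_deg cell_bdK c.
have gc : g (mono 1 c : F) = cell_htpy c := free_map_gen k cell_htpy c.
have hc : homogeneous cP i (mono 1 c : F) := free_gen_homogeneous cell_bd_deg cell_bdK c.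
have dbd : diff cP (cell_bd c) = 0 := cell_bdK c.
have hbd : homogeneous cP (i + 1) (cell_bd c) := cell_bd_deg c.
rewrite /hom_diff isignZ gc bd_c cell_htpyE -/g -/c.
rewrite primitiveK ?addrK //.
  apply: homogeneousD; first by rewrite -addrA; apply: fh.
  by apply: homogeneous_sg; have := gh _ _ hbd; rewrite addrAC.
have df := congr1 (fun u : P -> M => u (mono 1 c : F)) f_cocycle.
move: df bd_eq; rewrite /hom_diff !isignZ bd_c dbd (sub_f0 gB) sg0 subr0.
move=> /eqP; rewrite subr_eq0 => /eqP df dg.
rewrite diffD df diff_sg dg (@eq_sg _ (k + 1) (1 + k)) ?sg_add ?sg1 ?addNr //.
by rewrite addrC.
Qed.

Lemma cell_contraction : exists2 g, hom_degree k g & hom_diff k g = f.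
Proof.
exists g => //; apply/funext => x.
apply: (@hom_degree_eq_gen _ _ _ _ cell_bd_deg cell_bdK M (k + 1)) => //.
  exact: hom_diff_degree.
exact: cell_htpy_diff.
Qed.
End KProjective.

Lemma cell_K_projective : K_projective P.
Proof.
move=> M M0 i f hf df.
have e : i = i - 1 + 1 by rewrite subrK.
by rewrite e in hf df; apply: (cell_contraction M0 hf df).
Qed.
End CellResolution.

Lemma K_projective_resolution (A : dgRing) (N : dgModule A) :
  exists (P : dgModule A) (p : dgHom P N), K_projective P /\ @quasi_iso A P N p.
Proof.
have [eps epsE] := cell_augmentation N.
exists (cell_dgModule N), eps; split; first exact: cell_K_projective.
exact: cell_quasi_iso.
Qed.

(** * The equivalence *)

Section CoextensionInjective.
Variables (A : dgRing) (hA : nonpositive A) (J : lmodType (H0 A)) (h : hull J).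
Local Notation E := (coext_dgModule h).

Lemma coext_H_neg n : n < 0 -> H_zero n (E : D A).
Proof.
move=> n0; apply/H_zeroP => z [hz _]; rewrite (coext_nonneg hA n0 hz).
by exists 0; [exact: homogeneous0|exact: diff0].
Qed.

(** When H^0(E) = 0, the identity and the zero endomorphism agree on H^0, hence in the derived
    category. *)
Lemma coext_isomorphic_zero :
  (forall x : H 0 E, x = 0) -> @isomorphic (D A) E (zero_dgModule A).
Proof.
move=> E0; have [u uE] := dgHom_zero_exists E (zero_dgModule A).
have [v vE] := dgHom_zero_exists (zero_dgModule A) E.
exists (loc_arr u), (loc_arr v); split; rewrite loc_arr_comp.
- apply: (coext_faithful_strict hA (g := dgHom_id E)).
  by apply: linear_eq => x; rewrite [LHS]E0 [RHS]E0.
- congr (loc_arr _); apply: dgHom_eq => x.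
  by rewrite [LHS]thinmx0 [RHS]thinmx0.
Qed.

(** Cocycles of degree [- i] in the resolution are exact, and a Hom cocycle sends exact elements to
    boundaries, on which evaluation at 1 vanishes; [coext_null_homotopic] then applies. *)
Lemma coext_Ext_zero (N : D A) i : H_zero (- i) N -> Ext_zero i N (E : D A).
Proof.
move=> N0; have [P [p [KP qp]]] := K_projective_resolution N.
exists P, p; split=> // f hf df.
apply: (coext_null_homotopic (hull_inj (h := h)) hf df) => x hx dx.
have P0 : H_zero (- i) (P : D A).
  have [ip _] := (quasi_isoP p).1 qp (- i).
  by move=> t; apply: ip; rewrite linear0; apply: N0.
have [y hy dy] := (H_zeroP (- i) P).1 P0 x (conj hx dx).
have := congr1 (fun u : P -> E => coext_eval (u y) 1) df.
rewrite /hom_diff isignZ dy coext_evalBl coext_eval_sg coext_eval_diff.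
rewrite diff1 twist0 (sub_f0 (coext_evalB _)) sub0r => /eqP.
by rewrite oppr_eq0 => /eqP /sg_eq0.
Qed.

Lemma coext_is_Inj : is_Inj (E : D A).
Proof.
have [E0|/existsNP[x0 x0n]] := pselect (forall x : H 0 E, x = 0).
  by left; apply: coext_isomorphic_zero.
right; split; apply/le_anti/andP; split.
- by apply: extinf_le => /(_ x0).
- by apply: inf_ge0 => n; apply: coext_H_neg.
- apply: extinf_le => N _ i; rewrite sub0e => Ni; apply: coext_Ext_zero.
  apply: contrapT => nz; move: Ni; apply/negP; rewrite -leNgt.
  by rewrite leeNr -EFinN; apply: extinf_le.
(* A bound [n < 0] would force Ext^0 from the truncation of [E] at 0 into [E] to vanish. The
   inclusion would then be zero on H^0, although it is bijective there and [x0] is nonzero. *)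
- apply: le_extinf => n Sn; rewrite lee_fin leNgt; apply/negP => n0.
  have N0 m : m < 0 -> H_zero m (trunc hA E 0 : D A).
    by move=> m0; apply: trunc_H_lt (coext_H_neg m0).
  have [|P [p [_ qp PE]]] := Sn (trunc hA E 0) (trunc_bounded hA coext_H_neg) 0.
    apply: (@le_lt_trans _ _ (n%:E)%E); last by rewrite lte_fin.
    move: (inf_ge0 N0); case: (inf _) => [r| |] //.
      by rewrite -EFinB !lee_fin gerBl.
    by move=> _; apply: leNye.
  apply: x0n; have [t <-] := (trunc_H_iso hA E 0).2 x0.
  have [y <-] := ((quasi_isoP p).1 qp 0).2 t.
  elim/cohP: y => z hz; rewrite !H_map_coh; apply/coh_eq0.
  pose psi := dgHom_comp (trunc_in hA E 0) p.
  have [||g [gB gh _] gd] := PE psi; first exact: dgHom_hom_degree.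
    by apply/funext => x; rewrite /hom_diff isignZ dgh_diff subrr.
  exists (g z); first by have := gh _ _ hz.1; rewrite add0r.
  by rewrite -[RHS]/(psi z) -gd /hom_diff hz.2 (sub_f0 gB) scaler0 subr0.
Qed.
End CoextensionInjective.

(** Zero objects do not have infimum 0 and are treated apart: there H^0(M) = 0, and the coextension
    of any hull of it is again a zero object. *)
Lemma Inj_model (A : dgRing) (hA : nonpositive A) (M : D A) : is_Inj M ->
  injective_module (HD A 0 M) /\
  exists (J : lmodType (H0 A)) (h : hull J), @isomorphic (D A) M (coext_dgModule h).
Proof.
case=> [[u u_iso]|[infM idM]]; last first.
  have [n n0|N|injM [h [phi q]]] := @injective_model A hA M.
  - exact: inf_eq0_H_zero.
  - exact: inj_dim0_Ext.
  by split=> //; exists (H 0 M), h, (loc_arr phi); apply: loc_arr_is_iso.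
have M0 (x : H 0 M) : x = 0.
  apply: (is_iso_inj (fmap_iso (HD A 0) u_iso)).
  rewrite linear0; elim/cohP: (_ x) => z hz; apply/coh_eq0.
  by exists 0; [exact: homogeneous0|rewrite [LHS]thinmx0 [RHS]thinmx0].
have injM : injective_module (HD A 0 M).
  move=> U V i f _.
  have zL : linear (fun _ : V => 0 : H 0 M) by move=> a x y; rewrite scaler0 addr0.
  exists (pack_linear zL) => x.
  by rewrite [LHS]M0 [RHS]M0.
split=> //; have [h _] := hull_exists injM; exists (H 0 M), h.
have [x|v v_iso] := @coext_isomorphic_zero A hA _ h.
  by apply: (@coext_theta_inj _ _ h hA); rewrite [LHS]M0 [RHS]M0.
case: (v_iso) => w vw.
exists (@compm (D A) _ _ _ w u); apply: is_iso_comp u_iso.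
exact: inverse_is_iso vw.
Qed.

Theorem theorem1p2 (A : dgRing) (hA : nonpositive A) :
  exists H0_injective : forall I : D A, is_Inj I -> injective_module (HD A 0 I),
    is_equivalence
      (restrict_functor H0_injective : functor (Inj A) (InjMod (H0 A))).
Proof.
exists (fun I hI => (Inj_model hA hI).1).
apply: fully_faithful_equivalence.
(* For faithfulness and fullness only the target is replaced by a coextension, since [E] represents
   a functor on all of [D A]. *)
- move=> [N hN] [M hM] f g e.
  have [_ [J [h [w w_iso]]]] := Inj_model hA hM.
  apply: (@is_iso_mono (D A) N M _ w f g w_iso).
  apply: (coext_derived_faithful hA); rewrite !fmapM; congr compm.
  exact: e.
- move=> [N hN] [M hM] f0.
  have [_ [J [h [w w_iso]]]] := Inj_model hA hM.
  have [u uE] := coext_derived_full hA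
    (@compm (Mod (H0 A)) _ _ _ (fmap (HD A 0) w) f0 : {linear H 0 N -> H 0 (coext_dgModule h)}).
  have [w' [w'w ww']] := w_iso.
  exists (@compm (D A) _ _ _ w' u).
  rewrite -[LHS]/(fmap (HD A 0) (@compm (D A) _ _ _ w' u)) fmapM uE compmA -fmapM w'w fmap1.
  exact: comp1m.
- move=> [J injJ]; have [h _] := hull_exists injJ.
  exists (exist _ (coext_dgModule h : D A) (coext_is_Inj hA h)).
  exists (coext_theta h hA).
  have [g gP] := bijective_is_iso (@coext_theta_inj _ _ h hA) (@coext_theta_surj _ _ h hA).
  by exists g.
Qed.
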